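(* Let $1<p<\infty$, let $q$ be the conjugate exponent, $\frac1p+\frac1q=1$, let $n\ge 1$, and let $P_\Delta=\{(t,\tau)\in[0,1]\times[0,1]:\tau\le t\}$. Assume that $\Phi:P_\Delta\times\mathbb{R}^n\to\mathbb{R}^n$ satisfies the following conditions: (1) $\Phi(\cdot,\cdot,x)$ is measurable on $P_\Delta$ for any $x\in\mathbb{R}^n$, and $\Phi(t,\tau,\cdot)$ is continuously differentiable on $\mathbb{R}^n$ for a.e. $(t,\tau)\in P_\Delta$; (2) there exist functions $a,b\in L^p(P_\Delta,[0,\infty))$ such that $|\Phi(t,\tau,x)|\le a(t,\tau)|x|+b(t,\tau)$ for a.e. $(t,\tau)\in P_\Delta$ and all $x\in\mathbb{R}^n$, and there exists a constant $\overline a>0$ such that $\int_0^t a^p(t,\tau)\,d\tau\le\overline a^p$ for a.e. $t\in[0,1]$; (3) there exist functions $c\in L^p(P_\Delta,[0,\infty))$, $\alpha\in C([0,\infty),[0,\infty))$ and a constant $C>0$ such that $|\Phi_x(t,\tau,x)|\le c(t,\tau)\,\alpha(|x|)$ for a.e. $(t,\tau)\in P_\Delta$ and all $x\in\mathbb{R}^n$, and $\int_0^t c^q(t,\tau)\,d\tau\le C$ for a.e. $t\in[0,1]$. Then for any fixed $y\in L^p([0,1],\mathbb{R}^n)$ the problem $$x'(t)+\int_0^t\Phi(t,\tau,x(\tau))\,d\tau=y(t)\ \text{ for a.e. } t\in[0,1],\qquad x(0)=0,$$ has a unique solution $x_y\in\tilde W_0^{1,p}$. Moreover, the operator $$L^p([0,1],\mathbb{R}^n)\ni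 y\mapsto x_y\in\tilde W_0^{1,p},$$ which assigns to each $y$ the solution of this problem, is continuously differentiable.
   Context: $\tilde W_0^{1,p}=\tilde W_0^{1,p}([0,1],\mathbb{R}^n)$ is the space of absolutely continuous functions $x:[0,1]\to\mathbb{R}^n$ with $x(0)=0$ and a.e. derivative $x'\in L^p([0,1],\mathbb{R}^n)$, equipped with the norm $\|x\|_{\tilde W_0^{1,p}}=\left(\int_0^1|x'(t)|^p\,dt\right)^{1/p}$. $\Phi_x$ denotes the derivative (Jacobian matrix) of $\Phi$ with respect to the variable $x$. Continuously differentiable means continuously Fréchet differentiable between the Banach spaces. *)

(* Defs.v *)
From HB Require Import structures.
From mathcomp Require Import all_boot all_order all_algebra.
From mathcomp Require Import all_classical all_reals all_analysis.

Set Implicit Arguments.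
Unset Strict Implicit.
Unset Printing Implicit Defensive.

Import Order.TTheory GRing.Theory Num.Theory.
Import numFieldNormedType.Exports.

Local Open Scope classical_set_scope.
Local Open Scope ring_scope.

(* The library norm on matrices is the sup norm, hence the explicit norms. *)
Definition enorm {R : realType} {n : nat} (v : 'rV[R]_n) : R :=
  Num.sqrt (\sum_(i < n) v 0 i ^+ 2).

(* Matrices act on row vectors from the right, as in ['J f x]. *)
Definition opnorm {R : realType} {m n : nat} (A : 'M[R]_(m, n)) : R :=
  sup [set enorm (v *m A) | v in [set v : 'rV[R]_m | enorm v <= 1]].

(* [lebesgue_measure] lives on the Borel sigma-algebra. Being measurable for
   its completion amounts to agreeing a.e. with a Borel function; the library
   integral and [{ae _, _}] are insensitive to that modification. *)
Definition ae_measurable d (T : measurableType d) (R : realType)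
    (mu : {measure set T -> \bar R}) (D : set T) (f : T -> R) : Prop :=
  exists2 g : T -> R, measurable_fun D g & ae_eq mu D f g.

Definition Lp_scalar d (T : measurableType d) (R : realType)
    (mu : {measure set T -> \bar R}) (D : set T) (p : R) (f : T -> R) : Prop :=
  ae_measurable mu D f /\
  (\int[mu]_(z in D) (`|f z| `^ p)%:E < +oo)%E.

Definition leb2 (R : realType) := (@lebesgue_measure R \x @lebesgue_measure R)%E.
Arguments leb2 : clear implicits.

Definition PDelta (R : realType) : set (R * R) :=
  [set z | [/\ 0 <= z.1 <= 1, 0 <= z.2 <= 1 & z.2 <= z.1]].
Arguments PDelta : clear implicits.

Section function_spaces.
Context {R : realType} {n : nat}.
Implicit Types (p : R) (x y : R -> 'rV[R]_n).

(* Elements of L^p([0,1],R^n) are handled through representatives defined on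
   the whole of R; only the values on [0,1] matter. *)
Definition Lp p : set (R -> 'rV[R]_n) :=
  [set y : R -> 'rV[R]_n |
      (forall i, ae_measurable lebesgue_measure `[0, 1] (fun t : R => y t 0 i)) /\
      (\int[lebesgue_measure]_(t in `[0%R, 1%R]) (enorm (y t) `^ p)%:E < +oo)%E].

Definition Lp_norm p y : R :=
  (\int[lebesgue_measure]_(t in `[0, 1]) (enorm (y t) `^ p)) `^ p^-1.

Definition abs_continuous01 x : Prop :=
  forall e : R, 0 < e -> exists2 d : R, 0 < d &
  forall (m : nat) (u v : 'I_m -> R),
    (forall k, [/\ 0 <= u k, u k <= v k & v k <= 1]) ->
    trivIset setT (fun k => `]u k, v k[%classic) ->
    \sum_(k < m) (v k - u k) < d ->
    \sum_(k < m) enorm (x (v k) - x (u k)) < e.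

(* The derivability clause holds for every absolutely continuous function; it
   only records that [x^`()], total in the library, is the a.e. derivative. *)
Definition W01p p : set (R -> 'rV[R]_n) :=
  [set x : R -> 'rV[R]_n | [/\ abs_continuous01 x, x 0 = 0,
    {ae lebesgue_measure, forall t : R, `[0, 1]%classic t -> derivable x t 1}
    & Lp p (x^`())%classic]].

Definition W01p_norm p x : R := Lp_norm p (x^`())%classic.

Definition is_solution p (Phi : R -> R -> 'rV[R]_n -> 'rV[R]_n) y x : Prop :=
  W01p p x /\
  {ae lebesgue_measure, forall t : R, `[0, 1]%classic t ->
    (x^`())%classic t
    + \row_(i < n) (\int[lebesgue_measure]_(s in `[0, t]) (Phi t s (x s) 0 i))
    = y t}.

End function_spaces.

(* Frechet calculus between the normed spaces obtained from (D, NV) and (E, NW)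
   by identifying elements at seminorm distance 0, where D and E are linear
   subspaces of V and W carrying the seminorms NV and NW. Equalities in the
   target are therefore stated as [NW (_ - _) = 0]. *)
Section frechet.
Context {R : realType} {V W : lmodType R}.
Variables (D : set V) (NV : V -> R) (E : set W) (NW : W -> R).

Definition bounded_linear_op (A : V -> W) : Prop :=
  [/\ forall h, D h -> E (A h),
      forall (a : R) h k, D h -> D k ->
        NW (A (a *: h + k) - (a *: A h + A k)) = 0
    & exists K : R, forall h, D h -> NW (A h) <= K * NV h].

Definition is_frechet_derivative (F : V -> W) (y : V) (A : V -> W) : Prop :=
  bounded_linear_op A /\
  forall e : R, 0 < e -> exists2 d : R, 0 < d &
  forall h, D h -> NV h < d -> NW (F (y + h) - F y - A h) <= e * NV h.

Definition continuously_differentiable (F : V -> W) : Prop :=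
  (forall y, D y -> E (F y)) /\
  exists2 DF : V -> V -> W,
    forall y, D y -> is_frechet_derivative F y (DF y) &
    forall y, D y -> forall e : R, 0 < e -> exists2 d : R, 0 < d &
      forall z, D z -> NV (z - y) < d ->
      forall h, D h -> NW (DF z h - DF y h) <= e * NV h.

End frechet.

(* Main.v *)
(** On almost all of the triangle the kernel agrees with a Borel kernel [Psi],
    vanishing elsewhere, for which the hypotheses hold at every point, so the
    problem becomes x(t) = int_0^t (y - V x), with (V x)(s) = int_0^1 Psi(s,t,x(t)) dt.
    Growth (2) and Gronwall bound all solutions whose data have bounded L^1
    norm, and on the resulting ball (3) makes [Psi] Lipschitz with constant
    L c(t,s), where int c(t,s) ds is bounded. Picard iteration in a norm
    weighted by exp(-2Gt), applied to the kernel truncated by clipping the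
    coordinates, gives existence; Gronwall again gives uniqueness and Lipschitz
    dependence on the data, from L^1 to the sup norm for solutions.

    The candidate derivative in direction h is the solution v of the linear
    problem with kernel Psi_x(t,s,x(s)). The same estimates bound the derivative
    of the remainder x_(y+h) - x_y - v in L^p by the Taylor remainder of [Psi]
    along the solutions. Since |x_(y+h) - x_y| <= S |h|_1 pointwise, this
    remainder divided by |h|_1 tends to 0 pointwise and is dominated by a
    multiple of c, so two applications of dominated convergence make it o(1).
    Continuity of the derivative follows likewise from that of Psi_x.

    Internally R^n carries the library sup norm. *)
Require Import Defs.
From HB Require Import structures.
From mathcomp Require Import all_boot all_order all_algebra.
From mathcomp Require Import all_classical all_reals all_analysis.
From mathcomp Require Import measurable_realfun ring lra.

Set Implicit Arguments.
Unset Strict Implicit.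
Unset Printing Implicit Defensive.

Import Order.TTheory GRing.Theory Num.Theory.
Import numFieldNormedType.Exports.

Local Open Scope classical_set_scope.
Local Open Scope ring_scope.

(** * Measure theory on the unit interval *)

(** The obstacle is a circularity: the Lipschitz constant [L] depends on the radius of a ball, while
    the radius has to bound the solution still to be constructed. It disappears because the growth
    bound of the clipped kernel does not depend on the clipping radius, and hence neither does the
    Gronwall bound; the radius is fixed first and [L] afterwards. From the power bounds on the
    sections of [a] and [c] only [L^1] bounds are kept, by [r <= 1 + r ^ p]. The exponent [p]
    returns through the data and through [b], where Jensen's inequality on an interval of length one
    compares means with [p]-th powers. A priori bound, stability and both differentiability
    estimates are instances of one inequality, [volterra_estimate], with different coefficients and
    sources. Dominated convergence works along sequences, so the moduli of differentiability are
    found by contradiction. They are uniform in the direction [h] because the size of [h] is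
    factored out of the source before the limit is taken. *)

Section ae_integral.
Context d (T : measurableType d) (R : realType).
Variable mu : {measure set T -> \bar R}.
Import HBNNSimple.

(** The integral is a difference of suprema over simple functions below the positive and negative
    parts, and a simple function may be set to zero on a null set without changing its integral.
    Measurability of [f] and [g] is avoided because [Phi t s (x s)] need not be Borel in [s]. *)
Lemma ae_eq_integral_nonmeas (D : set T) (f g : T -> \bar R) :
  ae_eq mu D f g -> (\int[mu]_(x in D) f x = \int[mu]_(x in D) g x)%E.
Proof.
pose nn (f : T -> \bar R) := ereal_sup [set sintegral mu h |
  h in [set h : {nnsfun T >-> R} | forall x, ((h x)%:E <= f x)%E]].
have le_nn (u v : T -> \bar R) (N : set T) : measurable N -> mu N = 0%E ->
    (forall x, 0 <= v x)%E -> (forall x, ~ N x -> u x = v x) -> (nn u <= nn v)%E.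
  move=> mN N0 v0 uv; apply: ge_ereal_sup => _ [h /= hu <-].
  have mNC : measurable (~` N) by exact: measurableC.
  pose h' := proj_nnsfun h mNC.
  have h'E x : h' x = h x * \1_(~` N) x by [].
  apply: (@le_trans _ _ (sintegral mu h')); last first.
    apply: ereal_sup_ubound; exists h' => // x; rewrite h'E indicE.
    have [|xN] := boolP (x \in ~` N); last by rewrite mulr0 v0.
    by rewrite inE => /= /uv <-; rewrite mulr1.
  rewrite -!integralT_nnsfun le_eqVlt; apply/orP; left; apply/eqP.
  apply: ae_eq_integral => //; [exact/measurable_EFinP|exact/measurable_EFinP|].
  exists N; split=> // x /= /not_implyP [_] /= hh'; apply: contrapT => Nx.
  by apply: hh'; rewrite mindicE mem_set// mulr1.
move=> [N [mN N0 sN]].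
have fgN x : ~ N x -> (f \_ D) x = (g \_ D) x.
  move=> Nx; rewrite !patchE; case: ifPn => //; rewrite inE => Dx.
  by apply: contrapT => fg; apply: Nx; apply: sN => /= /(_ Dx).
rewrite /integral -!/(nn _); congr (_ - _)%E; apply/eqP; rewrite eq_le.
  by apply/andP; split; apply: (le_nn _ _ N) => // x Nx; rewrite !funeposE fgN.
by apply/andP; split; apply: (le_nn _ _ N) => // x Nx; rewrite !funenegE fgN.
Qed.

Lemma ae_eq_Rintegral_nonmeas (D : set T) (f g : T -> R) :
  ae_eq mu D f g -> \int[mu]_(x in D) f x = \int[mu]_(x in D) g x.
Proof.
move=> fg; congr fine; apply: ae_eq_integral_nonmeas.
by apply: filterS fg => x /[apply] ->.
Qed.

End ae_integral.

Lemma mx_coord_le (R : realType) (m n : nat) (M : 'M[R]_(m, n)) i j : `|M i j| <= `|M|.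
Proof.
rewrite [leRHS]mx_normrE.
exact: (le_bigmax _ (fun ij : 'I_m * 'I_n => `|M ij.1 ij.2|) (i, j)).
Qed.

Section row_norm.
Context (R : realType) (n : nat).
Implicit Types v : 'rV[R]_n.

Lemma row_coord_le v i : `|v 0 i| <= `|v|.
Proof. exact: mx_coord_le. Qed.

Lemma row_norm_le v M : 0 <= M -> (forall i, `|v 0 i| <= M) -> `|v| <= M.
Proof.
move=> M0 vM; rewrite [leLHS]mx_normrE; apply/bigmax_leP; split => //= -[i j] _.
by rewrite ord1 vM.
Qed.

Lemma cvg_row_coord (x : nat -> 'rV[R]_n) (l : 'rV[R]_n) i :
  x k @[k --> \oo] --> l -> x k 0 i @[k --> \oo] --> l 0 i.
Proof.
move=> /cvgrPdist_le xl; apply/cvgrPdist_le => e e0; apply: filterS (xl e e0) => k.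
by apply: le_trans; have := row_coord_le (l - x k) i; rewrite !mxE.
Qed.

End row_norm.

(** * Superposition with functions measurable in one variable and continuous in the other *)

Section caratheodory.
Context d (T : measurableType d) (R : realType) (n : nat).

Lemma measurable_row_norm (D : set T) (X : T -> 'rV[R]_n) :
  (forall i, measurable_fun D (fun z => X z 0 i)) ->
  measurable_fun D (fun z => `|X z|).
Proof.
move=> mX; have -> : (fun z => `|X z|) =
    (fun z => \big[Num.max/0]_(i < n) `|X z 0 i|).
  apply/funext => z; apply/eqP; rewrite eq_le; apply/andP; split.
    apply: row_norm_le => [|i]; first exact: bigmax_ge_id.
    exact: (le_bigmax _ (fun i => `|X z 0 i|)).
  by apply/bigmax_leP; split => // i _; exact: row_coord_le.
elim: (index_enum _) => [|i s ih].
  by under eq_fun do rewrite big_nil; exact: measurable_cst.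
under eq_fun do rewrite big_cons.
by apply: measurable_maxr => //; exact: measurableT_comp.
Qed.

Definition floor_row (k : nat) (v : 'rV[R]_n) : 'rV[R]_n :=
  \row_i ((Num.floor (k.+1%:R * v 0 i))%:~R / k.+1%:R).

Lemma floor_row_dist k (v : 'rV[R]_n) : `|v - floor_row k v| <= k.+1%:R^-1.
Proof.
have k0 : 0 < k.+1%:R :> R by rewrite ltr0n.
apply: row_norm_le => [|i]; first by rewrite invr_ge0 ltW.
rewrite !mxE -(ler_pM2l k0) divff ?gt_eqF// -{1}(gtr0_norm k0) -normrM.
rewrite mulrBr mulrCA divff ?gt_eqF// mulr1.
have := floor_itv (k.+1%:R * v 0 i); rewrite intrD => /andP[? ?].
by rewrite ger0_norm ?subr_ge0// lerBlDr addrC ltW.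
Qed.

(** Rounding [X] down to a grid leaves countably many values, and continuity in the second variable
    passes to the limit of fine grids. Measurability is asked at rational rows only, so that in the
    reduction a countable union of null sets suffices. *)
Lemma caratheodory_measurable (D : set T) (g : T -> 'rV[R]_n -> R)
    (X : T -> 'rV[R]_n) : measurable D ->
  (forall w : 'rV[rat]_n, measurable_fun D (g ^~ (map_mx ratr w))) ->
  (forall z, D z -> continuous (g z)) ->
  (forall i, measurable_fun D (fun z => X z 0 i)) ->
  measurable_fun D (fun z => g z (X z)).
Proof.
move=> mD mg cg mX.
apply: (@measurable_fun_cvg _ _ _ _ (fun k z => g z (floor_row k (X z)))).
  move=> k _ B mB.
  pose w (m : 'rV[int]_n) : 'rV[rat]_n := \row_i ((m 0 i)%:~R / k.+1%:R).
  (* [E m] is the cell of [D] on which [X] rounds down to the rational row [w m]. *)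
  pose E (m : 'rV[int]_n) := D `&` \big[setI/setT]_(i < n) [set z |
    (m 0 i)%:~R / k.+1%:R <= X z 0 i < (m 0 i + 1)%:~R / k.+1%:R].
  rewrite (_ : _ `&` _ = \bigcup_(m : 'rV[int]_n)
      (E m `&` (D `&` (g ^~ (map_mx ratr (w m))) @^-1` B))).
    apply: countable_bigcupT_measurable => // m.
    apply: measurableI; last exact: mg.
    rewrite /E; elim: (index_enum _) => [|i s ih].
      by rewrite big_nil setIT.
    rewrite big_cons setIIr; apply: measurableI => //.
    apply: (mX i mD `[_, _[%classic); exact: measurable_itv.
  apply/seteqP; split => [z [Dz Bz]|z [m _ [[Dz Ez] [_ Bz]]]].
    exists (\row_i Num.floor (k.+1%:R * X z 0 i)) => //; split; split => //.
      apply: (big_ind (fun A : set T => A z)) => // i _ /=; rewrite mxE.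
      rewrite ler_pdivrMr// ltr_pdivlMr// mulrC.
      exact: floor_itv.
    rewrite /= (_ : map_mx _ _ = floor_row k (X z))//.
    by apply/rowP => i; rewrite !mxE fmorph_div/= ratr_int ratr_nat.
  split=> //=; rewrite (_ : floor_row k (X z) = map_mx ratr (w m))//.
  apply/rowP => i; rewrite !mxE fmorph_div/= ratr_int ratr_nat.
  congr (_%:~R / _); apply: floor_def; rewrite mulrC.
  move: Ez; rewrite (bigD1 i)//= => -[/= + _].
  by rewrite ler_pdivrMr// ltr_pdivlMr.
move=> z Dz; apply: continuous_cvg; first exact: cg.
apply/cvgrPdist_le => e e0; near=> k.
apply: le_trans (floor_row_dist _ _) _.
near: k; apply: filterS (near_infty_natSinv_lt (PosNum e0)) => k; exact: ltW.
Unshelve. all: by end_near. Qed.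

End caratheodory.

Section unit_interval.
Context (R : realType).
Notation mu := (@lebesgue_measure R).
Local Notation I := (`[0%R, 1%R]%classic : set R).

Lemma lebesgue_measure01 : mu I = 1%E.
Proof. by rewrite lebesgue_measure_itv/= lte_fin ltr01 sube0. Qed.

Lemma integrable_cst01 (c : R) : mu.-integrable I (EFin \o cst c).
Proof.
apply/integrableP; split; first by apply/measurable_EFinP; exact: measurable_cst.
rewrite (eq_integral (cst `|c|%:E)) => [|x _ //].
by rewrite integral_cst//= lebesgue_measure01 mule1 ltey.
Qed.

Lemma Rintegral_cst01 (c : R) : \int[mu]_(t in I) c = c.
Proof. by rewrite Rintegral_cst//= lebesgue_measure01 mulr1. Qed.

Lemma integrable_le (D : set R) (f g : R -> R) : measurable D ->
  measurable_fun D f -> (forall t, D t -> `|f t| <= g t) ->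
  mu.-integrable D (EFin \o g) -> mu.-integrable D (EFin \o f).
Proof.
move=> mD mf fg; apply: le_integrable => //; first exact/measurable_EFinP.
move=> t Dt /=; rewrite lee_fin (le_trans (fg _ Dt))// ler_norm //.
Qed.

Lemma integrable_addr (D : set R) (f g : R -> R) : measurable D ->
  mu.-integrable D (EFin \o f) -> mu.-integrable D (EFin \o g) ->
  mu.-integrable D (EFin \o (fun t => f t + g t)).
Proof. by move=> mD fi gi; exact: eq_integrable (integrableD _ fi gi). Qed.

Lemma integrable_mull (D : set R) (f : R -> R) (c : R) : measurable D ->
  mu.-integrable D (EFin \o f) -> mu.-integrable D (EFin \o (fun t => c * f t)).
Proof. by move=> mD fi; exact: eq_integrable (integrableZl _ c fi). Qed.

Lemma integrable_mulr (D : set R) (f : R -> R) (c : R) : measurable D ->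
  mu.-integrable D (EFin \o f) -> mu.-integrable D (EFin \o (fun t => f t * c)).
Proof. by move=> mD fi; under eq_fun do rewrite mulrC; exact: integrable_mull. Qed.

Lemma integrable_bounded01 (f : R -> R) (M : R) : measurable_fun I f ->
  (forall t, I t -> `|f t| <= M) -> mu.-integrable I (EFin \o f).
Proof. by move=> mf fM; apply: integrable_le (integrable_cst01 M). Qed.

Lemma powR_add_le (a b p : R) : 0 <= a -> 0 <= b -> 0 <= p ->
  (a + b) `^ p <= 2 `^ p * (a `^ p + b `^ p).
Proof.
move=> a0 b0 p0; wlog ab : a b a0 b0 / a <= b.
  move=> H; have [|/ltW] := leP a b; first exact: H.
  by move=> ba; rewrite addrC [X in _ * X]addrC; exact: H.
apply: (@le_trans _ _ ((2 * b) `^ p)).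
  by rewrite ge0_ler_powR// ?nnegrE ?addr_ge0 ?mulr_ge0// mulr_natl mulr2n lerD2r.
by rewrite powRM// ler_wpM2l ?powR_ge0// lerDr powR_ge0.
Qed.

Section jensen.
Variables (p q : R).
Hypotheses (p_gt1 : 1 < p) (pq : p^-1 + q^-1 = 1).

Lemma conjugate_gt0 : 0 < q.
Proof.
rewrite -invr_gt0; have -> : q^-1 = 1 - p^-1 by rewrite -pq addrC addKr.
by rewrite subr_gt0 invf_lt1// (lt_trans ltr01).
Qed.

Let p_gt0 : 0 < p. Proof. exact: lt_trans ltr01 p_gt1. Qed.

Variable f : R -> R.
Hypotheses (mf : measurable_fun I f) (f0 : forall t, I t -> 0 <= f t).
Hypothesis fp : mu.-integrable I (EFin \o (fun t => f t `^ p)).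

Lemma powR_integrable : mu.-integrable I (EFin \o f).
Proof.
apply: (@integrable_le _ _ (fun t => f t `^ p + 1)) => //.
  move=> t It; rewrite ger0_norm ?f0// -[leLHS]mulr1.
  apply: (le_trans (conjugate_powR (f0 It) ler01 p_gt0 conjugate_gt0 pq)).
  rewrite powR1 lerD// ?div1r.
    by rewrite ler_pdivrMr// ler_peMr ?powR_ge0// ltW.
  by rewrite -pq lerDr invr_ge0 ltW.
by apply: integrable_addr => //; exact: integrable_cst01.
Qed.

(** Integrate Young's inequality for [f t] against the constant [m ^ (p - 1)], where [m] is the
    mean: the product integrates to [m ^ p], the [q]-th power of the constant is also [m ^ p], and
    the conjugacy relation cancels the share [1 / q]. *)
Lemma jensen01 : (\int[mu]_(t in I) f t) `^ p <= \int[mu]_(t in I) f t `^ p.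
Proof.
set m := \int[mu]_(t in I) f t.
have m0 : 0 <= m by apply: Rintegral_ge0 => t; exact: f0.
have [<-|mn0] := eqVneq 0 m.
  rewrite powR0 ?gt_eqF//; apply: Rintegral_ge0 => t _; exact: powR_ge0.
have mgt0 : 0 < m by rewrite lt_neqAle mn0.
have pE : m * m `^ (p - 1) = m `^ p.
  by rewrite -[X in X * _]powRr1// -powRD ?subrKC// gt_eqF.
(* The conjugacy relation multiplied by [p * q] reads [(p - 1) * q = p]. *)
have qE : (m `^ (p - 1)) `^ q = m `^ p.
  rewrite -powRrM; congr (_ `^ _).
  have pn0 : p != 0 by rewrite gt_eqF.
  have qn0 : q != 0 by rewrite gt_eqF// conjugate_gt0.
  have pqE : p * q * (p^-1 + q^-1) = q + p by field; apply/andP.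
  by rewrite mulrBl mul1r -[p * q]mulr1 -pq pqE [q + p]addrC addrK.
have : \int[mu]_(t in I) (f t * m `^ (p - 1)) <=
       \int[mu]_(t in I) (f t `^ p * p^-1 + m `^ p / q).
  apply: le_Rintegral => //.
  - by apply: integrable_mulr => //; exact: powR_integrable.
  - apply: integrable_addr => //; last exact: integrable_cst01.
    exact: integrable_mulr.
  - move=> t It; have := conjugate_powR (f0 It) (powR_ge0 m (p - 1)) p_gt0 conjugate_gt0 pq.
    by rewrite qE.
rewrite RintegralZr//; last exact: powR_integrable.
rewrite RintegralD//; last 2 first.
- exact: integrable_mulr.
- exact: integrable_cst01.
rewrite RintegralZr// Rintegral_cst01 -/m pE => H.
have : m `^ p * p^-1 <= (\int[mu]_(x in I) f x `^ p) * p^-1.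
  by move: H; rewrite -{1}[m `^ p]mulr1 -{1}pq mulrDr lerD2r.
by rewrite ler_pM2r ?invr_gt0.
Qed.

End jensen.

(** No integrability of the sections is required: the extended integral is a difference of two
    Tonelli integrals, of the positive and the negative part, and the map [fine] is applied to it
    afterwards. *)
Lemma measurable_Rintegral_snd (D : set R) (f : R * R -> R) : measurable D ->
  measurable_fun setT f ->
  measurable_fun setT (fun t => \int[mu]_(s in D) f (t, s)).
Proof.
move=> mD mf.
have mg : measurable_fun setT (EFin \o (f \_ (setT `*` D))).
  by apply/measurable_EFinP/(measurable_restrictT _ _).1 => //;
    [exact: measurableX|exact: measurable_funTS].
apply: measurableT_comp => //.
rewrite (_ : (fun _ => _) = fun t =>
   (fubini_F mu (fun z => (EFin \o (f \_ (setT `*` D)))^\+ z) t -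
    fubini_F mu (fun z => (EFin \o (f \_ (setT `*` D)))^\- z) t)%E).
  apply: emeasurable_funB; apply: measurable_fun_fubini_tonelli_F => //.
    exact: measurable_funepos.
  exact: measurable_funeneg.
apply/funext => t; rewrite integral_mkcond integralE /fubini_F.
by congr (_ - _)%E; apply: eq_integral => s _;
  rewrite ?funeposE ?funenegE /= !patchE in_setX in_setT /=; case: ifPn.
Qed.

End unit_interval.

Section dominated.
Context (R : realType).
Notation mu := (@lebesgue_measure R).
Local Notation I := (`[0%R, 1%R]%classic : set R).

Lemma ge0_integrable (D : set R) (f : R -> R) : measurable D ->
  measurable_fun D f -> (forall t, D t -> 0 <= f t) ->
  (\int[mu]_(t in D) (f t)%:E < +oo)%E -> mu.-integrable D (EFin \o f).
Proof.
move=> mD mf f0 foo; apply/integrableP; split; first exact/measurable_EFinP.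
apply: le_lt_trans foo; rewrite le_eqVlt; apply/orP; left; apply/eqP.
by apply: eq_integral => t; rewrite inE => Dt /=; rewrite ger0_norm// f0.
Qed.

Lemma dominated_cvg0 (D : set R) (f_ : nat -> R -> R) (g : R -> R) :
  measurable D -> (forall n, measurable_fun D (f_ n)) ->
  (forall x, D x -> f_ n x @[n --> \oo] --> (0 : R)) ->
  mu.-integrable D (EFin \o g) ->
  (forall n x, D x -> `|f_ n x| <= g x) ->
  \int[mu]_(x in D) f_ n x @[n --> \oo] --> (0 : R).
Proof.
move=> mD mf f0 ig fg.
have mf' n : measurable_fun D (EFin \o f_ n) by exact/measurable_EFinP.
have f0' : {ae mu, forall x, D x -> (EFin \o f_ n) x @[n --> \oo] --> 0%E}.
  by apply: aeW => x Dx; apply: cvg_EFin; [exact: nearW|exact: f0].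
have fg' : {ae mu, forall x n, D x -> (`|(EFin \o f_ n) x| <= (EFin \o g) x)%E}.
  by apply: aeW => x n Dx; rewrite lee_fin fg.
have [_ _] := @dominated_convergence _ _ _ mu D mD
  (fun n => EFin \o f_ n) (cst 0%E) (EFin \o g) mf' (measurable_cst _) f0' ig fg'.
by rewrite integral0 => /fine_cvg.
Qed.

Lemma cvg0_powR (a : nat -> R) (p : R) : 0 < p -> (forall m, 0 <= a m) ->
  a m @[m --> \oo] --> (0 : R) -> a m `^ p @[m --> \oo] --> (0 : R).
Proof.
move=> p0 a0 /cvgrPdist_le acvg; apply/cvgrPdist_le => e e0; near=> m.
rewrite sub0r normrN ger0_norm ?powR_ge0//.
rewrite -(powRr1 (ltW e0)) -(mulVf (lt0r_neq0 p0)) powRrM.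
apply: ge0_ler_powR; rewrite ?nnegrE ?powR_ge0 ?a0 ?(ltW p0)//.
have : `|0 - a m| <= e `^ p^-1 by near: m; apply: acvg; rewrite powR_gt0.
by rewrite sub0r normrN ger0_norm.
Unshelve. all: by end_near. Qed.

(** For fixed [t] the inner integrals are dominated by [k (t, _)]; the outer ones are dominated by
    the constant [G ^ p]. Neither majorant depends on [m]. *)
Lemma iterated_dominated_cvg0 (k : R * R -> R) (rho : nat -> R * R -> R)
    (G p : R) : 0 < p ->
  (forall m, measurable_fun setT (rho m)) -> measurable_fun setT k ->
  (forall m t s, I t -> I s -> 0 <= rho m (t, s) <= k (t, s)) ->
  (forall t, I t -> (\int[mu]_(s in I) (k (t, s))%:E <= G%:E)%E) ->
  (forall t s, I t -> I s -> rho m (t, s) @[m --> \oo] --> (0 : R)) ->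
  \int[mu]_(t in I) (\int[mu]_(s in I) rho m (t, s)) `^ p @[m --> \oo] --> (0 : R).
Proof.
move=> p0 mrho mk rhok kG rho0.
have mk1 t : measurable_fun I (fun s => k (t, s)).
  by apply: measurable_funTS; exact: measurableT_comp.
have mrho1 m t : measurable_fun I (fun s => rho m (t, s)).
  by apply: measurable_funTS; exact: measurableT_comp.
have k0 t s : I t -> I s -> 0 <= k (t, s).
  by move=> It Is; have /andP[] := rhok 0%N _ _ It Is; exact: le_trans.
have ik t : I t -> mu.-integrable I (EFin \o (fun s => k (t, s))).
  move=> It; apply: ge0_integrable => //; first by move=> s; exact: k0.
  by rewrite (le_lt_trans (kG _ It))// ltry.
have kGr t : I t -> \int[mu]_(s in I) k (t, s) <= G.
  move=> It; rewrite -lee_fin /Rintegral fineK ?kG//.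
  exact: (integrable_fin_num _ (ik _ It)).
have irho m t : I t -> mu.-integrable I (EFin \o (fun s => rho m (t, s))).
  move=> It; apply: integrable_le (ik _ It) => // s Is.
  by have /andP[? ?] := rhok m _ _ It Is; rewrite ger0_norm.
have rint0 m t : I t -> 0 <= \int[mu]_(s in I) rho m (t, s).
  by move=> It; apply: Rintegral_ge0 => s Is; have /andP[] := rhok m _ _ It Is.
apply: (@dominated_cvg0 _ _ (cst (G `^ p))) => //.
- move=> m; apply: measurable_funTS.
  by apply: (measurableT_comp (measurable_powR p)); exact: measurable_Rintegral_snd.
- move=> t It; apply: cvg0_powR => // [m|]; first exact: rint0.
  apply: (@dominated_cvg0 _ _ (fun s => k (t, s))) => //.
  + by move=> s Is; exact: rho0.
  + exact: ik.
  + by move=> m s Is; have /andP[? ?] := rhok m _ _ It Is; rewrite ger0_norm.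
- exact: integrable_cst01.
- move=> m t It.
  have rG : \int[mu]_(s in I) rho m (t, s) <= G.
    apply: le_trans (kGr _ It); apply: le_Rintegral => //; [exact: irho|exact: ik|].
    by move=> s Is; have /andP[] := rhok m _ _ It Is.
  rewrite ger0_norm ?powR_ge0// ge0_ler_powR// ?nnegrE ?rint0//; first exact: ltW.
  exact: le_trans (rint0 m _ It) _.
Qed.

End dominated.

(** * Absolutely continuous functions *)

Section absolute_continuity.
Context (R : realType).
Notation mu := (@lebesgue_measure R).
Local Notation I := (`[0%R, 1%R]%classic : set R).

(** Stated for an arbitrary cost [phi u v] of an interval, so that Euclidean increments of rows,
    increments of a coordinate and integral bounds are handled alike. *)
Definition abs_continuous_incr (phi : R -> R -> R) : Prop :=
  forall e : R, 0 < e -> exists2 d : R, 0 < d &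
  forall (m : nat) (u v : 'I_m -> R),
    (forall k, [/\ 0 <= u k, u k <= v k & v k <= 1]) ->
    trivIset setT (fun k => `]u k, v k[%classic) ->
    \sum_(k < m) (v k - u k) < d ->
    \sum_(k < m) phi (u k) (v k) < e.

Lemma abs_continuous_incrD phi psi chi :
  (forall u v, chi u v <= phi u v + psi u v) ->
  abs_continuous_incr phi -> abs_continuous_incr psi -> abs_continuous_incr chi.
Proof.
move=> chiE aphi apsi e e0; have e20 : 0 < e / 2 by rewrite divr_gt0.
have [d1 d10 h1] := aphi _ e20; have [d2 d20 h2] := apsi _ e20.
exists (Num.min d1 d2); first by rewrite lt_min d10.
move=> m u v uv tuv; rewrite lt_min => /andP[l1 l2].
apply: (@le_lt_trans _ _ (\sum_(k < m) (phi (u k) (v k) + psi (u k) (v k)))).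
  by apply: ler_sum => k _.
by rewrite big_split/= (splitr e) ltrD ?h1 ?h2.
Qed.

(* Newest interval first: the list runs through [0, x] from right to left. *)
Fixpoint chain (O : set R) (x : R) (s : seq (R * R)) : Prop :=
  if s is (u, v) :: s' then
    [/\ 0 <= u, u <= v, v <= x, `]u, v[ `<=` O & chain O u s'] else True.

Lemma chain_le O x y s : x <= y -> chain O x s -> chain O y s.
Proof. by case: s => [//|[u v] s] xy /= [? ? vx ? ?]; split => //; exact: le_trans xy. Qed.

Lemma chain_nth O x s k : chain O x s -> (k < size s)%N ->
  let w := nth (0, 0) s k in [/\ 0 <= w.1, w.1 <= w.2 & w.2 <= x].
Proof.
elim: s k x => [//|[u v] s ih] [|k] x /= [u0 uv vx _ c] ks; first by split.
by have [? ? ?] := ih k u c ks; split => //; lra.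
Qed.

Lemma chain_nth_lt O x s j k : chain O x s -> (j < k)%N -> (k < size s)%N ->
  (nth (0, 0) s k).2 <= (nth (0, 0) s j).1.
Proof.
elim: s j k x => [//|[u v] s ih] [|j] [|k] x //= [u0 uv vx _ c] jk ks.
  by have [] := chain_nth c ks.
exact: ih c _ _.
Qed.

(** The newest interval []u, v[] is disjoint from [[0, u]], which carries the rest of the chain, so
    the lengths add up inside [O]. *)
Lemma chain_measure O x s : measurable O -> 0 <= x -> chain O x s ->
  ((\sum_(w <- s) (w.2 - w.1))%:E <= mu (O `&` `[0%R, x]))%E.
Proof.
move=> mO; elim: s x => [|[u v] s ih] x x0 /=; first by rewrite big_nil.
move=> [u0 uv vx uvO c]; rewrite big_cons/= EFinD addeC.
apply: (@le_trans _ _ (mu (O `&` `[0%R, u]) + mu `]u, v[%classic)%E).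
  apply: leeD; first exact: ih.
  rewrite lebesgue_measure_itv/= lte_fin; case: ltP => //; rewrite ?EFinB// => vu.
  by rewrite lee_fin; lra.
rewrite -measureU//; last 2 first.
- exact: measurableI.
- apply/seteqP; split => // z [[_ /=]]; rewrite !in_itv/=; lra.
apply: le_measure; rewrite ?inE.
- by apply: measurableU => //; exact: measurableI.
- exact: measurableI.
- move=> z [[Oz]|]/=; rewrite in_itv/= => zuv; split => //; rewrite /= ?in_itv/=; last 2 first.
  + by apply: uvO; rewrite /= in_itv.
  + by lra.
  by lra.
Qed.

Lemma abs_continuous_chain phi : abs_continuous_incr phi ->
  forall e : R, 0 < e -> exists2 d : R, 0 < d & forall O s, chain O 1 s ->
    \sum_(w <- s) (w.2 - w.1) < d -> \sum_(w <- s) phi w.1 w.2 < e.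
Proof.
move=> aphi e /aphi[d d0 h]; exists d => // O s cs sd.
pose w (k : 'I_(size s)) := nth (0, 0) s k.
have E (psi : R -> R -> R) :
    \sum_(w <- s) psi w.1 w.2 = \sum_(k < size s) psi (w k).1 (w k).2.
  by rewrite (big_nth (0, 0)) big_mkord.
rewrite E; apply: h; first by move=> k; exact: chain_nth cs _.
  move=> j k _ _ [z [/=]]; rewrite !in_itv/= => zj zk; apply/val_inj => /=.
  have absurd (j' k' : 'I_(size s)) : (j' < k')%N ->
      (w j').1 < z < (w j').2 -> (w k').1 < z < (w k').2 -> False.
    move=> jk /andP[z1 _] /andP[_ z2].
    have := lt_trans z1 (lt_le_trans z2 (chain_nth_lt cs jk (ltn_ord k'))).
    by rewrite ltxx.
  by case: (ltngtP j k) => // jk; [case: (absurd j k)|case: (absurd k j)].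
by rewrite -(E (fun u v => v - u)).
Qed.

Lemma negligible_open_cover (E : set R) (d : R) : mu.-negligible E -> 0 < d ->
  exists O : set R, [/\ open O, E `<=` O & (mu O < d%:E)%E].
Proof.
move=> [N [mN N0 EN]] d0.
have [|O [oO NO Od]] := @lebesgue_regularity_outer R N d mN _ d0.
  by apply: (@le_lt_trans _ _ 0%E) => //; rewrite le_eqVlt; apply/orP; left; apply/eqP; exact: N0.
exists O; split=> //; first exact: subset_trans NO.
have mO : measurable O by exact: open_measurable.
have mON : measurable (O `\` N) by exact: measurableD.
apply: le_lt_trans Od; rewrite -[leRHS]adde0.
have OE : O = (O `\` N) `|` N by rewrite setUC setDUK.
rewrite [leLHS](congr1 mu OE).
apply: (le_trans (measureU2 mu mON mN)); apply: leeD => //.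
by rewrite le_eqVlt; apply/orP; left; apply/eqP; exact: N0.
Qed.

(* Cousin-style argument: with [O] an open neighbourhood of [E] of small
   measure, the supremum of the points [x] reached by a chain in [O] carrying
   all of the increment of [f] but [e * x] is the right end point. *)
Lemma abs_continuous_deriv0 (f : R -> R) (E : set R) :
  abs_continuous_incr (fun u v => `|f v - f u|) -> mu.-negligible E ->
  (forall x, I x -> ~ E x -> forall e : R, 0 < e -> exists2 r : R, 0 < r &
     forall y, `|y - x| < r -> `|f y - f x| <= e * `|y - x|) ->
  forall b, I b -> f b = f 0.
Proof.
move=> af nE f0 b; rewrite /= in_itv/= => /andP[b0 b1].
suff H (e : R) : 0 < e -> `|f b - f 0| <= e * 2.
  apply/eqP; rewrite -subr_eq0 -normr_le0; apply/ler_addgt0Pr => e e0.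
  by have := H (e / 2); rewrite divfK ?pnatr_eq0// add0r; apply; rewrite divr_gt0.
move=> e0; have [d d0 hd] := abs_continuous_chain af e0.
have [U [oU EU Ud]] := negligible_open_cover nE d0.
have mU : measurable U by exact: open_measurable.
pose A := [set x | [/\ 0 <= x, x <= b & exists2 s, chain U x s &
  `|f x - f 0| <= e * x + \sum_(w <- s) `|f w.2 - f w.1|]].
have A0 : A 0 by split=> //; exists [::]; rewrite ?big_nil// subrr normr0 mulr0 addr0.
have ubA : has_ubound A by exists b => x [].
have supA : has_sup A by split; [exists 0|].
set c := sup A.
have c0 : 0 <= c by exact: ub_le_sup.
have cb : c <= b by apply: ge_sup; [exists 0|move=> x []].
(* The local move across [c]. If [c] lies in [E], the interval from [x] to [y] stays in [U] and
   joins the chain; otherwise the vanishing derivative at [c] pays for the increment with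
   [e * (y - x)]. *)
have step : exists2 r : R, 0 < r & forall x y, A x -> c - r < x -> x <= c ->
    c <= y -> y < c + r -> y <= b -> A y.
  have [Ec|nEc] := pselect (E c).
    have Uc : U c by exact: EU.
    have /nbhs_ballP[r /= r0 rU] : nbhs c U by exact: open_nbhs_nbhs.
    exists r => // x y [x0 xb [s cs fx]] rx xc cy yr yb; split => //; first by lra.
    exists ((x, y) :: s).
      split => //; first by lra.
      move=> z /=; rewrite in_itv/= => /andP[? ?]; apply: rU.
      by rewrite /ball/= ltr_distlC; apply/andP; split; lra.
    rewrite big_cons/=; have := ler_distD (f x) (f y) (f 0).
    have : e * x <= e * y by rewrite ler_wpM2l//; lra.
    by move: fx; set S := \sum_(_ <- _) _; lra.
  have Ic : I c by rewrite /= in_itv/=; apply/andP; split => //; lra.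
  have [r r0 hr] := f0 c Ic nEc e e0.
  exists r => // x y [x0 xb [s cs fx]] rx xc cy yr yb; split => //; first by lra.
  exists s; first by apply: chain_le cs; lra.
  have := ler_distD (f x) (f y) (f 0).
  have : `|f y - f c| <= e * `|y - c| by apply: hr; rewrite ger0_norm; lra.
  have : `|f x - f c| <= e * `|x - c| by apply: hr; rewrite ler0_norm; lra.
  rewrite (ger0_norm (_ : 0 <= y - c)); last by lra.
  rewrite (ler0_norm (_ : x - c <= 0)); last by lra.
  have := ler_distD (f c) (f y) (f x); rewrite (distrC (f c)).
  rewrite !mulrBr mulrN mulrBr.
  by move: fx; set S := \sum_(_ <- _) _; lra.
have [r r0 hr] := step.
have [x Ax xr] := sup_adherent r0 supA.
have xc : x <= c by exact: ub_le_sup.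
(* If [c < b], the move reaches [b] or [c + r / 2], both beyond the supremum. *)
have Ab : A b.
  have [bc|cltb] := leP b c.
    by apply: (hr x) => //; lra.
  have : A (Num.min b (c + r / 2)).
    apply: (hr x) => //.
    - by rewrite le_min; apply/andP; split; lra.
    - by rewrite gt_min; apply/orP; right; lra.
    - by rewrite ge_min lexx.
  move=> /(ub_le_sup ubA); rewrite -/c ge_min; lra.
(* The chain lies in [U], of measure below [d], so absolute continuity keeps its increments below
   [e]; the slope term adds at most [e * b <= e]. *)
have [_ _ [s cs fb]] := Ab.
have := chain_measure mU b0 cs.
move=> H.
have /(hd U s (chain_le b1 cs)) : \sum_(w <- s) (w.2 - w.1) < d.
  rewrite -lte_fin; apply: le_lt_trans H _; apply: le_lt_trans Ud.
  by apply: le_measure; rewrite ?inE//; exact: measurableI.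
have : e * b <= e by rewrite ger_pMr.
by move: fb; set S := \sum_(_ <- _) _; lra.
Qed.

End absolute_continuity.

Section enorm_theory.
Context (R : realType) (n : nat).
Implicit Types v : 'rV[R]_n.

Lemma enorm_ge0 v : 0 <= enorm v.
Proof. exact: sqrtr_ge0. Qed.

Lemma coord_le_enorm v i : `|v 0 i| <= enorm v.
Proof.
rewrite -sqrtr_sqr; apply: ler_wsqrtr; rewrite (bigD1 i)//= lerDl.
by apply: sumr_ge0 => j _; exact: sqr_ge0.
Qed.

Lemma enorm_le_sum v : enorm v <= \sum_(i < n) `|v 0 i|.
Proof.
set S := \sum_(i < n) _; have S0 : 0 <= S by exact: sumr_ge0.
rewrite -[leRHS]ger0_norm// -sqrtr_sqr; apply: ler_wsqrtr.
rewrite [leRHS]expr2 {1}/S mulr_suml; apply: ler_sum => i _.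
rewrite -real_normK ?num_real// expr2 ler_wpM2l// /S (bigD1 i)//= lerDl.
exact: sumr_ge0.
Qed.

Lemma norm_le_enorm v : `|v| <= enorm v.
Proof. apply: row_norm_le; [exact: enorm_ge0|exact: coord_le_enorm]. Qed.

Lemma enorm_le_norm v : enorm v <= n%:R * `|v|.
Proof.
apply: le_trans (enorm_le_sum v) _; apply: (@le_trans _ _ (\sum_(i < n) `|v|)).
  by apply: ler_sum => i _; exact: row_coord_le.
by rewrite sumr_const card_ord mulr_natl.
Qed.

Lemma measurable_enorm d (T : measurableType d) (D : set T) (X : T -> 'rV[R]_n) :
  (forall i, measurable_fun D (fun z => X z 0 i)) ->
  measurable_fun D (fun z => enorm (X z)).
Proof.
move=> mX; rewrite (_ : (fun _ => _) =
    (@powR R ^~ 2^-1) \o (fun z => \sum_(i < n) X z 0 i ^+ 2)).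
  apply: (measurableT_comp (measurable_powR _)).
  by apply: measurable_sum => i; exact: measurable_funX.
by apply/funext => z /=; rewrite powR12_sqrt// sumr_ge0// => i _; exact: sqr_ge0.
Qed.

End enorm_theory.

(** * Primitives and their almost everywhere derivatives *)

Section primitive.
Context (R : realType).
Notation mu := (@lebesgue_measure R).
Local Notation I := (`[0%R, 1%R]%classic : set R).

Lemma subset_itv01 (b1 b2 : bool) (a b : R) : 0 <= a -> b <= 1 ->
  [set` Interval (BSide b1 a) (BSide b2 b)] `<=` I.
Proof.
move=> a0 b1'; move=> z /=; rewrite !in_itv/=.
by case: b1; case: b2 => /= /andP[? ?]; apply/andP; split; lra.
Qed.

Lemma EFin_Rintegral (D : set R) (f : R -> R) : measurable D ->
  mu.-integrable D (EFin \o f) ->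
  (\int[mu]_(x in D) f x)%:E = (\int[mu]_(x in D) (f x)%:E)%E.
Proof.
by move=> mD fi; rewrite /Rintegral fineK//; apply: integrable_fin_num.
Qed.

Lemma Rintegral_incr (u : R -> R) a b : mu.-integrable I (EFin \o u) ->
  0 <= a -> a <= b -> b <= 1 ->
  \int[mu]_(s in `[0, b]) u s - \int[mu]_(s in `[0, a]) u s =
  \int[mu]_(s in `]a, b[) u s.
Proof.
move=> iu a0 ab b1.
rewrite Rintegral_itvB ?bnd_simp//; last first.
  by apply: integrableS iu => //; exact: subset_itv01.
rewrite Rintegral_itv_bndo_bndc//.
by apply: integrableS iu => //; exact: subset_itv01.
Qed.

(** Cut [g] at height [N]: the excess [h N] has integral below [e / 2] by dominated convergence, and
    what lies under the cut contributes at most the height times the total length. *)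
Lemma abs_continuous_integral (phi : R -> R -> R) (g : R -> R) :
  mu.-integrable I (EFin \o g) -> (forall t, I t -> 0 <= g t) ->
  (forall a b : R, 0 <= a -> a <= b -> b <= 1 ->
    phi a b <= \int[mu]_(s in `]a, b[) g s) ->
  abs_continuous_incr phi.
Proof.
move=> ig g0 phig e e0.
have mg : measurable_fun I g by apply/measurable_EFinP; exact: measurable_int ig.
pose h n t := Num.max (g t - n%:R) 0.
have mh n : measurable_fun I (h n).
  by apply: measurable_maxr => //; apply: measurable_funB => //; exact: measurable_cst.
have h0 n t : 0 <= h n t by rewrite le_max lexx orbT.
have hg n t : I t -> `|h n t| <= g t.
  by move=> It; rewrite ger0_norm ?h0// ge_max g0// andbT gerBl.
have ih n : mu.-integrable I (EFin \o h n) by exact: (integrable_le _ (mh n) (hg n) ig).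
have : \int[mu]_(t in I) h n t @[n --> \oo] --> (0 : R).
  apply: (@dominated_cvg0 _ _ _ g) => // t It.
  apply/cvgrPdist_le => d d0; near=> n.
  rewrite sub0r normrN ger0_norm ?h0// ge_max (ltW d0) andbT.
  apply: (@le_trans _ _ 0); last exact: ltW.
  by rewrite subr_le0; near: n; exact: nbhs_infty_ger.
move=> /cvgrPdist_lt/(_ (e / 2)) [|N _ hN]; first by rewrite divr_gt0.
have {hN} hN : \int[mu]_(t in I) h N t < e / 2.
  have := hN N (leqnn _); rewrite sub0r normrN ger0_norm//.
  by apply: Rintegral_ge0.
(* The successor [N.+1] keeps the divisor positive; as a height it only weakens the bound. *)
exists (e / 2 / N.+1%:R); first by rewrite !divr_gt0.
move=> m u v uv tuv uvd.
have sub k : `]u k, v k[%classic `<=` I.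
  by have [? ? ?] := uv k; exact: subset_itv01.
apply: (@le_lt_trans _ _ (\sum_(k < m) (\int[mu]_(s in `]u k, v k[) h N s + N.+1%:R * (v k - u k)))).
  apply: ler_sum => k _; have [uk uvk vk] := uv k.
  apply: le_trans (phig _ _ uk uvk vk) _.
  have ihk : mu.-integrable `]u k, v k[ (EFin \o h N) by apply: integrableS (ih N).
  have ick : mu.-integrable `]u k, v k[ (EFin \o cst N.+1%:R).
    by apply: integrableS (integrable_cst01 _).
  have -> : N.+1%:R * (v k - u k) = \int[mu]_(s in `]u k, v k[) N.+1%:R.
    rewrite Rintegral_cst//= lebesgue_measure_itv/= lte_fin; case: ltP => //= vu.
    have -> : v k = u k by lra.
    by rewrite subrr.
  rewrite -RintegralD//; apply: le_Rintegral => //.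
  - by apply: integrableS ig.
  - exact: integrable_addr.
  - move=> t _; rewrite -lerBlDr; apply: (@le_trans _ _ (g t - N%:R)).
      by rewrite lerB// ler_nat.
    by rewrite le_max lexx.
rewrite big_split/= -mulr_sumr (splitr e); apply: ler_ltD; last first.
  by rewrite mulrC -ltr_pdivlMr.
apply: le_trans (ltW hN).
rewrite -lee_fin -sumEFin EFin_Rintegral//.
rewrite (eq_bigr (fun k : 'I_m => \int[mu]_(s in `]u k, v k[) (h N s)%:E)%E); last first.
  move=> k _; rewrite EFin_Rintegral//.
  by apply: integrableS (ih N).
have sU : \big[setU/set0]_(k <- index_enum 'I_m) `]u k, v k[%classic `<=` I.
  apply: (big_ind (fun A : set R => A `<=` I)) => //.
  by move=> A B AI BI z []; [exact: AI|exact: BI].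
have mU : measurable (\big[setU/set0]_(k <- index_enum 'I_m) `]u k, v k[%classic).
  exact: bigsetU_measurable.
rewrite -ge0_integral_bigsetU//; last 4 first.
- exact: index_enum_uniq.
- exact: sub_trivIset tuv.
- by apply/measurable_EFinP; apply: measurable_funS (mh N).
- by move=> t _; rewrite lee_fin.
apply: ge0_subset_integral => //; first by apply/measurable_EFinP; exact: mh.
by move=> t _; rewrite lee_fin.
Unshelve. all: by end_near. Qed.

Lemma deriv0_small (f : R -> R) x : derivable f x 1 -> 'D_1 f x = 0 ->
  forall e : R, 0 < e -> exists2 r : R, 0 < r &
    forall y, `|y - x| < r -> `|f y - f x| <= e * `|y - x|.
Proof.
move=> df Df e e0; move: df => /cvg_ex[l dl].
have l0 : l = 0 by rewrite -Df; apply/esym/cvg_lim.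
move: dl; rewrite l0 => /cvgrPdist_le/(_ _ e0).
move=> /nbhs_ballP[r /= r0 hr]; exists r => // y yr.
have [->|yx] := eqVneq y x; first by rewrite !subrr normr0 mulr0.
have yx0 : y - x != 0 by rewrite subr_eq0.
have := hr (y - x); rewrite /ball/= sub0r normrN => /(_ yr yx0).
rewrite sub0r normrN /= [_ *: 1]mulr1 subrK [_ *: _]/( _ * _) normrM normfV.
by rewrite mulrC ler_pdivrMr ?normr_gt0.
Qed.

End primitive.

Section ae_connectives.
Context d (T : measurableType d) (R : realType).
Variable mu : {measure set T -> \bar R}.
Implicit Types P Q S : T -> Prop.

Lemma ae_imply P Q : (forall x, P x -> Q x) ->
  {ae mu, forall x, P x} -> {ae mu, forall x, Q x}.
Proof. by move=> PQ; exact: filterS. Qed.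

Lemma ae_imply2 P Q S : (forall x, P x -> Q x -> S x) ->
  {ae mu, forall x, P x} -> {ae mu, forall x, Q x} -> {ae mu, forall x, S x}.
Proof. by move=> PQ; exact: filterS2. Qed.

Lemma ae_forall_fin (I : finType) (P : I -> T -> Prop) :
  (forall i, {ae mu, forall t, P i t}) -> {ae mu, forall t, forall i, P i t}.
Proof. by move=> aP; apply: filter_forall. Qed.

Lemma ae_eq_integral_comp (V : Type) (phi : V -> \bar R) (D : set T) (y u : T -> V) :
  ae_eq mu D y u -> (\int[mu]_(x in D) phi (y x) = \int[mu]_(x in D) phi (u x))%E.
Proof.
by move=> yu; apply: ae_eq_integral_nonmeas; apply: ae_imply yu => x /[apply] ->.
Qed.

Lemma ae_eq_Rintegral_comp (V : Type) (phi : V -> R) (D : set T) (y u : T -> V) :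
  ae_eq mu D y u -> \int[mu]_(x in D) phi (y x) = \int[mu]_(x in D) phi (u x).
Proof.
by move=> yu; apply: ae_eq_Rintegral_nonmeas; apply: ae_imply yu => x /[apply] ->.
Qed.

End ae_connectives.

Section primitive_row.
Context (R : realType) (n : nat).
Notation mu := (@lebesgue_measure R).
Local Notation I := (`[0%R, 1%R]%classic : set R).
Implicit Types u x y : R -> 'rV[R]_n.

(** At [t = 1] this is the integral over the whole unit interval, and it is used in that way in
    [volterra]. *)
Definition vint u (t : R) : 'rV[R]_n :=
  \row_i \int[mu]_(s in `[0, t]) u s 0 i.

Definition measurable_row u := forall i, measurable_fun I (fun t => u t 0 i).

(** Counterpart of [Lp] for Borel representatives, with the sup norm in place of the Euclidean one.
    By [Lp_repr] each element of [Lp] agrees a.e. with such a representative. *)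
Definition Lpm (p : R) u :=
  measurable_row u /\ mu.-integrable I (EFin \o (fun t => `|u t| `^ p)).

Section exponent.
Variables (p q : R).
Hypotheses (p_gt1 : 1 < p) (pq : p^-1 + q^-1 = 1).

Let p_gt0 : 0 < p. Proof. exact: lt_trans ltr01 p_gt1. Qed.

Lemma measurable_norm01 u : measurable_row u -> measurable_fun I (fun t => `|u t|).
Proof. by move=> mu_; exact: measurable_row_norm. Qed.

Lemma Lpm_norm_integrable u : Lpm p u -> mu.-integrable I (EFin \o (fun t => `|u t|)).
Proof.
move=> [mu_ iu]; apply: (powR_integrable p_gt1 pq _ _ iu) => //.
exact: measurable_norm01.
Qed.

Lemma norm_coord_integrable u i : measurable_row u ->
  mu.-integrable I (EFin \o (fun t => `|u t|)) ->
  mu.-integrable I (EFin \o (fun t => u t 0 i)).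
Proof.
move=> mu_ iu; apply: (integrable_le _ (mu_ i) _ iu) => // t _.
exact: row_coord_le.
Qed.

Lemma Lp_repr y : Lp p y -> exists2 u, Lpm p u & ae_eq mu I y u.
Proof.
move=> [my iy].
have /choice[g hg] i : exists g : R -> R,
    measurable_fun I g /\ ae_eq mu I (fun t => y t 0 i) g.
  by have [g mg yg] := my i; exists g.
pose u t : 'rV[R]_n := \row_i g i t.
have mu_ : measurable_row u.
  move=> i; rewrite (_ : (fun _ => _) = g i); first exact: (hg i).1.
  by apply/funext => t; rewrite mxE.
have yu : ae_eq mu I y u.
  have : {ae mu, forall t, forall i, I t -> y t 0 i = g i t}.
    by apply: ae_forall_fin => i; exact: (hg i).2.
  by apply: ae_imply => t H It; apply/rowP => i; rewrite mxE H.
exists u => //; split => //.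
have me : measurable_fun I (fun t => enorm (u t) `^ p).
  by apply: (measurableT_comp (measurable_powR p)); exact: measurable_enorm.
have ie : mu.-integrable I (EFin \o (fun t => enorm (u t) `^ p)).
  apply: (ge0_integrable _ me) => [//|t _|].
    exact: powR_ge0.
  have E := ae_eq_integral_comp (fun v => (enorm v `^ p)%:E) yu.
  by rewrite -E.
apply: (integrable_le _ _ _ ie) => //.
  by apply: (measurableT_comp (measurable_powR p)); exact: measurable_norm01.
move=> t _; rewrite ger0_norm ?powR_ge0// ge0_ler_powR ?nnegrE ?enorm_ge0 ?(ltW p_gt0)//.
exact: norm_le_enorm.
Qed.

Lemma Lpm_enorm_integrable u : Lpm p u ->
  mu.-integrable I (EFin \o (fun t => enorm (u t) `^ p)).
Proof.
move=> [mu_ iu].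
apply: (integrable_le _ _ _ (integrable_mull (n%:R `^ p) _ iu)) => //.
  by apply: (measurableT_comp (measurable_powR p)); exact: measurable_enorm.
move=> t _; rewrite ger0_norm ?powR_ge0// -powRM//.
by rewrite ge0_ler_powR ?nnegrE ?enorm_ge0 ?(ltW p_gt0) ?mulr_ge0 ?enorm_le_norm.
Qed.

Lemma Lpm_Lp u y : Lpm p u -> ae_eq mu I y u -> Lp p y.
Proof.
move=> Lu yu; split.
  move=> i; exists (fun t => u t 0 i); first exact: Lu.1.
  by apply: ae_imply yu => t /[apply] ->.
have -> := ae_eq_integral_comp (fun v => (enorm v `^ p)%:E) yu.
have /integrableP[_] := Lpm_enorm_integrable Lu; apply: le_lt_trans.
rewrite le_eqVlt; apply/orP; left; apply/eqP.
by apply: eq_integral => t _ /=; rewrite ger0_norm// powR_ge0.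
Qed.

Lemma Lp_norm_ae u y : ae_eq mu I y u -> Lp_norm p y = Lp_norm p u.
Proof.
move=> yu; have E := ae_eq_Rintegral_comp (fun v => enorm v `^ p) yu.
by rewrite /Lp_norm E.
Qed.

Lemma vint0 u : vint u 0 = 0.
Proof. by apply/rowP => i; rewrite !mxE set_itv1 Rintegral_set1. Qed.

Lemma eq_vint u v t : I t -> (forall s, I s -> u s = v s) -> vint u t = vint v t.
Proof.
rewrite /= in_itv/= => /andP[t0 t1] uv; apply/rowP => i; rewrite !mxE.
apply: eq_Rintegral => s; rewrite inE/= in_itv/= => /andP[s0 st].
by rewrite uv//= in_itv/= s0 (le_trans st).
Qed.

(** The data are extended by zero so that they are integrable on the whole line, as the
    differentiation theorem for integrals asks. *)
Lemma vint_W01p u : Lpm p u ->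
  let x := vint (fun t => if t \in I then u t else 0) in
  W01p p x /\ ae_eq mu I (x^`())%classic u.
Proof.
move=> Lu; set u' := (fun t => if _ then _ else _) => x.
have [mu_ _] := Lu.
have iu := Lpm_norm_integrable Lu.
have iui i := norm_coord_integrable i mu_ iu.
have u'E i : (fun t => u' t 0 i) = (fun t => u t 0 i) \_ I.
  by apply/funext => t; rewrite patchE /u'; case: ifP => //; rewrite mxE.
have iu' i : mu.-integrable setT (EFin \o (fun t => u' t 0 i)).
  by rewrite u'E -restrict_EFin; apply/(integrable_mkcond _ _).1 => //.
have dx : {ae mu, forall t, I t -> derivable x t 1 /\ 'D_1 x t = u t}.
  have H i : {ae mu, forall t, I t -> derivable (fun t => x t 0 i) t 1 /\
      'D_1 (fun t => x t 0 i) t = u t 0 i}.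
    have iy (b : R) : mu.-integrable `[0%R, b]
      (EFin \o (fun t => u' t 0 i)) by apply: integrableS (iu' i).
    have ly : locally_integrable [set: R] (fun t => u' t 0 i).
      by rewrite u'E; exact: integrable_locally.
    (* The differentiation theorem speaks of points strictly to the right of the base point, so the
       null set [{0}] is discarded. *)
    have n0 : {ae mu, forall t, t != 0}.
      exists [set 0]; split; [exact: measurable_set1|exact: lebesgue_measure_set1|].
      by move=> t /= /negP; rewrite negbK => /eqP.
    apply: ae_imply2 n0 (@FTC1 R _ (BLeft 0) iy ly) => t tn0 + It.
    have /andP[t0 t1] : 0 <= t <= 1 by move: It; rewrite /= in_itv.
    have {tn0}t0 : 0 < t by rewrite lt_neqAle eq_sym tn0.
    rewrite lte_fin => /(_ t0).
    rewrite (_ : (fun _ => _) = (fun t => x t 0 i)); last first.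
      by apply/funext => b; rewrite mxE.
    by rewrite derive1E /u' mem_set.
  apply: ae_imply (ae_forall_fin H) => t Ht It.
  have dxt : derivable x t 1.
    by apply/derivable_mxP => i j; rewrite ord1; have [] := Ht j It.
  split=> //; rewrite derive_mx//; apply/rowP => j; rewrite mxE.
  by have [] := Ht j It.
have xu : ae_eq mu I (x^`())%classic u.
  by apply: ae_imply dx => t H /H[_ <-]; rewrite derive1E.
split=> //; split.
- change (abs_continuous_incr (fun a b => enorm (x b - x a))).
  apply: (@abs_continuous_integral _ _ (fun t => n%:R * `|u t|)).
  + exact: integrable_mull.
  + by move=> t _; rewrite mulr_ge0.
  move=> a b a0 ab b1.
  have iun : mu.-integrable `]a, b[ (EFin \o (fun t => `|u t|)).
    by apply: integrableS iu => //; exact: subset_itv01.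
  rewrite RintegralZl//; apply: le_trans (enorm_le_norm _) _.
  rewrite ler_wpM2l//; apply: row_norm_le => [|i]; first exact: Rintegral_ge0.
  rewrite !mxE Rintegral_incr//; last by apply: integrableS (iu' i).
  have iab : mu.-integrable `]a, b[ (EFin \o (fun t => u' t 0 i)).
    by apply: integrableS (iu' i).
  apply: le_trans (le_normr_Rintegral _ iab) _ => //.
  apply: le_Rintegral => //; first exact: integrable_norm.
  move=> t tab; rewrite /u' mem_set ?row_coord_le//.
  by apply: subset_itv01 tab.
- exact: vint0.
- by apply: ae_imply dx => t H /H[].
- exact: Lpm_Lp xu.
Qed.

(** Converse of [vint_W01p]: each coordinate of [x] minus the primitive of [u] is absolutely
    continuous with zero derivative off a null set, hence constant by [abs_continuous_deriv0], and
    it vanishes at [0]. *)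
Lemma W01p_vint x u : W01p p x -> Lpm p u -> ae_eq mu I (x^`())%classic u ->
  forall t, I t -> x t = vint u t.
Proof.
move=> [ax x0 dx _] Lu xu t It.
have [[ay y0 dy _] yu] := vint_W01p Lu.
set y := vint _ in ay y0 dy yu.
have -> : vint u t = y t by apply: eq_vint => // s Is; rewrite mem_set.
clearbody y.
apply/rowP => i; apply/eqP; rewrite -subr_eq0; apply/eqP.
pose f t := x t 0 i - y t 0 i.
have f0 : f 0 = 0 by rewrite /f x0 y0 mxE subrr.
rewrite -[LHS]/(f t) -f0.
pose E := ~` [set t | I t -> [/\ derivable x t 1, derivable y t 1 &
  (x^`())%classic t = (y^`())%classic t]].
apply: (@abs_continuous_deriv0 _ f E) => //.
- apply: (@abs_continuous_incrD _ (fun a b => enorm (x b - x a))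
    (fun a b => enorm (y b - y a)) _ _ ax ay) => a b /=.
  rewrite /f (_ : _ - _ = (x b - x a) 0 i - (y b - y a) 0 i); last first.
    by rewrite !mxE; lra.
  by apply: le_trans (ler_normB _ _) _; rewrite lerD ?coord_le_enorm.
- have dxy := ae_imply2 (fun s => @conj _ _) dx dy.
  have xyu := ae_imply2 (fun s => @conj _ _) xu yu.
  apply: ae_imply2 dxy xyu => s [h1 h2] [h3 h4] Is.
  by split; [exact: h1|exact: h2|rewrite h3// h4].
move=> s Is; rewrite /E /= => /contrapT /(_ Is)[dxs dys xys].
have dxi : derivable (fun t => x t 0 i) s 1 by move/derivable_mxP: dxs; exact.
have dyi : derivable (fun t => y t 0 i) s 1 by move/derivable_mxP: dys; exact.
apply: deriv0_small; first exact: derivableB.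
rewrite deriveB//; apply/eqP; rewrite subr_eq0; apply/eqP.
have coordD (z : R -> 'rV[R]_n) : derivable z s 1 ->
    'D_1 (fun t => z t 0 i) s = (z^`())%classic s 0 i.
  by move=> dz; rewrite derive1E (derive_mx dz) mxE.
by rewrite !coordD// xys.
Qed.

End exponent.
End primitive_row.

(** * Volterra inequalities and Picard iteration *)

Section volterra.
Context (R : realType) (n : nat).
Notation mu := (@lebesgue_measure R).
Local Notation I := (`[0%R, 1%R]%classic : set R).
Implicit Types u x y z : R -> 'rV[R]_n.

Lemma in01 (t : R) : I t <-> 0 <= t /\ t <= 1.
Proof. by rewrite /= in_itv/=; split => [/andP|[-> ->]]. Qed.

Lemma Rintegral_expR (l t : R) : 0 < l -> I t ->
  \int[mu]_(s in `[0, t]) (l * expR (l * s)) = expR (l * t) - 1.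
Proof.
move=> l0 /in01[t0 t1]; move: t0; rewrite le_eqVlt => /predU1P[<-|t0].
  by rewrite set_itv1 Rintegral_set1 mulr0 expR0 subrr.
have dE (s : R) : is_derive s 1 (fun s => expR (l * s)) (l * expR (l * s)).
  have -> : l * expR (l * s) = expR (l * s) * l by rewrite mulrC.
  have dl : is_derive s (1 : R) (fun s : R => l * s) l.
    by have := is_deriveZ l (is_derive_id s (1 : R)); rewrite /GRing.scale/= mulr1.
  exact: (@is_derive1_comp _ expR (fun s => l * s)).
have cE : continuous (fun s : R => expR (l * s)).
  move=> s; apply/differentiable_continuous/derivable1_diffP.
  exact: (@ex_derive _ _ _ _ _ _ _ (dE s)).
rewrite /Rintegral (@continuous_FTC2 _ _ (fun s => expR (l * s)))//.
- by rewrite mulr0 expR0.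
- by apply: continuous_subspaceT => s; apply: cvgM; [exact: cvg_cst|exact: cE].
- split.
  + by move=> s _; exact: (@ex_derive _ _ _ _ _ _ _ (dE s)).
  + by apply: cvg_at_right_filter; exact: cE.
  + by apply: cvg_at_left_filter; exact: cE.
- by move=> s _; rewrite derive1E; exact: (@derive_val _ _ _ _ _ _ _ (dE s)).
Qed.

Lemma integrable_expR (c l : R) :
  mu.-integrable I (EFin \o (fun s => c * expR (l * s))).
Proof.
apply: continuous_compact_integrable; first exact: segment_compact.
apply: continuous_subspaceT => s; apply: cvgM; first exact: cvg_cst.
apply: continuous_comp; last exact: continuous_expR.
by apply: cvgM; [exact: cvg_cst|exact: cvg_id].
Qed.

Lemma Rintegral_itv_le (w : R -> R) t : mu.-integrable I (EFin \o w) ->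
  (forall s, I s -> 0 <= w s) -> I t ->
  \int[mu]_(s in `[0, t]) w s <= \int[mu]_(s in I) w s.
Proof.
move=> iw w0 /in01[t0 t1]; have sub : `[0, t]%classic `<=` I by exact: subset_itv01.
have iw' : mu.-integrable `[0, t] (EFin \o w) by exact: integrableS iw.
rewrite -lee_fin !EFin_Rintegral//; apply: ge0_subset_integral => //.
  exact: measurable_int iw.
Qed.

Definition row_integrable u :=
  measurable_row u /\ mu.-integrable I (EFin \o (fun t => `|u t|)).

Lemma row_integrable_coord u i : row_integrable u ->
  mu.-integrable I (EFin \o (fun t => u t 0 i)).
Proof. by move=> [m_u iu]; exact: norm_coord_integrable. Qed.

Lemma row_integrable_le u (w : R -> R) : measurable_row u ->
  (forall s, I s -> `|u s| <= w s) -> mu.-integrable I (EFin \o w) ->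
  row_integrable u.
Proof.
move=> m_u uw iw; split => //; apply: (integrable_le _ _ _ iw) => //.
  exact: measurable_norm01.
by move=> t It; rewrite normr_id uw.
Qed.

Lemma measurable_rowB u v : measurable_row u -> measurable_row v ->
  measurable_row (fun t => u t - v t).
Proof.
move=> m_u m_v i; rewrite (_ : (fun _ => _) = (fun t => u t 0 i - v t 0 i)).
  exact: measurable_funB.
by apply/funext => t; rewrite !mxE.
Qed.

Lemma row_integrableB u v : row_integrable u -> row_integrable v ->
  row_integrable (fun t => u t - v t).
Proof.
move=> [m_u iu] [m_v iv].
apply: (@row_integrable_le _ (fun t => `|u t| + `|v t|)).
- exact: measurable_rowB.
- by move=> s _; exact: ler_normB.
- exact: integrable_addr.
Qed.

Lemma vintB u v t : row_integrable u -> row_integrable v -> I t ->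
  vint (fun s => u s - v s) t = vint u t - vint v t.
Proof.
move=> iu iv /in01[t0 t1]; apply/rowP => i; rewrite !mxE -RintegralB//.
- by apply: eq_Rintegral => s _; rewrite !mxE.
- apply: integrableS (row_integrable_coord i iu) => //; exact: subset_itv01.
- apply: integrableS (row_integrable_coord i iv) => //; exact: subset_itv01.
Qed.

Lemma vint_norm_le u (w : R -> R) t : row_integrable u ->
  (forall s, I s -> `|u s| <= w s) -> mu.-integrable I (EFin \o w) -> I t ->
  `|vint u t| <= \int[mu]_(s in `[0, t]) w s.
Proof.
move=> iu uw iw /in01[t0 t1].
have sub : `[0, t]%classic `<=` I by exact: subset_itv01.
have iwt : mu.-integrable `[0, t] (EFin \o w) by exact: integrableS iw.
apply: row_norm_le => [|i].
  by apply: Rintegral_ge0 => s /sub Is; exact: le_trans (uw s Is).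
have iut : mu.-integrable `[0, t] (EFin \o (fun s => u s 0 i)).
  by apply: integrableS (row_integrable_coord i iu).
rewrite mxE; apply: le_trans (le_normr_Rintegral _ iut) _ => //.
apply: le_Rintegral => //; first exact: integrable_norm.
by move=> s /sub Is; apply: le_trans (uw s Is); exact: row_coord_le.
Qed.

Lemma measurable_vint u : row_integrable u -> measurable_row (vint u).
Proof.
move=> iu i; rewrite (_ : (fun _ => _) =
    (fun t => \int[mu]_(s in `[0, t]) u s 0 i)).
  apply: subspace_continuous_measurable_fun => //.
  apply: (@parameterized_integral_continuous _ 0 1 (fun s => u s 0 i)) => //.
  exact: row_integrable_coord.
by apply/funext => t; rewrite mxE.
Qed.

Lemma vint_bounded u t : row_integrable u -> I t ->
  `|vint u t| <= \int[mu]_(s in I) `|u s|.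
Proof.
move=> iu It; apply: (le_trans (vint_norm_le iu _ iu.2 It)) => //.
by apply: Rintegral_itv_le => //; exact: iu.2.
Qed.

(** The exponent is [2 * G] because integrating [G * B * expR (2 * G * s)] then returns at most half
    of [B * expR (2 * G * t)]. This halving is what drives both [gronwall] and [picard]. *)
Lemma vint_weight u (rho : R -> R) (G B : R) t : 0 < G -> 0 <= B ->
  row_integrable u -> mu.-integrable I (EFin \o rho) ->
  (forall s, I s -> 0 <= rho s) ->
  (forall s, I s -> `|u s| <= rho s + G * B * expR (2 * G * s)) -> I t ->
  `|vint u t| <= \int[mu]_(s in I) rho s + B / 2 * expR (2 * G * t).
Proof.
move=> G0 B0 iu irho rho0 urho It; have /in01[t0 t1] := It.
have sub : `[0, t]%classic `<=` I by exact: subset_itv01.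
have G20 : 0 < 2 * G by rewrite mulr_gt0.
have iexp : mu.-integrable I (EFin \o (fun s => 2 * G * expR (2 * G * s))).
  exact: integrable_expR.
apply: (le_trans (vint_norm_le (w := fun s =>
  rho s + B / 2 * (2 * G * expR (2 * G * s))) iu _ _ It)).
- move=> s Is; apply: le_trans (urho s Is) _; rewrite lerD2l le_eqVlt; apply/orP; left; apply/eqP.
  by field.
- by apply: integrable_addr => //; exact: integrable_mull.
rewrite RintegralD//; last 2 first.
- exact: integrableS irho.
- by apply: integrableS (integrable_mull _ _ iexp).
rewrite RintegralZl//; last exact: integrableS iexp.
rewrite Rintegral_expR//; apply: lerD; first exact: Rintegral_itv_le.
by rewrite ler_wpM2l ?divr_ge0// gerBl.
Qed.

(** Let [B] be the supremum of [|x t|] over the weight, finite because [x] is a primitive. The step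
    hypothesis and [vint_weight] give [B <= int rho + B / 2]. That hypothesis is quantified over [B]
    since a Volterra operator bounds [u s] through the history of [x], not through [x s] alone. *)
Lemma gronwall u x (rho : R -> R) (G : R) : 0 < G ->
  row_integrable u -> mu.-integrable I (EFin \o rho) ->
  (forall s, I s -> 0 <= rho s) ->
  (forall t, I t -> x t = vint u t) ->
  (forall B : R, 0 <= B -> (forall s, I s -> `|x s| <= B * expR (2 * G * s)) ->
     forall s, I s -> `|u s| <= rho s + G * B * expR (2 * G * s)) ->
  forall t, I t -> `|x t| <= 2 * (\int[mu]_(s in I) rho s) * expR (2 * G * t).
Proof.
move=> G0 iu irho rho0 xu step.
pose w t := `|x t| / expR (2 * G * t).
pose W := [set w t | t in I].
have e0 (t : R) : 0 < expR (2 * G * t) by exact: expR_gt0.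
have W0 : W !=set0 by exists (w 0), 0 => //; apply/in01.
have ubW : has_ubound W.
  exists (\int[mu]_(s in I) `|u s|) => _ [t It <-].
  rewrite /w ler_pdivrMr// xu//; apply: le_trans (vint_bounded iu It) _.
  rewrite ler_peMr//; first exact: Rintegral_ge0.
  have /in01[t0 _] := It.
  by rewrite -expR0 ler_expR mulr_ge0// mulr_ge0// ltW.
pose B := sup W.
have wB t : I t -> w t <= B by move=> It; apply: ub_le_sup => //; exists t.
have B0 : 0 <= B.
  by apply: le_trans (wB 0 _); [rewrite /w divr_ge0// ltW|apply/in01].
have xB s : I s -> `|x s| <= B * expR (2 * G * s).
  by move=> Is; rewrite -ler_pdivrMr//; exact: wB.
have key : B <= \int[mu]_(s in I) rho s + B / 2.
  apply: ge_sup => // _ [t It <-].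
  rewrite /w ler_pdivrMr// xu//.
  apply: le_trans (vint_weight G0 B0 iu irho rho0 (step B B0 xB) It) _.
  have H : \int[mu]_(s in I) rho s <= (\int[mu]_(s in I) rho s) * expR (2 * G * t).
    rewrite ler_peMr//; first exact: Rintegral_ge0.
    have /in01[t0 _] := It.
    by rewrite -expR0 ler_expR mulr_ge0// mulr_ge0// ltW.
  by move: H; lra.
move=> t It; apply: le_trans (xB t It) _; rewrite ler_wpM2r ?(ltW (e0 t))//.
by lra.
Qed.

End volterra.

Section picard.
Context (R : realType) (n : nat).
Notation mu := (@lebesgue_measure R).
Local Notation I := (`[0%R, 1%R]%classic : set R).
Implicit Types u x y z : R -> 'rV[R]_n.

Definition bounded_row x :=
  measurable_row x /\ exists M, forall s, I s -> `|x s| <= M.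

Variables (F : (R -> 'rV[R]_n) -> R -> 'rV[R]_n) (y : R -> 'rV[R]_n) (G : R).
Hypotheses (G0 : 0 < G) (iy : row_integrable y).
Hypothesis iF : forall x, bounded_row x -> row_integrable (F x).
Hypothesis lipF : forall x z (B : R), bounded_row x -> bounded_row z -> 0 <= B ->
  (forall s, I s -> `|x s - z s| <= B * expR (2 * G * s)) ->
  forall s, I s -> `|F x s - F z s| <= G * B * expR (2 * G * s).

Let T x := vint (fun s => y s - F x s).

Let iT x : bounded_row x -> row_integrable (fun s => y s - F x s).
Proof. by move=> bx; apply: row_integrableB => //; exact: iF. Qed.

Let bT x : bounded_row x -> bounded_row (T x).
Proof.
move=> bx; split; first by apply: measurable_vint; exact: iT.
by eexists => s Is; apply: vint_bounded => //; exact: iT.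
Qed.

Let T_contract x z (B : R) : bounded_row x -> bounded_row z -> 0 <= B ->
  (forall s, I s -> `|x s - z s| <= B * expR (2 * G * s)) ->
  forall s, I s -> `|T x s - T z s| <= B / 2 * expR (2 * G * s).
Proof.
move=> bx bz B0 xz t It; rewrite /T -vintB//; [|exact: iT|exact: iT].
have := @vint_weight _ _ (fun s => (y s - F x s) - (y s - F z s)) (cst 0) G B t G0 B0.
rewrite Rintegral_cst01 add0r; apply => //.
- by apply: row_integrableB; exact: iT.
- exact: integrable_cst01.
- move=> s Is; rewrite add0r (_ : _ - _ = - (F x s - F z s)); last first.
    by rewrite !opprB addrC subrKA.
  by rewrite normrN; exact: lipF.
Qed.

Let X k := iter k T (fun=> 0).

Let bX k : bounded_row (X k).
Proof.
elim: k => [|k ih]; last exact: bT.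
split; last by exists 0 => s _; rewrite normr0.
move=> i; rewrite (_ : (fun _ => _) = cst 0); first exact: measurable_cst.
by apply/funext => t; rewrite mxE.
Qed.

(** [T] halves weighted distances, so the iterates converge geometrically. The limit is taken
    pointwise, which keeps it measurable without introducing a Banach space of functions. *)
Theorem picard : exists2 x, bounded_row x &
  forall t, I t -> x t = vint (fun s => y s - F x s) t.
Proof.
have e1 s : I s -> 1 <= expR (2 * G * s).
  by move=> /in01[s0 _]; rewrite -expR0 ler_expR !mulr_ge0// ltW.
have e0 s : 0 < expR (2 * G * s) by exact: expR_gt0.
have [_ [M hM]] := bX 1.
have M0 : 0 <= M by apply: le_trans (hM 0 _); [|apply/in01].
have dX k : forall s, I s -> `|X k.+1 s - X k s| <= M / 2 ^+ k * expR (2 * G * s).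
  elim: k => [|k ih] s Is.
    by rewrite subr0 expr0 divr1; apply: le_trans (hM s Is) _; rewrite ler_peMr ?e1.
  rewrite exprSr invfM mulrA.
  have B0 : 0 <= M / 2 ^+ k by rewrite divr_ge0// exprn_ge0.
  by have := T_contract (bX k.+1) (bX k) B0 ih Is; rewrite mulrAC.
(* Telescoping: the sum of [M / 2 ^ j] over [k <= j < m + k] is
   [2 * M * (2 ^- k - 2 ^- (m + k))]. *)
have dXm k m s : I s ->
    `|X (m + k)%N s - X k s| <= 2 * M * (2 ^- k - 2 ^- (m + k)) * expR (2 * G * s).
  move=> Is; elim: m => [|m ih]; first by rewrite add0n !subrr normr0 mulr0 mul0r.
  rewrite addSn; apply: le_trans (ler_distD (X (m + k)%N s) _ _) _.
  apply: le_trans (lerD (dX _ _ Is) ih) _.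
  rewrite -mulrDl ler_wpM2r ?(ltW (e0 s))// exprS invfM.
  set a := _ ^- k; set b := (_ ^+ (m + k))^-1.
  by rewrite le_eqVlt; apply/orP; left; apply/eqP; field.
have dXc k m s : I s -> (k <= m)%N ->
    `|X m s - X k s| <= 2 * M / 2 ^+ k * expR (2 * G * s).
  move=> Is km; rewrite -(subnK km); apply: le_trans (dXm _ _ _ Is) _.
  rewrite ler_wpM2r ?(ltW (e0 s))// ler_wpM2l ?mulr_ge0//.
  by rewrite gerBl invr_ge0 exprn_ge0.
have geo0 (C : R) : C / 2 ^+ k @[k --> \oo] --> (0 : R).
  rewrite -[X in _ --> X](mulr0 C); apply: cvgM; first exact: cvg_cst.
  under eq_fun do rewrite -exprVn.
  by apply: cvg_expr; rewrite ger0_norm ?invr_ge0// invf_lt1// ltr1n.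
have geo s (e : R) : 0 < e -> \forall k \near \oo, 2 * M / 2 ^+ k * expR (2 * G * s) <= e.
  move=> ep; have := geo0 (2 * M * expR (2 * G * s)) => /cvgrPdist_le/(_ _ ep).
  apply: filterS => k; rewrite sub0r normrN mulrAC; apply: le_trans; exact: ler_norm.
have cX s : I s -> cvgn (fun k => X k s).
  move=> Is; apply: cauchy_cvg; apply/cauchyP => e ep.
  have e20 : 0 < e / 2 by rewrite divr_gt0.
  have [N _ hN] := geo s _ e20.
  exists (X N s); exists N => // m /= Nm.
  rewrite mx_norm_ball /ball_/= distrC; apply: le_lt_trans (dXc _ _ _ Is Nm) _.
  by apply: le_lt_trans (hN N (leqnn _)) _; rewrite ltr_pdivrMr// ltr_pMr// ltr1n.
pose x s := lim (X k s @[k --> \oo]).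
have Xx s : I s -> X k s @[k --> \oo] --> x s by move=> /cX.
have xX k s : I s -> `|x s - X k s| <= 2 * M / 2 ^+ k * expR (2 * G * s).
  move=> Is; have cn : `|X m s - X k s| @[m --> \oo] --> `|x s - X k s|.
    by apply: cvg_norm; apply: cvgB; [exact: Xx|exact: cvg_cst].
  by apply: (cvgr_to_le cn); exists k => // m /= km; exact: dXc.
have bx : bounded_row x.
  split.
    move=> i; apply: (@measurable_fun_cvg _ _ _ _ (fun k t => X k t 0 i)).
      by move=> k; exact: (bX k).1.
    by move=> t It; apply: cvg_row_coord; exact: Xx.
  exists (2 * M * expR (2 * G)) => s Is; have := xX 0%N s Is.
  rewrite subr0 expr0 divr1 => /le_trans; apply.
  rewrite ler_wpM2l ?mulr_ge0// ler_expR.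
  by have /in01[_ s1] := Is; rewrite ler_piMr// mulr_ge0// ltW.
exists x => // t It; apply/eqP; rewrite -subr_eq0 -normr_le0.
apply/ler_addgt0Pr => e ep; rewrite add0r.
have [|N _ hN] := geo t (e / 2); first by rewrite divr_gt0.
(* [x] is compared with [X N.+1 = T (X N)], and [T (X N)] with [T x]; each distance is at most
   [e / 2]. *)
have h1 := xX N.+1 t It.
have C0 : 0 <= 2 * M / 2 ^+ N by rewrite divr_ge0 ?mulr_ge0 ?exprn_ge0.
have h2 := T_contract bx (bX N) C0 (fun s Is => xX N s Is) It.
apply: le_trans (ler_distD (X N.+1 t) _ _) _.
rewrite (splitr e); apply: lerD.
  apply: le_trans h1 _; apply: le_trans (hN N.+1 (leqnSn N)); exact: lexx.
rewrite distrC; apply: le_trans h2 _; apply: le_trans (hN N (leqnn _)).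
by rewrite ler_wpM2r ?(ltW (e0 t))// ler_pdivrMr// ler_peMr// ler1n.
Qed.

End picard.

(** * Reduction to a Borel kernel *)

Section product_sections.
Context (R : realType).
Notation mu := (@lebesgue_measure R).
Local Notation I := (`[0%R, 1%R]%classic : set R).

Lemma ae_sections (P : R * R -> Prop) : {ae leb2 R, forall z, P z} ->
  {ae mu, forall t, {ae mu, forall s, P (t, s)}}.
Proof.
move=> [N [mN N0 PN]].
have : ae_eq mu setT (mu \o xsection N) (cst 0%E).
  apply/ae_eq_integral_abs => //; first exact: measurable_fun_xsection.
  rewrite -[RHS]N0 /leb2 /product_measure1/=.
  by apply: eq_integral => t _; rewrite gee0_abs.
apply: ae_imply => t /(_ Logic.I) /= Nt0.
exists (xsection N t); split => //; first exact: measurable_xsection.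
by move=> s /= Ps; rewrite /xsection/= inE; exact: PN.
Qed.

Lemma measurable_PDelta : measurable (PDelta R).
Proof.
have -> : PDelta R = (I `*` I) `&` [set z | z.2 <= z.1].
  apply/seteqP; split => [[t s]/= [? ? ?]|[t s]/= [[]]].
    by rewrite !in_itv.
  by rewrite !in_itv.
apply: measurableI; first exact: measurableX.
rewrite -[X in measurable X]setTI.
exact: (measurable_fun_le measurableT measurable_snd measurable_fst).
Qed.

Lemma ae_foralls_count (U : countType) d (T : measurableType d)
    (nu : {measure set T -> \bar R}) (P : U -> T -> Prop) :
  (forall u, {ae nu, forall z, P u z}) -> {ae nu, forall z, forall u, P u z}.
Proof.
move=> aP; have : {ae nu, forall z, forall k : nat,
    if unpickle k is Some u then P u z else True}.
  apply: ae_foralln => k; case: (unpickle k) => [u|]; first exact: aP.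
  exact: aeW.
by apply: ae_imply => z H u; have := H (pickle u); rewrite pickleK.
Qed.

Lemma le1_powR (r p : R) : 0 <= r -> 1 <= p -> r <= 1 + r `^ p.
Proof.
move=> r0 p1; have [r1|r1] := leP r 1.
  by apply: le_trans r1 _; rewrite lerDl powR_ge0.
apply: (@le_trans _ _ (r `^ p)); last by rewrite lerDr.
by rewrite -{1}(powRr1 r0) ler_powR// ltW.
Qed.

(** The inequality [r <= 1 + r ^ p] turns a bound on [p]-th powers over [[0, t]] into an [L^1] bound
    over the unit interval, whence [1 + K]. Here [f] is the given function, [g] a Borel version of
    it and [P0] the set of good points. *)
Lemma section_integral_le (f g : R * R -> R) (P0 : set (R * R)) (p K t : R) :
  1 <= p -> measurable P0 -> P0 `<=` PDelta R ->
  measurable_fun (PDelta R) g -> (forall z, P0 z -> 0 <= g z) -> I t ->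
  {ae mu, forall s, PDelta R (t, s) -> f (t, s) = g (t, s)} ->
  (\int[mu]_(s in `[0%R, t]) (f (t, s) `^ p)%:E <= K%:E)%E ->
  (\int[mu]_(s in I) ((g \_ P0) (t, s))%:E <= (1 + K)%:E)%E.
Proof.
move=> p1 mP0 P0D mg g0 It fg fK.
have mgP : measurable_fun setT (g \_ P0).
  by apply/(measurable_restrictT _ _).1 => //; exact: measurable_funS measurable_PDelta P0D mg.
have mgD : measurable_fun setT (g \_ (PDelta R)).
  by apply/(measurable_restrictT _ _).1 => //; exact: measurable_PDelta.
have mgDp : measurable_fun setT (fun s => (g \_ (PDelta R)) (t, s) `^ p).
  by apply: (measurableT_comp (measurable_powR p)); exact: measurableT_comp.
have mgt : measurable_fun setT (fun s => (g \_ P0) (t, s)).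
  exact: measurableT_comp.
have gP0 z : 0 <= (g \_ P0) z.
  by rewrite patchE; case: ifPn => //; rewrite inE; exact: g0.
have mgp : measurable_fun setT (fun s => (g \_ P0) (t, s) `^ p).
  exact: (measurableT_comp (measurable_powR p)).
apply: (@le_trans _ _ (\int[mu]_(s in I) (1%:E + ((g \_ P0) (t, s) `^ p)%:E))%E).
  apply: ge0_le_integral => //.
  - by move=> s _; rewrite lee_fin.
  - by apply/measurable_EFinP; exact: measurable_funTS.
  - apply: emeasurable_funD; first exact: measurable_cst.
    by apply/measurable_EFinP; exact: measurable_funTS.
  - by move=> s _; rewrite -EFinD lee_fin le1_powR.
rewrite ge0_integralD//; last 2 first.
- by move=> s _; rewrite lee_fin powR_ge0.
- by apply/measurable_EFinP; exact: measurable_funTS.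
rewrite integral_cst//= lebesgue_measure01 mule1 EFinD; apply: leeD => //.
apply: le_trans fK.
have fgD : ae_eq mu `[0, t]%classic (fun s => (f (t, s) `^ p)%:E)
    (fun s => ((g \_ (PDelta R)) (t, s) `^ p)%:E).
  apply: ae_imply fg => s H; rewrite /= in_itv/= => /andP[s0 st].
  have Dts : PDelta R (t, s).
    by move/in01: It => [t0 t1]; split => //=; apply/andP; split; lra.
  by rewrite H// patchE mem_set.
rewrite (ae_eq_integral_nonmeas fgD) [leLHS]integral_mkcond [leRHS]integral_mkcond.
apply: (@ge0_le_integral _ _ R mu) => //.
- by move=> s _; rewrite patchE; case: ifP; rewrite ?lee_fin ?powR_ge0.
- by apply/(measurable_restrictT _ _).1 => //; apply/measurable_EFinP; exact: measurable_funTS.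
- by apply/(measurable_restrictT _ _).1 => //; apply/measurable_EFinP; exact: measurable_funTS.
move=> s _; rewrite ![in leLHS]patchE; case: ifPn => Is; last first.
  by rewrite patchE; case: ifP; rewrite ?lee_fin ?powR_ge0.
case: ifPn => [|_]; last first.
  rewrite powR0 ?gt_eqF ?(lt_le_trans ltr01)//.
  by rewrite patchE; case: ifP; rewrite ?lee_fin ?powR_ge0.
rewrite inE => P0s; have [_ /andP[s0 _] st] := P0D _ P0s.
rewrite patchE mem_set; last by rewrite /= in_itv/= s0.
by rewrite patchE mem_set//; exact: P0D.
Qed.

End product_sections.

Section opnorm_theory.
Context (R : realType) (m n : nat).

Lemma enormZ (l : R) (v : 'rV[R]_n) : enorm (l *: v) = `|l| * enorm v.
Proof.
rewrite /enorm -sqrtr_sqr -sqrtrM ?sqr_ge0// mulr_sumr.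
by congr Num.sqrt; apply: eq_bigr => i _; rewrite mxE exprMn.
Qed.

Lemma enorm_eq0 (v : 'rV[R]_n) : enorm v = 0 -> v = 0.
Proof.
move=> v0; apply/rowP => i; rewrite mxE; apply/normr0_eq0/eqP.
by rewrite eq_le normr_ge0 -v0 coord_le_enorm.
Qed.

Lemma enorm0 : enorm (0 : 'rV[R]_n) = 0.
Proof. by have := enormZ 0 0; rewrite scale0r normr0 mul0r. Qed.

End opnorm_theory.

Lemma opnorm_has_ubound (R : realType) (m n : nat) (A : 'M[R]_(m, n)) :
  has_ubound [set enorm (v *m A) | v in [set v : 'rV[R]_m | enorm v <= 1]].
Proof.
exists (\sum_j \sum_i `|A i j|) => _ [w /= w1 <-].
apply: le_trans (enorm_le_sum _) _; apply: ler_sum => j _; rewrite mxE.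
apply: le_trans (ler_norm_sum _ _ _) _; apply: ler_sum => i _.
by rewrite normrM ler_piMl//; apply: le_trans w1; exact: coord_le_enorm.
Qed.

Lemma opnorm_ge0 (R : realType) (m n : nat) (A : 'M[R]_(m, n)) : 0 <= opnorm A.
Proof.
apply: ub_le_sup; first exact: opnorm_has_ubound.
by exists 0; [rewrite /= enorm0|rewrite mul0mx enorm0].
Qed.

Lemma enorm_mulmx_le (R : realType) (m n : nat) (A : 'M[R]_(m, n)) (v : 'rV[R]_m) :
  enorm (v *m A) <= opnorm A * enorm v.
Proof.
have [v0|v0] := eqVneq (enorm v) 0.
  by rewrite v0 mulr0 (enorm_eq0 v0) mul0mx enorm0.
have vgt0 : 0 < enorm v by rewrite lt_neqAle eq_sym v0 enorm_ge0.
rewrite -ler_pdivrMr//; apply: ub_le_sup; first exact: opnorm_has_ubound.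
exists ((enorm v)^-1 *: v) => /=.
  by rewrite enormZ ger0_norm ?invr_ge0 ?enorm_ge0// mulVf.
by rewrite -scalemxAl enormZ ger0_norm ?invr_ge0 ?enorm_ge0// mulrC.
Qed.

Section jacobian_cst.
Context (R : realType) (m n : nat).

Lemma jacobian_cst (a : 'rV[R]_n) (x : 'rV[R]_m) : 'J (fun=> a) x = 0.
Proof.
apply/matrixP => i j; rewrite !mxE.
by rewrite (_ : 'd _ _ = 0 :> (_ -> _)) ?mxE//; exact: diff_cst.
Qed.

End jacobian_cst.

Section local_kernel.
Context (R : realType) (n : nat).
Notation mu := (@lebesgue_measure R).
Local Notation I := (`[0%R, 1%R]%classic : set R).

(** The hypotheses in pointwise form: [A], [B], [C] are Borel versions of [a], [b], [c] put to zero
    at bad points. The function [alpha] is absorbed into a constant [L] depending on the radius, and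
    of the integrability of [b] there remain integrable sections whose integrals have an integrable
    [p]-th power. The factor [n%:R] is the price of bounding the Euclidean norm by the sup norm. *)
Record local_kernel (p : R) (Psi : R -> R -> 'rV[R]_n -> 'rV[R]_n)
    (A B C : R * R -> R) (Ga Gc : R) : Prop := LocalKernel {
  lk_measurable : forall v i,
    measurable_fun setT (fun z : R * R => Psi z.1 z.2 v 0 i);
  lk_measurableA : measurable_fun setT A;
  lk_measurableB : measurable_fun setT B;
  lk_measurableC : measurable_fun setT C;
  lk_zero : forall t s, ~ PDelta R (t, s) ->
    [/\ Psi t s = (fun=> 0), A (t, s) = 0 & C (t, s) = 0];
  lk_ge0 : forall z, [/\ 0 <= A z, 0 <= B z & 0 <= C z];
  lk_diff : forall t s x, differentiable (Psi t s) x;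
  lk_C1 : forall t s, continuous (fun x => 'J (Psi t s) x);
  lk_growth : forall t s x,
    `|Psi t s x| <= A (t, s) * (n%:R * `|x|) + B (t, s);
  lk_jacobian : forall r, 0 <= r -> exists2 L, 0 <= L &
    forall t s (x h : 'rV[R]_n), `|x| <= r ->
      `|h *m 'J (Psi t s) x| <= L * C (t, s) * `|h|;
  lk_sectionA : forall t, I t -> (\int[mu]_(s in I) (A (t, s))%:E <= Ga%:E)%E;
  lk_sectionC : forall t, I t -> (\int[mu]_(s in I) (C (t, s))%:E <= Gc%:E)%E;
  lk_sectionB : forall t, I t -> mu.-integrable I (EFin \o (fun s => B (t, s)));
  lk_sectionBp : mu.-integrable I
    (EFin \o (fun t => (\int[mu]_(s in I) B (t, s)) `^ p)) }.

Section reduction.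
Variables (p q : R) (Phi : R -> R -> 'rV[R]_n -> 'rV[R]_n).
Hypotheses (p_gt1 : 1 < p) (pq : p^-1 + q^-1 = 1).
Hypothesis Phi_measurable : forall (x : 'rV[R]_n) (i : 'I_n),
  ae_measurable (leb2 R) (PDelta R) (fun z : R * R => Phi z.1 z.2 x 0 i).
Hypothesis Phi_C1 : {ae leb2 R, forall z : R * R, PDelta R z ->
  (forall x : 'rV[R]_n, differentiable (Phi z.1 z.2) x) /\
  continuous (fun x => 'J (Phi z.1 z.2) x)}.
Variables (a b c : R * R -> R) (alpha : R -> R) (abar Cc : R).
Hypothesis a0 : forall z, PDelta R z -> 0 <= a z.
Hypothesis b0 : forall z, PDelta R z -> 0 <= b z.
Hypothesis c0 : forall z, PDelta R z -> 0 <= c z.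
Hypothesis La : ae_measurable (leb2 R) (PDelta R) a.
Hypothesis Lb : Lp_scalar (leb2 R) (PDelta R) p b.
Hypothesis Lc : ae_measurable (leb2 R) (PDelta R) c.
Hypothesis Phi_growth : {ae leb2 R, forall z : R * R, PDelta R z ->
  forall x, enorm (Phi z.1 z.2 x) <= a z * enorm x + b z}.
Hypothesis abarP : {ae mu, forall t : R, I t ->
  (\int[mu]_(s in `[0%R, t]) (a (t, s) `^ p)%:E <= (abar `^ p)%:E)%E}.
Hypothesis alpha0 : forall r, 0 <= r -> 0 <= alpha r.
Hypothesis alpha_cont : {within `[0, +oo[, continuous alpha}.
Hypothesis Phi_jacobian : {ae leb2 R, forall z : R * R, PDelta R z ->
  forall x, opnorm ('J (Phi z.1 z.2) x) <= c z * alpha (enorm x)}.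
Hypothesis Cc0 : 0 <= Cc.
Hypothesis CcP : {ae mu, forall t : R, I t ->
  (\int[mu]_(s in `[0%R, t]) (c (t, s) `^ q)%:E <= Cc%:E)%E}.

(** Two kinds of bad points are removed from the triangle: a null set [N1] of pairs where a
    pointwise hypothesis fails, and the strips over a null set [T0] of times [t] where a section
    bound fails. Almost every section of [N1] is null, so the kernels still agree for a.e. [t] and
    then a.e. [s]. *)
Lemma ae_borel_kernel : exists Psi A B C Ga Gc,
  local_kernel p Psi A B C Ga Gc /\
  {ae mu, forall t, I t -> {ae mu, forall s, PDelta R (t, s) ->
    Phi t s = Psi t s}}.
Proof.
have p0 : 0 < p by exact: lt_trans ltr01 p_gt1.
have q1 : 1 <= q.
  have q0 := conjugate_gt0 p_gt1 pq.
  by rewrite -invf_le1// -pq lerDr invr_ge0 ltW.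
have [ga mga aga] := La; have [gb mgb bgb] := Lb.1; have [gc mgc cgc] := Lc.
have /choice[g hg] : forall wi : 'rV[rat]_n * 'I_n, exists g : R * R -> R,
    measurable_fun (PDelta R) g /\
    ae_eq (leb2 R) (PDelta R) (fun z => Phi z.1 z.2 (map_mx ratr wi.1) 0 wi.2) g.
  by move=> wi; have [g mg Pg] := Phi_measurable (map_mx ratr wi.1) wi.2; exists g.
have mD := @measurable_PDelta R.
(* No section bound is assumed for [b]. Tonelli applied to the [p]-th power [H] makes its section
   integrals finite for a.e. [t], and integrable in [t]. *)
pose H z : \bar R := (((gb \_ (PDelta R)) z) `^ p)%:E.
have mH : measurable_fun setT H.
  apply/measurable_EFinP; apply: (measurableT_comp (measurable_powR p)).
  by apply/(measurable_restrictT _ _).1.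
have H0 z : (0 <= H z)%E by rewrite lee_fin powR_ge0.
have H_off z : ~ PDelta R z -> H z = 0%E.
  by move=> Dz; rewrite /H patchE memNset// powR0// gt_eqF.
have iH : (\int[leb2 R]_z H z < +oo)%E.
  have [_] := Lb; apply: le_lt_trans; rewrite le_eqVlt; apply/orP; left; apply/eqP.
  have -> : H = H \_ (PDelta R).
    apply/funext => z; rewrite patchE; case: ifPn => // Dz.
    by apply: H_off => Dz'; move: Dz; rewrite mem_set.
  rewrite -integral_mkcond; apply: ae_eq_integral_nonmeas.
  apply: ae_imply bgb => z bg Dz; rewrite /H patchE mem_set// -bg// ger0_norm//.
  exact: b0.
have iH1 : (\int[mu]_t fubini_F mu H t < +oo)%E.
  by rewrite -fubini_tonelli1.
have mFH : measurable_fun setT (fubini_F mu H).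
  exact: measurable_fun_fubini_tonelli_F.
have FH0 t : (0 <= fubini_F mu H t)%E by apply: integral_ge0 => s _.
have iFH : mu.-integrable setT (fubini_F mu H).
  apply/integrableP; split => //; apply: le_lt_trans iH1.
  by rewrite le_eqVlt; apply/orP; left; apply/eqP; apply: eq_integral => t _; rewrite gee0_abs.
have aeH : {ae mu, forall t, (fubini_F mu H t < +oo)%E}.
  apply: ae_imply (integrable_ae measurableT iFH) => t /(_ Logic.I).
  by rewrite ge0_fin_numE.
(* Agreement with Borel versions is demanded at all rational rows at once; they are countably many,
   so the exceptional set stays null. *)
pose Q1 z := PDelta R z ->
  [/\ (forall x, differentiable (Phi z.1 z.2) x) /\
      continuous (fun x => 'J (Phi z.1 z.2) x),
      forall x, enorm (Phi z.1 z.2 x) <= a z * enorm x + b z,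
      forall x, opnorm ('J (Phi z.1 z.2) x) <= c z * alpha (enorm x),
      [/\ a z = ga z, b z = gb z & c z = gc z] &
      forall wi, Phi z.1 z.2 (map_mx ratr wi.1) 0 wi.2 = g wi z].
have [N1 [mN1 N10 N1P]] : {ae leb2 R, forall z, Q1 z}.
  have e1 := ae_imply2 (fun z => @conj _ _) Phi_C1 Phi_growth.
  have e2 := ae_imply2 (fun z => @conj _ _) Phi_jacobian aga.
  have e3 := ae_imply2 (fun z => @conj _ _) bgb cgc.
  have e4 := ae_foralls_count (fun wi => (hg wi).2).
  have e12 := ae_imply2 (fun z => @conj _ _) e1 e2.
  have e34 := ae_imply2 (fun z => @conj _ _) e3 e4.
  apply: ae_imply2 e12 e34 => z [[h1 h2] [h3 h4]] [[h5 h6] h7] Dz.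
  by split; [exact: h1|exact: h2|exact: h3|rewrite h4// h5// h6|move=> wi; exact: h7].
have N1Q z : ~ N1 z -> Q1 z by move=> Nz; apply: contrapT => /N1P.
have aeN1 : {ae mu, forall t, {ae mu, forall s, ~ N1 (t, s)}}.
  by apply: (@ae_sections R (fun z => ~ N1 z)); exists N1; split => // z /= /contrapT.
pose S1 t := I t -> [/\ {ae mu, forall s, ~ N1 (t, s)},
  (\int[mu]_(s in `[0%R, t]) (a (t, s) `^ p)%:E <= (abar `^ p)%:E)%E,
  (\int[mu]_(s in `[0%R, t]) (c (t, s) `^ q)%:E <= Cc%:E)%E &
  (fubini_F mu H t < +oo)%E].
have [T0 [mT0 T00 T0P]] : {ae mu, forall t, S1 t}.
  have e1 := ae_imply2 (fun t => @conj _ _) aeN1 abarP.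
  have e2 := ae_imply2 (fun t => @conj _ _) CcP aeH.
  apply: ae_imply2 e1 e2 => t [h1 h2] [h3 h4] It.
  by split => //; [exact: h2|exact: h3].
have T0S t : ~ T0 t -> S1 t by move=> Tt; apply: contrapT => /T0P.
pose P0 := PDelta R `\` (N1 `|` (T0 `*` setT)).
have mP0 : measurable P0.
  by apply: measurableD => //; apply: measurableU => //; exact: measurableX.
have P0D : P0 `<=` PDelta R by move=> z [].
have P0Q z : P0 z -> Q1 z by move=> [_ /= /not_orP[/N1Q]].
have P0S z : P0 z -> S1 z.1.
  by move=> [_ /= /not_orP[_ hz]]; apply: T0S => Tz; apply: hz.
pose Psi t s := if (t, s) \in P0 then Phi t s else (fun=> 0).
have PsiE t s : P0 (t, s) -> Psi t s = Phi t s by move=> Pts; rewrite /Psi mem_set.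
have Psi0 t s : ~ P0 (t, s) -> Psi t s = fun=> 0 by move=> Pts; rewrite /Psi memNset.
exists Psi, (ga \_ P0), (gb \_ P0), (gc \_ P0), (1 + abar `^ p), (1 + Cc).
have res0 (f : R * R -> R) z : ~ P0 z -> (f \_ P0) z = 0.
  by move=> Pz; rewrite patchE memNset.
have resE (f : R * R -> R) z : P0 z -> (f \_ P0) z = f z.
  by move=> Pz; rewrite patchE mem_set.
have mres (f : R * R -> R) : measurable_fun (PDelta R) f -> measurable_fun setT (f \_ P0).
  by move=> mf; apply/(measurable_restrictT _ _).1 => //; exact: measurable_funS mD P0D mf.
have ga0 z : P0 z -> 0 <= ga z.
  by move=> Pz; have [_ _ _ [<- _ _] _] := P0Q _ Pz (P0D _ Pz); exact: a0 (P0D _ Pz).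
have gb0 z : P0 z -> 0 <= gb z.
  by move=> Pz; have [_ _ _ [_ <- _] _] := P0Q _ Pz (P0D _ Pz); exact: b0 (P0D _ Pz).
have gc0 z : P0 z -> 0 <= gc z.
  by move=> Pz; have [_ _ _ [_ _ <-] _] := P0Q _ Pz (P0D _ Pz); exact: c0 (P0D _ Pz).
have res_ge0 (f : R * R -> R) : (forall z, P0 z -> 0 <= f z) -> forall z, 0 <= (f \_ P0) z.
  by move=> f0 z; have [Pz|Pz] := pselect (P0 z); [rewrite resE ?f0|rewrite res0].
(* Shared by [A] and [C]. Over [t] in [T0] the section of [P0] is empty and the integral is [0],
   which [0 <= K] makes admissible. *)
have secP (f gf : R * R -> R) (r K t : R) : 1 <= r -> measurable_fun (PDelta R) gf ->
    (forall z, P0 z -> 0 <= gf z) -> I t -> 0 <= K ->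
    (forall z, ~ N1 z -> PDelta R z -> f z = gf z) ->
    (~ T0 t -> (\int[mu]_(s in `[0%R, t]) (f (t, s) `^ r)%:E <= K%:E)%E) ->
    (\int[mu]_(s in I) ((gf \_ P0) (t, s))%:E <= (1 + K)%:E)%E.
  move=> r1 mgf gf0 It K0 fgf fK.
  have [Tt|Tt] := pselect (T0 t).
    rewrite integral0_eq ?lee_fin ?addr_ge0// => s _.
    by rewrite res0// => -[_ /= /not_orP[_]]; apply.
  have [h _ _ _] := T0S _ Tt It.
  apply: section_integral_le r1 mP0 P0D mgf gf0 It _ (fK Tt).
  by apply: ae_imply h => s Ns Ds; exact: fgf.
split; last first.
  have aeT0 : {ae mu, forall t, ~ T0 t} by exists T0; split => // t /= /contrapT.
  apply: ae_imply2 aeN1 aeT0 => t h Tt It; apply: ae_imply h => s Ns Ds.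
  by rewrite PsiE//; split => //= -[//|[]].
have BH z : (((gb \_ P0) z `^ p)%:E <= H z)%E.
  have [Pz|Pz] := pselect (P0 z); last by rewrite res0// powR0 ?gt_eqF.
  by rewrite resE// /H patchE mem_set//; exact: P0D.
have mHt t : measurable_fun setT (fun s => H (t, s)) by exact: measurableT_comp.
have mBp t : measurable_fun setT (fun s => (gb \_ P0) (t, s) `^ p).
  apply: (measurableT_comp (measurable_powR p)).
  by apply: measurableT_comp => //; exact: mres.
have BFH t : (\int[mu]_(s in I) ((gb \_ P0) (t, s) `^ p)%:E <= fubini_F mu H t)%E.
  apply: (@le_trans _ _ (\int[mu]_(s in I) H (t, s))%E).
    apply: ge0_le_integral => //.
    - by move=> s _; rewrite lee_fin powR_ge0.
    - by apply/measurable_EFinP; apply: measurable_funTS; exact: mBp.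
    - by apply: measurable_funTS; exact: mHt.
  by rewrite /fubini_F; apply: ge0_subset_integral => //; exact: mHt.
have iBp t : I t -> mu.-integrable I (EFin \o (fun s => (gb \_ P0) (t, s) `^ p)).
  move=> It; apply: ge0_integrable => //.
  - by apply: measurable_funTS; exact: mBp.
  - by move=> s _; exact: powR_ge0.
  have [Tt|Tt] := pselect (T0 t).
    rewrite integral0_eq// => s _; rewrite res0 ?powR0 ?gt_eqF//.
    by move=> [_ /= /not_orP[_]]; apply.
  have [_ _ _] := T0S _ Tt It; apply: le_lt_trans; exact: BFH.
have iB t : I t -> mu.-integrable I (EFin \o (fun s => (gb \_ P0) (t, s))).
  move=> It; apply: (powR_integrable p_gt1 pq _ _ (iBp t It)).
    by apply: measurable_funTS; apply: measurableT_comp => //; exact: mres.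
  by move=> s _; exact: res_ge0.
split.
- move=> v i.
  have -> : (fun z : R * R => Psi z.1 z.2 v 0 i) =
      (fun z : R * R => Phi z.1 z.2 v 0 i) \_ P0.
    apply/funext => -[t s] /=; have [Pts|Pts] := pselect (P0 (t, s)).
      by rewrite resE// PsiE.
    by rewrite res0// Psi0// mxE.
  apply/(measurable_restrictT _ _).1 => //.
  (* With the constant argument [v], this passes from rational rows to an arbitrary one. *)
  apply: (@caratheodory_measurable _ _ R n P0
    (fun z w => Phi z.1 z.2 w 0 i) (fun=> v)) => //.
  + move=> w; apply: (eq_measurable_fun (g (w, i))).
      move=> z; rewrite inE => Pz; have [_ _ _ _ h] := P0Q _ Pz (P0D _ Pz).
      by rewrite -(h (w, i)).
    exact: measurable_funS mD P0D (hg (w, i)).1.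
  + move=> z Pz w; have [[h _] _ _ _ _] := P0Q _ Pz (P0D _ Pz).
    apply: (@continuous_comp _ _ _ (Phi z.1 z.2) (fun u : 'rV[R]_n => u 0 i)).
      by apply: differentiable_continuous; exact: h.
    exact: coord_continuous.
- exact: mres.
- exact: mres.
- exact: mres.
- move=> t s Dts; have Pts : ~ P0 (t, s) by move=> /P0D.
  by rewrite Psi0// !res0.
- by move=> z; split; exact: res_ge0.
- move=> t s x; have [Pts|Pts] := pselect (P0 (t, s)).
    by rewrite PsiE//; have [[h _] _ _ _ _] := P0Q _ Pts (P0D _ Pts); exact: h.
  by rewrite Psi0//; exact: differentiable_cst.
- move=> t s; have [Pts|Pts] := pselect (P0 (t, s)).
    by rewrite PsiE//; have [[_ h] _ _ _ _] := P0Q _ Pts (P0D _ Pts).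
  rewrite Psi0//; under eq_fun do rewrite jacobian_cst; exact: cst_continuous.
- move=> t s x; have [Pts|Pts] := pselect (P0 (t, s)); last first.
    by rewrite Psi0// normr0 !res0// mul0r addr0.
  rewrite PsiE// !resE//; have [_ h _ [aE bE _] _] := P0Q _ Pts (P0D _ Pts).
  apply: le_trans (norm_le_enorm _) _; apply: le_trans (h x) _.
  by rewrite aE bE lerD2r ler_wpM2l ?ga0 ?enorm_le_norm.
- move=> r r0; have nr0 : 0 <= n%:R * r by rewrite mulr_ge0.
  (* [|x| <= r] only gives Euclidean norm at most [n%:R * r], so [alpha] is maximized up to that
     point. *)
  have [|m m01 mmax] := @EVT_max R alpha 0 (n%:R * r) nr0.
    by apply: continuous_subspaceW alpha_cont => x /=; rewrite !in_itv/= => /andP[->].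
  exists (n%:R * alpha m).
    by rewrite mulr_ge0// alpha0//; move: m01; rewrite in_itv/= => /andP[].
  move=> t s x h xr; have [Pts|Pts] := pselect (P0 (t, s)); last first.
    by rewrite Psi0// jacobian_cst mulmx0 normr0 !res0// mulr0 mul0r.
  rewrite PsiE// resE//; have [_ _ hJ [_ _ cE] _] := P0Q _ Pts (P0D _ Pts).
  apply: le_trans (norm_le_enorm _) _; apply: le_trans (enorm_mulmx_le _ _) _.
  apply: (@le_trans _ _ (gc (t, s) * alpha m * (n%:R * `|h|))); last by lra.
  apply: ler_pM; rewrite ?enorm_ge0 ?opnorm_ge0 ?enorm_le_norm//.
  apply: le_trans (hJ x) _; rewrite cE ler_wpM2l ?gc0//; apply: mmax.
  rewrite in_itv/= enorm_ge0/=; apply: le_trans (enorm_le_norm _) _.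
  by rewrite ler_wpM2l.
- move=> t It; apply: (secP a _ p) => //; [exact: ltW|exact: powR_ge0| |].
    by move=> z Nz Dz; have [_ _ _ [-> _ _] _] := N1Q _ Nz Dz.
  by move=> Tt; have [_ ? _ _] := T0S _ Tt It.
- move=> t It; apply: (secP c _ q) => //.
    by move=> z Nz Dz; have [_ _ _ [_ _ ->] _] := N1Q _ Nz Dz.
  by move=> Tt; have [_ _ ? _] := T0S _ Tt It.
- exact: iB.
apply: ge0_integrable => //.
- apply: measurable_funTS; apply: (measurableT_comp (measurable_powR p)).
  by apply: measurable_Rintegral_snd => //; exact: mres.
- by move=> t _; exact: powR_ge0.
apply: le_lt_trans iH1.
apply: (@le_trans _ _ (\int[mu]_(t in I) fubini_F mu H t)%E); last first.
  by apply: ge0_subset_integral.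
apply: ge0_le_integral => //.
- by move=> t _; rewrite lee_fin powR_ge0.
- apply/measurable_EFinP; apply: measurable_funTS.
  apply: (measurableT_comp (measurable_powR p)).
  by apply: measurable_Rintegral_snd => //; exact: mres.
- exact: measurable_funTS.
(* By Jensen the [p]-th power of the section integral of [B] is at most the section integral of
   [B ^ p], hence at most that of [H]. *)
move=> t It; apply: le_trans (BFH t).
rewrite -(@EFin_Rintegral _ I _ _ (iBp t It))// lee_fin.
apply: (jensen01 p_gt1 pq) (iBp t It).
- by apply: measurable_funTS; apply: measurableT_comp => //; exact: mres.
- by move=> s _; exact: res_ge0.
Qed.

End reduction.
End local_kernel.

(** * Lipschitz Volterra kernels *)

Section lipschitz_kernel.
Context (R : realType) (n : nat).
Notation mu := (@lebesgue_measure R).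
Local Notation I := (`[0%R, 1%R]%classic : set R).
Variables (p q : R).
Hypotheses (p_gt1 : 1 < p) (pq : p^-1 + q^-1 = 1).
Implicit Types (x y u v : R -> 'rV[R]_n) (Psi : R -> R -> 'rV[R]_n -> 'rV[R]_n).

(** The integral runs over all of [[0, 1]]. For a kernel vanishing above the diagonal this is the
    integral up to [t], and the domain of integration no longer moves with [t]. *)
Definition volterra Psi x (t : R) : 'rV[R]_n := vint (fun s => Psi t s (x s)) 1.

Let p_gt0 : 0 < p. Proof. exact: lt_trans ltr01 p_gt1. Qed.
Let I1 : I 1. Proof. by apply/in01. Qed.

Lemma Lpm_row_integrable u : Lpm p u -> row_integrable u.
Proof. by move=> Lu; split; [exact: Lu.1|exact: (Lpm_norm_integrable p_gt1 pq)]. Qed.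

Lemma Lpm_le u (w : R -> R) : measurable_row u ->
  (forall t, I t -> `|u t| <= w t) ->
  mu.-integrable I (EFin \o (fun t => w t `^ p)) -> Lpm p u.
Proof.
move=> m_u uw iw; split => //; apply: (integrable_le _ _ _ iw) => //.
  by apply: (measurableT_comp (measurable_powR p)); exact: measurable_norm01.
move=> t It; rewrite ger0_norm ?powR_ge0//.
by rewrite ge0_ler_powR ?nnegrE ?(ltW p_gt0) ?uw// (le_trans _ (uw _ It)).
Qed.

Lemma integrable_powRD (f g : R -> R) : measurable_fun I f -> measurable_fun I g ->
  (forall t, I t -> 0 <= f t) -> (forall t, I t -> 0 <= g t) ->
  mu.-integrable I (EFin \o (fun t => f t `^ p)) ->
  mu.-integrable I (EFin \o (fun t => g t `^ p)) ->
  mu.-integrable I (EFin \o (fun t => (f t + g t) `^ p)).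
Proof.
move=> mf mg f0 g0 i_f ig.
apply: (@integrable_le _ _ _ (fun t => 2 `^ p * (f t `^ p + g t `^ p))) => //.
- by apply: (measurableT_comp (measurable_powR p)); exact: measurable_funD.
- move=> t It; rewrite ger0_norm ?powR_ge0//.
  by apply: powR_add_le; [exact: f0|exact: g0|exact: ltW].
- by apply: integrable_mull => //; exact: integrable_addr.
Qed.

Lemma LpmB u v : Lpm p u -> Lpm p v -> Lpm p (fun t => u t - v t).
Proof.
move=> [m_u iu] [m_v iv].
apply: (@Lpm_le _ (fun t => `|u t| + `|v t|)).
- exact: measurable_rowB.
- by move=> t _; exact: ler_normB.
- by apply: integrable_powRD => //; exact: measurable_norm01.
Qed.

Lemma eq_bounded_row x (z : R -> 'rV[R]_n) : (forall t, I t -> x t = z t) ->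
  bounded_row x -> bounded_row z.
Proof.
move=> xz [mx [M hM]]; split.
  move=> i; apply: eq_measurable_fun (mx i) => t; rewrite inE => It.
  by rewrite xz.
by exists M => s Is; rewrite -xz// hM.
Qed.

Lemma vint_bounded_row u : row_integrable u -> bounded_row (vint u).
Proof.
move=> iu; split; first exact: measurable_vint.
by eexists => t It; exact: vint_bounded.
Qed.

(** Rows are measurable on [[0, 1]] only; the zero extension makes the integrand Borel on the whole
    plane, as the Fubini argument of [measurable_volterra] needs. *)
Lemma measurable_superposition Psi x i :
  (forall (v : 'rV[R]_n) j, measurable_fun setT (fun z : R * R => Psi z.1 z.2 v 0 j)) ->
  (forall t s, continuous (Psi t s)) -> measurable_row x ->
  measurable_fun setT (fun z : R * R =>
    Psi z.1 z.2 (if z.2 \in I then x z.2 else 0) 0 i).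
Proof.
move=> mPsi cPsi mx.
apply: (@caratheodory_measurable _ _ R n setT
  (fun (z : R * R) w => Psi z.1 z.2 w 0 i) (fun z : R * R => if z.2 \in I then x z.2 else 0)) => //.
  move=> z _ w; apply: (@continuous_comp _ _ _ (Psi z.1 z.2) (fun u : 'rV[R]_n => u 0 i)).
    exact: cPsi.
  exact: coord_continuous.
move=> j; rewrite (_ : (fun _ => _) = ((fun t => x t 0 j) \_ I) \o snd).
  by apply: measurableT_comp => //; apply/(measurable_restrictT _ _).1.
by apply/funext => z /=; rewrite patchE; case: ifP => //; rewrite mxE.
Qed.

Lemma measurable_kernel_section Psi x t :
  (forall (v : 'rV[R]_n) j, measurable_fun setT (fun z : R * R => Psi z.1 z.2 v 0 j)) ->
  (forall t s, continuous (Psi t s)) -> measurable_row x ->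
  measurable_row (fun s => Psi t s (x s)).
Proof.
move=> mPsi cPsi mx i.
have H := measurable_superposition i mPsi cPsi mx.
apply: (@eq_measurable_fun _ _ _ _ _
  (fun s => Psi t s (if s \in I then x s else 0) 0 i)).
  by move=> s ->.
apply: measurable_funTS.
exact: (measurableT_comp H (pair1_measurable t)).
Qed.

Lemma measurable_volterra Psi x :
  (forall (v : 'rV[R]_n) j, measurable_fun setT (fun z : R * R => Psi z.1 z.2 v 0 j)) ->
  (forall t s, continuous (Psi t s)) -> measurable_row x ->
  measurable_row (volterra Psi x).
Proof.
move=> mPsi cPsi mx i.
rewrite (_ : (fun _ => _) = (fun t => \int[mu]_(s in I)
   (fun z : R * R => Psi z.1 z.2 (if z.2 \in I then x z.2 else 0) 0 i) (t, s))).
  have H := measurable_superposition i mPsi cPsi mx.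
  have mI : measurable (I : set R) by [].
  by apply: measurable_funTS; exact: (measurable_Rintegral_snd mI H).
apply/funext => t; rewrite mxE; apply: eq_Rintegral => s Is /=.
by rewrite Is.
Qed.

Lemma eq_volterra Psi x (z : R -> 'rV[R]_n) t : (forall s, I s -> x s = z s) ->
  volterra Psi x t = volterra Psi z t.
Proof. by move=> xz; apply: eq_vint => // s Is; rewrite xz. Qed.

(* The kernel [k] lives on the triangle, so only the values of [x] on [0, t]
   matter and the weight [expR (l * t)] can be taken out of the integral. *)
Lemma vint_kernel_le (k b : R * R -> R) (U : R -> 'rV[R]_n) x (G B l t : R) :
  measurable_fun setT k -> (forall z, 0 <= k z) ->
  (forall s, t < s -> k (t, s) = 0) ->
  (\int[mu]_(s in I) (k (t, s))%:E <= G%:E)%E ->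
  mu.-integrable I (EFin \o (fun s => b (t, s))) ->
  measurable_row U -> 0 <= B -> 0 <= l -> I t ->
  (forall s, I s -> `|U s| <= k (t, s) * `|x s| + b (t, s)) ->
  (forall s, I s -> `|x s| <= B * expR (l * s)) ->
  row_integrable U /\
  `|vint U 1| <= G * B * expR (l * t) + \int[mu]_(s in I) b (t, s).
Proof.
move=> mk k0 kt kG ib mU B0 l0 It Uk xB.
have Be0 : 0 <= B * expR (l * t) by rewrite mulr_ge0// expR_ge0.
have mkt : measurable_fun I (fun s => k (t, s)).
  by apply: measurable_funTS; exact: measurableT_comp.
have ik : mu.-integrable I (EFin \o (fun s => k (t, s))).
  by apply: ge0_integrable => //; exact: le_lt_trans kG (ltry _).
have kGr : \int[mu]_(s in I) k (t, s) <= G by rewrite -lee_fin EFin_Rintegral.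
have Uw s : I s -> `|U s| <= k (t, s) * (B * expR (l * t)) + b (t, s).
  move=> Is; apply: le_trans (Uk s Is) _; rewrite lerD2r.
  have [st|ts] := leP s t; last by rewrite kt// !mul0r.
  rewrite ler_wpM2l//; apply: le_trans (xB s Is) _.
  by rewrite ler_wpM2l// ler_expR ler_wpM2l.
have iw : mu.-integrable I (EFin \o
    (fun s => k (t, s) * (B * expR (l * t)) + b (t, s))).
  by apply: integrable_addr => //; exact: integrable_mulr.
have iU : row_integrable U by exact: row_integrable_le Uw iw.
split=> //; apply: le_trans (vint_norm_le iU Uw iw I1) _.
rewrite RintegralD//; last exact: integrable_mulr.
by rewrite RintegralZr// lerD2r -mulrA ler_wpM2r.
Qed.

(** With [r] the integral of [rho], the sup bound of [gronwall] fed back with [B = 2 * r] bounds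
    [|u t|] by [rho t + c * r]. The constant then comes from [powR_add_le], which gives [2 ^ p], and
    from Jensen, which bounds [r ^ p] by the integral of [rho ^ p]. *)
Lemma gronwall_Lp u x (rho : R -> R) (G : R) : 0 < G ->
  row_integrable u -> measurable_fun I rho ->
  mu.-integrable I (EFin \o (fun t => rho t `^ p)) ->
  (forall s, I s -> 0 <= rho s) ->
  (forall t, I t -> x t = vint u t) ->
  (forall B : R, 0 <= B -> (forall s, I s -> `|x s| <= B * expR (2 * G * s)) ->
     forall s, I s -> `|u s| <= rho s + G * B * expR (2 * G * s)) ->
  [/\ mu.-integrable I (EFin \o rho),
      forall t, I t -> `|x t| <= 2 * expR (2 * G) * \int[mu]_(s in I) rho s,
      Lpm p u &
      \int[mu]_(t in I) `|u t| `^ p <=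
      2 `^ p * (1 + (2 * G * expR (2 * G)) `^ p) * \int[mu]_(t in I) rho t `^ p].
Proof.
move=> G0 iu mrho irhop rho0 xu step.
have irho : mu.-integrable I (EFin \o rho) by exact: (powR_integrable p_gt1 pq).
have xB := gronwall G0 iu irho rho0 xu step.
set r := \int[mu]_(s in I) rho s in xB *.
have r0 : 0 <= r by exact: Rintegral_ge0.
have G20 : 0 <= 2 * G by rewrite mulr_ge0// ltW.
have e1 (t : R) : I t -> expR (2 * G * t) <= expR (2 * G).
  by move=> /in01[_ t1]; rewrite ler_expR ler_piMr.
have uB t : I t -> `|u t| <= rho t + 2 * G * expR (2 * G) * r.
  move=> It; apply: le_trans (step (2 * r) _ xB t It) _; first by rewrite mulr_ge0.
  rewrite lerD2l; have := ler_wpM2l (mulr_ge0 G20 r0) (e1 t It).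
  lra.
set c := 2 * G * expR (2 * G).
have c0 : 0 <= c by rewrite mulr_ge0// expR_ge0.
have icst (d : R) : mu.-integrable I (EFin \o (fun=> d : R)) by exact: integrable_cst01.
have iub : mu.-integrable I (EFin \o (fun t => (rho t + c * r) `^ p)).
  apply: (integrable_powRD mrho (measurable_cst (c * r)) rho0 _ irhop (icst ((c * r) `^ p))).
  by move=> t _; rewrite mulr_ge0.
have Lu : Lpm p u by exact: Lpm_le iu.1 uB iub.
split => //.
  move=> t It; apply: le_trans (xB t It) _.
  by have := ler_wpM2l (mulr_ge0 (ler0n R 2) r0) (e1 t It); lra.
have j := jensen01 p_gt1 pq mrho rho0 irhop.
have i2 : mu.-integrable I (EFin \o (fun t => rho t `^ p + (c * r) `^ p)).
  by apply: integrable_addr => //; exact: (icst ((c * r) `^ p)).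
apply: (@le_trans _ _ (\int[mu]_(t in I) (2 `^ p * (rho t `^ p + (c * r) `^ p)))).
  apply: le_Rintegral => //; first exact: Lu.2.
    exact: integrable_mull.
  move=> t It; apply: (@le_trans _ _ ((rho t + c * r) `^ p)).
    apply: ge0_ler_powR; rewrite ?nnegrE ?(ltW p_gt0)//; last exact: uB.
    by apply: addr_ge0; [exact: rho0|exact: mulr_ge0].
  by apply: powR_add_le; [exact: rho0|exact: mulr_ge0|exact: ltW].
rewrite RintegralZl// -mulrA ler_wpM2l ?powR_ge0//.
rewrite RintegralD//.
rewrite Rintegral_cst01 mulrDl mul1r lerD2l powRM//.
by rewrite ler_wpM2l ?powR_ge0.
Qed.

(** Common frame for the truncated kernel and the linearized one. Above the diagonal only the
    coefficient [k] vanishes, so that [Psi t s] is constant there; [B] bounds the value at [0]. *)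
Record lipschitz_kernel Psi (k B : R * R -> R) (G : R) : Prop := LipschitzKernel {
  lip_measurable : forall (v : 'rV[R]_n) i,
    measurable_fun setT (fun z : R * R => Psi z.1 z.2 v 0 i);
  lip_measurablek : measurable_fun setT k;
  lip_k0 : forall z, 0 <= k z;
  lip_zero : forall t s, t < s -> k (t, s) = 0;
  lip_lipschitz : forall t s (v w : 'rV[R]_n),
    `|Psi t s v - Psi t s w| <= k (t, s) * `|v - w|;
  lip_section : forall t, I t -> (\int[mu]_(s in I) (k (t, s))%:E <= G%:E)%E;
  lip_measurableB : measurable_fun setT B;
  lip_Psi0 : forall t s, `|Psi t s 0| <= B (t, s);
  lip_sectionB : forall t, I t -> mu.-integrable I (EFin \o (fun s => B (t, s)));
  lip_sectionBp : mu.-integrable I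
    (EFin \o (fun t => (\int[mu]_(s in I) B (t, s)) `^ p)) }.

Section lipschitz_kernel_theory.
Variables (Psi : R -> R -> 'rV[R]_n -> 'rV[R]_n) (k B : R * R -> R) (G : R).
Hypotheses (G0 : 0 < G) (lipPsi : lipschitz_kernel Psi k B G).

Lemma lip_continuous t s : continuous (Psi t s).
Proof.
have c0 : 0 < k (t, s) + 1 by rewrite ltr_wpDl ?(lip_k0 lipPsi).
move=> v A /nbhs_ballP[e /= e0 eA]; apply/nbhs_ballP.
exists (e / (k (t, s) + 1)) => /=; first by rewrite divr_gt0.
move=> w; rewrite mx_norm_ball /ball_/= ltr_pdivlMr// => vw; apply: eA.
rewrite mx_norm_ball /ball_/=; apply: le_lt_trans (lip_lipschitz lipPsi t s v w) _.
by apply: le_lt_trans vw; rewrite mulrC ler_wpM2l// lerDl.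
Qed.

Lemma lip_measurable_section x t : measurable_row x ->
  measurable_row (fun s => Psi t s (x s)).
Proof.
by apply: measurable_kernel_section; [exact: lip_measurable lipPsi|exact: lip_continuous].
Qed.

Lemma lip_section_le x (M t : R) : measurable_row x -> 0 <= M ->
  (forall s, I s -> `|x s| <= M) -> I t ->
  row_integrable (fun s => Psi t s (x s)) /\
  `|volterra Psi x t| <= G * M + \int[mu]_(s in I) B (t, s).
Proof.
move=> mx M0 hM It.
have PsixB s : I s -> `|Psi t s (x s)| <= k (t, s) * `|x s| + B (t, s).
  move=> Is; have := lip_lipschitz lipPsi t s (x s) 0.
  rewrite subr0 => h; have := lip_Psi0 lipPsi t s.
  have := ler_normD (Psi t s (x s) - Psi t s 0) (Psi t s 0); rewrite subrK.
  by move: h; lra.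
have xM s : I s -> `|x s| <= M * expR (0 * s).
  by move=> Is; rewrite mul0r expR0 mulr1 hM.
(* Exponent [0] turns the weighted estimate into a plain sup bound. *)
have [iU U1] := vint_kernel_le (lip_measurablek lipPsi) (lip_k0 lipPsi)
  (fun s => @lip_zero _ _ _ _ lipPsi t s) (lip_section lipPsi It)
  (lip_sectionB lipPsi It) (lip_measurable_section _ mx) M0 (lexx 0) It PsixB xM.
by split=> //; move: U1; rewrite mul0r expR0 mulr1.
Qed.

Lemma lip_integrable_section x t : bounded_row x -> I t ->
  row_integrable (fun s => Psi t s (x s)).
Proof.
move=> [mx [M hM]] It.
have [|s Is|//] := @lip_section_le x (Num.max M 0) t mx _ _ It.
  by rewrite le_max lexx orbT.
by rewrite le_max hM.
Qed.

Lemma lip_volterra_Lpm x : bounded_row x -> Lpm p (volterra Psi x).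
Proof.
move=> [mx [M hM]].
have M0 : 0 <= Num.max M 0 by rewrite le_max lexx orbT.
have hM' s : I s -> `|x s| <= Num.max M 0 by move=> Is; rewrite le_max hM.
have B0 z : 0 <= B z.
  by case: z => t s; apply: le_trans (lip_Psi0 lipPsi t s).
have GM : 0 <= G * Num.max M 0 by rewrite mulr_ge0// ltW.
apply: (@Lpm_le _ (fun t => G * Num.max M 0 + \int[mu]_(s in I) B (t, s))).
- by apply: measurable_volterra => //; [exact: lip_measurable lipPsi|exact: lip_continuous].
- by move=> t It; have [] := lip_section_le mx M0 hM' It.
- have mB : measurable_fun I (fun t => \int[mu]_(s in I) B (t, s)).
    have mI : measurable (I : set R) by [].
    apply: measurable_funTS.
    exact: (measurable_Rintegral_snd mI (lip_measurableB lipPsi)).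
  apply: (integrable_powRD (measurable_cst (G * Num.max M 0)) mB _ _
    (integrable_cst01 ((G * Num.max M 0) `^ p)) (lip_sectionBp lipPsi)) => // t It.
  exact: Rintegral_ge0.
Qed.

Lemma volterraB x (z : R -> 'rV[R]_n) t : bounded_row x -> bounded_row z -> I t ->
  volterra Psi x t - volterra Psi z t = vint (fun s => Psi t s (x s) - Psi t s (z s)) 1.
Proof. by move=> bx bz It; rewrite vintB//; exact: lip_integrable_section. Qed.

Lemma lip_volterra x (z : R -> 'rV[R]_n) (Bd l t : R) : bounded_row x -> bounded_row z ->
  0 <= Bd -> 0 <= l -> I t ->
  (forall s, I s -> `|x s - z s| <= Bd * expR (l * s)) ->
  `|volterra Psi x t - volterra Psi z t| <= G * Bd * expR (l * t).
Proof.
move=> bx bz Bd0 l0 It xz; rewrite volterraB//.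
have mU : measurable_row (fun s => Psi t s (x s) - Psi t s (z s)).
  by apply: measurable_rowB; apply: lip_measurable_section; [exact: bx.1|exact: bz.1].
have UB s : I s -> `|Psi t s (x s) - Psi t s (z s)| <=
    k (t, s) * `|x s - z s| + cst 0 (t, s).
  by move=> Is; rewrite addr0; exact: (lip_lipschitz lipPsi).
have [_] := vint_kernel_le (lip_measurablek lipPsi) (lip_k0 lipPsi)
  (fun s => @lip_zero _ _ _ _ lipPsi t s) (lip_section lipPsi It)
  (integrable_cst01 0) mU Bd0 l0 It UB xz.
by rewrite Rintegral_cst01 addr0.
Qed.

Lemma lip_existence y : Lpm p y -> exists2 x, bounded_row x &
  forall t, I t -> x t = vint (fun s => y s - volterra Psi x s) t.
Proof.
move=> Ly; apply: (@picard _ _ (volterra Psi) y G G0).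
- exact: Lpm_row_integrable.
- by move=> x bx; apply: Lpm_row_integrable; exact: lip_volterra_Lpm.
- move=> x z Bd bx bz Bd0 xz s Is; apply: lip_volterra => //.
  by rewrite mulr_ge0// ltW.
Qed.

End lipschitz_kernel_theory.
End lipschitz_kernel.

(** * Solutions of the reduced problem *)

Section row_calculus.
Context (R : realType) (n : nat).
Implicit Types v w : 'rV[R]_n.

(** The retraction onto the sup norm ball of radius [r]. Clipping each coordinate is 1-Lipschitz for
    this norm and does not increase it, so both the Lipschitz and the growth bounds survive. *)
Definition clip (r : R) v : 'rV[R]_n :=
  \row_i Num.max (- r) (Num.min r (v 0 i)).

Lemma clip_le r v : 0 <= r -> `|clip r v| <= r.
Proof.
move=> r0; apply: row_norm_le => // i; rewrite mxE ler_norml le_max lexx/=.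
by rewrite ge_max ge_min lexx/= andbT; lra.
Qed.

Lemma clip_lipschitz r v w : `|clip r v - clip r w| <= `|v - w|.
Proof.
apply: row_norm_le => // i; rewrite !mxE.
have := row_coord_le (v - w) i; rewrite !mxE; apply: le_trans.
set a := v 0 i; set b := w 0 i.
have := ler_norm (a - b); have := ler_norm (b - a); rewrite (distrC b).
move=> h1 h2; rewrite ler_norml.
rewrite /Num.max /Num.min.
by case: (ltP r a) => ?; case: (ltP r b) => ?; repeat (case: (ltP (- r) _) => ?);
  apply/andP; split; lra.
Qed.

Lemma clip_id r v : `|v| <= r -> clip r v = v.
Proof.
move=> vr; apply/rowP => i; rewrite mxE.
have := le_trans (row_coord_le v i) vr; rewrite ler_norml => /andP[h1 h2].
by rewrite min_r// max_r.
Qed.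

Lemma clip0 r : 0 <= r -> clip r 0 = 0.
Proof. by move=> r0; rewrite clip_id ?normr0. Qed.

Lemma clip_norm_le r v : 0 <= r -> `|clip r v| <= `|v|.
Proof. by move=> r0; have := clip_lipschitz r v 0; rewrite clip0// !subr0. Qed.

(** The sup norm allows one coordinate at a time, hence the scalar mean value theorem along the
    segment from [w] to [v], which stays in the ball by convexity. *)
Lemma mean_value_le (f : 'rV[R]_n -> 'rV[R]_n) (K r : R) v w :
  (forall x, differentiable f x) ->
  (forall x h : 'rV[R]_n, `|x| <= r -> `|h *m 'J f x| <= K * `|h|) ->
  `|v| <= r -> `|w| <= r -> `|f v - f w| <= K * `|v - w|.
Proof.
move=> df fK vr wr.
have K0 : 0 <= K * `|v - w| by apply: le_trans (fK v (v - w) vr).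
apply: row_norm_le => // i.
pose a (th : R) : 'rV[R]_n := w + th *: (v - w).
pose g (th : R) : R := f (a th) 0 i.
pose dg (th : R) : R := ((v - w) *m 'J f (a th)) 0 i.
have dgP (th : R) : is_derive th (1 : R) g (dg th).
  have dfa : derivable f (a th) (v - w) by exact: diff_derivable.
  have /derivable_mxP/(_ 0 i) dfai := dfa.
  have gE : (fun h : R => h^-1 *: ((g \o shift th) (h *: 1) - g th)) =
      (fun h : R => h^-1 *: (((fun z => f z 0 i) \o shift (a th)) (h *: (v - w)) - f (a th) 0 i)).
    apply/funext => h /=; congr (_ *: (_ - _)); rewrite /g /a.
    by rewrite [h *: 1]mulr1 scalerDl addrCA addrA.
  apply: DeriveDef; first by rewrite /derivable gE.
  rewrite /derive gE -[LHS]/('D_(v - w) (fun z => f z 0 i) (a th)).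
  by rewrite /dg -deriveEjacobian// derive_mx// mxE.
have [|c c01 E] := @MVT_segment R g dg 0 1 ler01 (fun x _ => dgP x).
  apply: continuous_subspaceT => th.
  apply/differentiable_continuous/derivable1_diffP.
  exact: (@ex_derive _ _ _ _ _ _ _ (dgP th)).
have a1 : a 1 = v by rewrite /a scale1r subrKC.
have a0 : a 0 = w by rewrite /a scale0r addr0.
have := E; rewrite /g a1 a0 subr0 mulr1 => E'.
rewrite !mxE E'; apply: le_trans (row_coord_le _ _) _; apply: fK.
move: c01; rewrite in_itv/= => /andP[c0 c1].
have -> : a c = (1 - c) *: w + c *: v.
  by rewrite /a scalerBr scalerBl scale1r addrA addrAC.
apply: le_trans (ler_normD _ _) _; rewrite !normrZ !ger0_norm ?subr_ge0//.
have c1' : 0 <= 1 - c by rewrite subr_ge0.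
have h1 := ler_wpM2l c1' wr; have h2 := ler_wpM2l c0 vr; lra.
Qed.

End row_calculus.

Section estimate.
Context (R : realType) (n : nat).
Notation mu := (@lebesgue_measure R).
Local Notation I := (`[0%R, 1%R]%classic : set R).
Variables (p q : R).
Hypotheses (p_gt1 : 1 < p) (pq : p^-1 + q^-1 = 1).

Lemma measurable_section_integral (b : R * R -> R) : measurable_fun setT b ->
  measurable_fun I (fun t => \int[mu]_(s in I) b (t, s)).
Proof.
move=> mb; have mI : measurable (I : set R) by [].
by apply: measurable_funTS; exact: (measurable_Rintegral_snd mI mb).
Qed.

Lemma section_scale (k : R * R -> R) (L G t : R) : measurable_fun setT k ->
  (forall z, 0 <= k z) -> 0 <= L ->
  (\int[mu]_(s in I) (k (t, s))%:E <= G%:E)%E ->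
  (\int[mu]_(s in I) (L * k (t, s))%:E <= (L * G)%:E)%E.
Proof.
move=> mk k0 L0 kG.
have mkt : measurable_fun I (fun s => k (t, s)).
  by apply: measurable_funTS; exact: measurableT_comp.
under eq_integral do rewrite EFinM.
rewrite ge0_integralZl//; first by rewrite EFinM lee_wpmul2l ?lee_fin.
- exact/measurable_EFinP.
- by move=> s _; rewrite lee_fin.
Qed.

(** One template for all estimates. The a priori bound takes [n%:R * A], [B] and [|y t|] for [k],
    [b] and [rho]; stability has [b = 0] and the difference of the data as [rho]; remainders have
    [rho = 0] and the remainder as [b]. The source [b] enters through its section integral, as a
    part of [rho']. *)
Lemma volterra_estimate (k b : R * R -> R) (U : R -> R -> 'rV[R]_n)
    (u x : R -> 'rV[R]_n) (rho : R -> R) (G : R) : 0 < G ->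
  measurable_fun setT k -> (forall z, 0 <= k z) ->
  (forall t s, t < s -> k (t, s) = 0) ->
  (forall t, I t -> (\int[mu]_(s in I) (k (t, s))%:E <= G%:E)%E) ->
  measurable_fun setT b -> (forall t s, I t -> I s -> 0 <= b (t, s)) ->
  (forall t, I t -> mu.-integrable I (EFin \o (fun s => b (t, s)))) ->
  mu.-integrable I (EFin \o (fun t => (\int[mu]_(s in I) b (t, s)) `^ p)) ->
  measurable_fun I rho -> (forall t, I t -> 0 <= rho t) ->
  mu.-integrable I (EFin \o (fun t => rho t `^ p)) ->
  (forall t, I t -> measurable_row (U t)) ->
  (forall t s, I t -> I s -> `|U t s| <= k (t, s) * `|x s| + b (t, s)) ->
  row_integrable u -> (forall t, I t -> x t = vint u t) ->
  (forall t, I t -> `|u t| <= rho t + `|vint (U t) 1|) ->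
  let rho' t := rho t + \int[mu]_(s in I) b (t, s) in
  [/\ mu.-integrable I (EFin \o rho'),
      forall t, I t -> `|x t| <= 2 * expR (2 * G) * \int[mu]_(s in I) rho' s,
      Lpm p u &
      \int[mu]_(t in I) `|u t| `^ p <=
      2 `^ p * (1 + (2 * G * expR (2 * G)) `^ p) * \int[mu]_(t in I) rho' t `^ p].
Proof.
move=> G0 mk k0 kt kG mb b0 ib ibp mrho rho0 irho mU Uk iu xu urho rho'.
have mib := measurable_section_integral mb.
have ib0 t : I t -> 0 <= \int[mu]_(s in I) b (t, s).
  by move=> It; apply: Rintegral_ge0 => s Is; exact: b0.
apply: (gronwall_Lp p_gt1 pq G0 iu) => //.
- exact: measurable_funD.
- exact: integrable_powRD.
- by move=> t It; rewrite addr_ge0 ?rho0 ?ib0.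
move=> B B0 xB t It; apply: le_trans (urho t It) _.
have G20 : 0 <= 2 * G by rewrite mulr_ge0// ltW.
have [_ h] := vint_kernel_le mk k0 (kt t) (kG t It) (ib t It) (mU t It) B0 G20 It
  (Uk t ^~ It) xB.
by rewrite /rho' -addrA lerD2l addrC.
Qed.

End estimate.

Section solution_theory.
Context (R : realType) (n : nat).
Notation mu := (@lebesgue_measure R).
Local Notation I := (`[0%R, 1%R]%classic : set R).
Variables (p q : R).
Hypotheses (p_gt1 : 1 < p) (pq : p^-1 + q^-1 = 1).
Implicit Types (x y u v h : R -> 'rV[R]_n).

Let I0 : I 0. Proof. by apply/in01. Qed.

(** The integral form of the problem. No derivative occurs, so the a.e. calculus is confined to the
    passage to and from [is_solution]. *)
Definition solves (Psi : R -> R -> 'rV[R]_n -> 'rV[R]_n) y x : Prop :=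
  bounded_row x /\
  forall t, I t -> x t = vint (fun s => y s - volterra Psi x s) t.

Variables (Psi : R -> R -> 'rV[R]_n -> 'rV[R]_n) (A B C : R * R -> R) (Ga Gc : R).
Hypothesis lk : local_kernel p Psi A B C Ga Gc.

Definition truncate (r : R) t s (w : 'rV[R]_n) := Psi t s (clip r w).

Lemma lk_above t s : t < s -> A (t, s) = 0 /\ C (t, s) = 0.
Proof.
move=> ts; have [|_ -> ->//] := @lk_zero _ _ _ _ _ _ _ _ _ lk t s.
by move=> [_ _ /=]; rewrite leNgt ts.
Qed.

Lemma lk_Ga_ge0 : 0 <= Ga.
Proof.
rewrite -lee_fin; apply: le_trans (lk_sectionA lk I0).
by apply: integral_ge0 => s _; rewrite lee_fin; have [] := lk_ge0 lk (0, s).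
Qed.

Lemma lk_Gc_ge0 : 0 <= Gc.
Proof.
rewrite -lee_fin; apply: le_trans (lk_sectionC lk I0).
by apply: integral_ge0 => s _; rewrite lee_fin; have [] := lk_ge0 lk (0, s).
Qed.

Lemma lk_lipschitz r : 0 <= r -> exists2 L, 0 <= L &
  (forall t s (v w : 'rV[R]_n), `|v| <= r -> `|w| <= r ->
    `|Psi t s v - Psi t s w| <= L * C (t, s) * `|v - w|) /\
  (forall t s (v h : 'rV[R]_n), `|v| <= r ->
    `|h *m 'J (Psi t s) v| <= L * C (t, s) * `|h|).
Proof.
move=> r0; have [L L0 hL] := lk_jacobian lk r0; exists L => //; split => //.
move=> t s v w; apply: mean_value_le; first exact: (lk_diff lk).
by move=> x h; exact: hL.
Qed.

(** Serves both the truncated kernel, with [D = B], and the linearized one, with [D = 0]. The [+ 1]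
    makes the constant positive even if [L * Gc] is zero. *)
Lemma lk_lipschitz_kernel (r L : R) (Th : R -> R -> 'rV[R]_n -> 'rV[R]_n)
    (D : R * R -> R) : 0 <= L ->
  (forall (v : 'rV[R]_n) i, measurable_fun setT (fun z : R * R => Th z.1 z.2 v 0 i)) ->
  (forall t s (v w : 'rV[R]_n), `|Th t s v - Th t s w| <= L * C (t, s) * `|v - w|) ->
  measurable_fun setT D -> (forall t s, `|Th t s 0| <= D (t, s)) ->
  (forall t, I t -> mu.-integrable I (EFin \o (fun s => D (t, s)))) ->
  mu.-integrable I (EFin \o (fun t => (\int[mu]_(s in I) D (t, s)) `^ p)) ->
  lipschitz_kernel p Th (fun z => L * C z) D (L * Gc + 1).
Proof.
move=> L0 mTh lTh mD ThD iD iDp; split => //.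
- by apply: measurable_funM => //; exact: lk_measurableC lk.
- by move=> z; rewrite mulr_ge0//; have [] := lk_ge0 lk z.
- by move=> t s /lk_above[_ ->]; rewrite mulr0.
- move=> t It; apply: (@le_trans _ _ (L * Gc)%:E); last by rewrite lee_fin lerDl.
  apply: section_scale => //; first exact: lk_measurableC lk.
  + by move=> z; have [] := lk_ge0 lk z.
  + exact: lk_sectionC lk _ It.
Qed.

Lemma truncate_growth r t s w : 0 <= r ->
  `|truncate r t s w| <= n%:R * A (t, s) * `|w| + B (t, s).
Proof.
move=> r0; apply: le_trans (lk_growth lk _ _ _) _; rewrite lerD2r.
have [A0 _ _] := lk_ge0 lk (t, s).
rewrite mulrCA mulrA ler_wpM2l ?clip_norm_le// mulr_ge0//.
Qed.

Lemma truncate_lipschitz_kernel r : 0 <= r -> exists2 L, 0 <= L &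
  lipschitz_kernel p (truncate r) (fun z => L * C z) B (L * Gc + 1).
Proof.
move=> r0; have [L L0 [hL _]] := lk_lipschitz r0; exists L => //.
apply: lk_lipschitz_kernel => //.
- by move=> v i; exact: lk_measurable lk _ _.
- move=> t s v w; apply: le_trans (hL _ _ _ _ (clip_le _ r0) (clip_le _ r0)) _.
  rewrite ler_wpM2l ?clip_lipschitz// mulr_ge0//; have [] := lk_ge0 lk (t, s) => //.
- exact: lk_measurableB lk.
- move=> t s; have := truncate_growth t s 0 r0.
  by rewrite normr0 mulr0 add0r.
- exact: lk_sectionB lk.
- exact: lk_sectionBp lk.
Qed.

Lemma truncate_volterra r x t : (forall s, I s -> `|x s| <= r) ->
  volterra (truncate r) x t = volterra Psi x t.
Proof. by move=> xr; apply: eq_vint; [apply/in01|move=> s Is; rewrite /truncate clip_id ?xr]. Qed.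

Lemma solves_truncate r y x :
  (forall s, I s -> `|x s| <= r) ->
  solves (truncate r) y x <-> solves Psi y x.
Proof.
move=> xr; have E : (fun s => y s - volterra (truncate r) x s) =
    (fun s => y s - volterra Psi x s).
  by apply/funext => s; rewrite truncate_volterra.
by rewrite /solves E.
Qed.

Lemma lipschitz_kernel_Lpm Th k D G y x : 0 < G -> lipschitz_kernel p Th k D G ->
  Lpm p y -> bounded_row x -> Lpm p (fun s => y s - volterra Th x s).
Proof. by move=> G0 lT Ly bx; apply: LpmB => //; exact: (lip_volterra_Lpm p_gt1 G0 lT bx). Qed.

Lemma LGc_gt0 L : 0 <= L -> 0 < L * Gc + 1.
Proof. by move=> L0; rewrite ltr_wpDl// mulr_ge0// lk_Gc_ge0. Qed.

(** The sup bound of [volterra_estimate] for the coefficient [n%:R * A], with [Y] bounding the mean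
    of the data. It uses [truncate_growth] and not the Lipschitz constant, and so is free of the
    clipping radius. The [+ 1] keeps the exponent positive. *)
Definition apriori_bound (Y : R) : R :=
  2 * expR (2 * (n%:R * Ga + 1)) *
  (Y + \int[mu]_(t in I) (\int[mu]_(s in I) B (t, s))).

Let mB : measurable_fun I (fun t => \int[mu]_(s in I) B (t, s)).
Proof. by apply: measurable_section_integral; exact: lk_measurableB lk. Qed.

Let B0 t : 0 <= \int[mu]_(s in I) B (t, s).
Proof. by apply: Rintegral_ge0 => s _; have [] := lk_ge0 lk (t, s). Qed.

Lemma truncate_apriori r Y y x : 0 <= r -> Lpm p y ->
  \int[mu]_(t in I) `|y t| <= Y -> solves (truncate r) y x ->
  forall t, I t -> `|x t| <= apriori_bound Y.
Proof.
move=> r0 Ly yY [bx xE] t It.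
have [L L0 lT] := truncate_lipschitz_kernel r0.
have G0 := LGc_gt0 L0.
have iu := Lpm_row_integrable p_gt1 pq (lipschitz_kernel_Lpm G0 lT Ly bx).
have nA0 z : 0 <= n%:R * A z by rewrite mulr_ge0//; have [] := lk_ge0 lk z.
have Ga0 := lk_Ga_ge0.
have Gn0 : 0 < n%:R * Ga + 1 by rewrite ltr_wpDl// mulr_ge0.
have mA := lk_measurableA lk.
have mnA : measurable_fun setT (fun z => n%:R * A z) by exact: measurable_funM.
have iy := Lpm_row_integrable p_gt1 pq Ly.
have k0 t' s' : t' < s' -> n%:R * A (t', s') = 0.
  by move=> /lk_above[-> _]; rewrite mulr0.
have kG t' : I t' -> (\int[mu]_(s in I) (n%:R * A (t', s))%:E <= (n%:R * Ga + 1)%:E)%E.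
  move=> It'; apply: (@le_trans _ _ (n%:R * Ga)%:E); last by rewrite lee_fin lerDl.
  apply: section_scale => //; last exact: lk_sectionA lk _ It'.
  by move=> z; have [] := lk_ge0 lk z.
have BB t' s' : I t' -> I s' -> 0 <= B (t', s').
  by move=> _ _; have [] := lk_ge0 lk (t', s').
have mU t' : I t' -> measurable_row (fun s => truncate r t' s (x s)).
  by move=> It'; exact: (lip_measurable_section lT t' bx.1).
pose U t' s' := truncate r t' s' (x s').
have uU t' : I t' -> `|y t' - volterra (truncate r) x t'| <= `|y t'| + `|vint (U t') 1|.
  by move=> _; exact: ler_normB.
have UA t' s' : I t' -> I s' ->
    `|U t' s'| <= n%:R * A (t', s') * `|x s'| + B (t', s').
  by move=> _ _; exact: truncate_growth.
have y0 t' : I t' -> 0 <= `|y t'| by [].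
have [_ xB _ _] := volterra_estimate p_gt1 pq Gn0 mnA nA0 k0 kG
  (lk_measurableB lk) BB (lk_sectionB lk) (lk_sectionBp lk)
  (measurable_norm01 Ly.1) y0 Ly.2 mU UA iu xE uU.
apply: le_trans (xB t It) _; rewrite /apriori_bound ler_wpM2l ?mulr_ge0 ?expR_ge0//.
rewrite RintegralD//; first by rewrite lerD2r.
- exact: iy.2.
- by apply: (powR_integrable p_gt1 pq) => //; exact: lk_sectionBp lk.
Qed.

Lemma apriori_bound_ge0 Y : 0 <= Y -> 0 <= apriori_bound Y.
Proof.
move=> Y0; rewrite /apriori_bound mulr_ge0 ?mulr_ge0 ?expR_ge0// addr_ge0//.
exact: Rintegral_ge0.
Qed.

(** A solution also solves the problem clipped at any bound [M] of its own, and the estimate there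
    does not depend on [M]. *)
Lemma solves_apriori Y y x : Lpm p y -> \int[mu]_(t in I) `|y t| <= Y ->
  solves Psi y x -> forall t, I t -> `|x t| <= apriori_bound Y.
Proof.
move=> Ly yY sx; have [[mx [M hM]] _] := sx.
have M0 : 0 <= M by apply: le_trans (hM 0 I0).
case: (solves_truncate y hM) => _ /(_ sx) tx.
exact: (truncate_apriori M0 Ly yY tx).
Qed.

(** The kernel is clipped at the a priori radius itself, so the solution of the clipped problem
    never meets the clipping. *)
Lemma solves_exists y : Lpm p y -> exists x, solves Psi y x.
Proof.
move=> Ly; set Y := \int[mu]_(t in I) `|y t|.
have Y0 : 0 <= Y by exact: Rintegral_ge0.
have r0 := apriori_bound_ge0 Y0.
have [L L0 lT] := truncate_lipschitz_kernel r0.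
have [x bx xE] := lip_existence p_gt1 pq (LGc_gt0 L0) lT Ly.
have sx : solves (truncate (apriori_bound Y)) y x by [].
have yY : \int[mu]_(t in I) `|y t| <= Y by exact: lexx.
have xr := truncate_apriori r0 Ly yY sx.
by exists x; case: (solves_truncate y xr) => + _; apply.
Qed.

Lemma solves_Lpm y x : Lpm p y -> solves Psi y x ->
  Lpm p (fun s => y s - volterra Psi x s).
Proof.
move=> Ly [[mx [M hM]] xE].
have M0 : 0 <= M by apply: le_trans (hM 0 I0).
have [L L0 lT] := truncate_lipschitz_kernel M0.
have bx : bounded_row x by split => //; exists M.
have := lipschitz_kernel_Lpm (LGc_gt0 L0) lT Ly bx.
by rewrite (_ : (fun s => _) = (fun s => y s - volterra Psi x s))//; apply/funext => s; rewrite truncate_volterra.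
Qed.

End solution_theory.

(** * Linearization and its remainders *)

Section norm_cancellation.
Context (R : realType) (n : nat).
Implicit Types a b c y z : 'rV[R]_n.

Lemma norm_sub_sub y z a b : `|(y - a) - (z - b)| <= `|y - z| + `|a - b|.
Proof.
have -> : (y - a) - (z - b) = (y - z) - (a - b).
  by apply/rowP => i; rewrite !mxE; lra.
exact: ler_normB.
Qed.

Lemma norm_cancel_sub y a b : `|(y - a) - (y - b)| <= `|a - b|.
Proof. by have := norm_sub_sub y y a b; rewrite subrr normr0 add0r. Qed.

Lemma norm_cancel_sub2 y z a b c :
  `|(y + z - a) - (y - b) - (z - c)| <= `|a - b - c|.
Proof.
rewrite (_ : _ - (z - c) = - (a - b - c)) ?normrN//.
by apply/rowP => i; rewrite !mxE; lra.
Qed.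

Lemma row_coordB a b i : (a - b) 0 i = a 0 i - b 0 i.
Proof. by rewrite !mxE. Qed.

End norm_cancellation.

Section linearization.
Context (R : realType) (n : nat).
Notation mu := (@lebesgue_measure R).
Local Notation I := (`[0%R, 1%R]%classic : set R).
Variables (p q : R).
Hypotheses (p_gt1 : 1 < p) (pq : p^-1 + q^-1 = 1).
Implicit Types (x y z u v h : R -> 'rV[R]_n).

Let p_gt0 : 0 < p. Proof. exact: lt_trans ltr01 p_gt1. Qed.

Variables (Psi : R -> R -> 'rV[R]_n -> 'rV[R]_n) (A B C : R * R -> R) (Ga Gc : R).
Hypothesis lk : local_kernel p Psi A B C Ga Gc.

(** Solutions are measurable and bounded on [[0, 1]] only, while a [lipschitz_kernel] has to be
    Borel and Lipschitz on the whole plane. *)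
Definition extend0 x (s : R) : 'rV[R]_n := if s \in I then x s else 0.

Definition linear_kernel x (t s : R) (v : 'rV[R]_n) : 'rV[R]_n :=
  v *m 'J (Psi t s) (extend0 x s).

Lemma extend0E x s : I s -> extend0 x s = x s.
Proof. by move=> Is; rewrite /extend0 mem_set. Qed.

Lemma extend0_le x r s : 0 <= r -> (forall s, I s -> `|x s| <= r) ->
  `|extend0 x s| <= r.
Proof.
move=> r0 xr; rewrite /extend0; case: ifPn; last by rewrite normr0.
by rewrite inE; exact: xr.
Qed.

Lemma measurable_extend0 x j : measurable_row x ->
  measurable_fun setT (fun z : R * R => extend0 x z.2 0 j).
Proof.
move=> mx; rewrite (_ : (fun _ => _) = ((fun t => x t 0 j) \_ I) \o snd).
  by apply: measurableT_comp => //; apply/(measurable_restrictT _ _).1.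
by apply/funext => z /=; rewrite patchE /extend0; case: ifP => //; rewrite mxE.
Qed.

Lemma lk_superposition (X : R * R -> 'rV[R]_n) i :
  (forall j, measurable_fun setT (fun z : R * R => X z 0 j)) ->
  measurable_fun setT (fun z : R * R => Psi z.1 z.2 (X z) 0 i).
Proof.
move=> mX.
apply: (@caratheodory_measurable _ _ R n setT
  (fun (z : R * R) w => Psi z.1 z.2 w 0 i) X) => //.
  by move=> w; exact: lk_measurable lk _ _.
move=> z _ w; apply: (@continuous_comp _ _ _ (Psi z.1 z.2) (fun u : 'rV[R]_n => u 0 i)).
  by apply: differentiable_continuous; exact: lk_diff lk _ _ _.
exact: coord_continuous.
Qed.

(** The Jacobian applied to [v] is the pointwise limit of difference quotients with steps
    [1 / (m + 1)], each Borel by superposition. *)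
Lemma measurable_linear_kernel x (v : 'rV[R]_n) i : measurable_row x ->
  measurable_fun setT (fun z : R * R => linear_kernel x z.1 z.2 v 0 i).
Proof.
move=> mx.
pose D m (z : R * R) : R := m.+1%:R *
  (Psi z.1 z.2 (extend0 x z.2 + m.+1%:R^-1 *: v) 0 i - Psi z.1 z.2 (extend0 x z.2) 0 i).
apply: (@measurable_fun_cvg _ _ _ _ D).
  move=> m; apply: measurable_funM; first exact: measurable_cst.
  apply: measurable_funB; apply: lk_superposition => j; last exact: measurable_extend0.
  rewrite (_ : (fun _ => _) = (fun z : R * R => extend0 x z.2 0 j + m.+1%:R^-1 * v 0 j)).
    by apply: measurable_funD; [exact: measurable_extend0|exact: measurable_cst].
  by apply/funext => z; rewrite !mxE.
move=> z _; set a := extend0 x z.2; set f := Psi z.1 z.2.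
have df : derivable f a v by apply: diff_derivable; exact: lk_diff lk _ _ _.
have Df : 'D_v f a = v *m 'J f a by apply: deriveEjacobian; exact: lk_diff lk _ _ _.
have cf : h^-1 *: ((f \o shift a) (h *: v) - f a) @[h --> 0^'] --> v *m 'J f a.
  by rewrite -Df; exact: df.
have c0 : m.+1%:R^-1 @[m --> \oo] --> (0 : R)^'.
  move=> P /nbhs_ballP[e /= e0 eP]; apply: filterS (near_infty_natSinv_lt (PosNum e0)) => m /= me.
  apply: eP; last by rewrite invr_eq0 pnatr_eq0.
  by rewrite /ball/= sub0r normrN ger0_norm// invr_ge0.
have := cvg_row_coord (i := i) (cvg_comp _ _ c0 cf).
rewrite /linear_kernel -/a -/f; apply: cvg_trans; apply: near_eq_cvg.
by apply: nearW => m; rewrite /D /= -/f -/a !mxE invrK [_ *: v + a]addrC.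
Qed.

Section ball.
Variables (r L : R).
Hypotheses (r0 : 0 <= r) (L0 : 0 <= L).
Hypothesis lipL : forall t s (v w : 'rV[R]_n), `|v| <= r -> `|w| <= r ->
  `|Psi t s v - Psi t s w| <= L * C (t, s) * `|v - w|.
Hypothesis jacL : forall t s (v h : 'rV[R]_n), `|v| <= r ->
  `|h *m 'J (Psi t s) v| <= L * C (t, s) * `|h|.

Let G := L * Gc + 1.
Let G0 : 0 < G. Proof. exact: (LGc_gt0 lk L0). Qed.
Let kC (z : R * R) := L * C z.
Let kC0 (z : R * R) : 0 <= kC z.
Proof. by rewrite mulr_ge0//; have [] := lk_ge0 lk z. Qed.
Let mkC : measurable_fun setT kC.
Proof. by apply: measurable_funM => //; exact: lk_measurableC lk. Qed.
Let kCz t s : t < s -> kC (t, s) = 0.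
Proof. by move=> /(lk_above lk)[_ h]; rewrite /kC h mulr0. Qed.
Let kCG t : I t -> (\int[mu]_(s in I) (kC (t, s))%:E <= G%:E)%E.
Proof.
move=> It; apply: (@le_trans _ _ (L * Gc)%:E); last by rewrite lee_fin lerDl.
apply: section_scale => //; first exact: lk_measurableC lk.
  by move=> z; have [] := lk_ge0 lk z.
exact: lk_sectionC lk _ It.
Qed.
Let ikC t : I t -> mu.-integrable I (EFin \o (fun s => kC (t, s))).
Proof.
move=> It; apply: ge0_integrable => //; last exact: le_lt_trans (kCG It) (ltry _).
by apply: measurable_funTS; exact: measurableT_comp.
Qed.

(** This and [norm_constant] are the two constants of [gronwall_Lp] for [G = L * Gc + 1]; they
    depend on the ball only through [L]. *)
Definition sup_constant : R := 2 * expR (2 * G).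
Definition norm_constant : R := 2 `^ p * (1 + (2 * G * expR (2 * G)) `^ p).

Lemma section_bounded_powR (b : R * R -> R) (M : R) : measurable_fun setT b ->
  0 <= M -> (forall t s, I t -> I s -> 0 <= b (t, s) <= M * kC (t, s)) ->
  (forall t, I t -> mu.-integrable I (EFin \o (fun s => b (t, s)))) /\
  mu.-integrable I (EFin \o (fun t => (\int[mu]_(s in I) b (t, s)) `^ p)).
Proof.
move=> mb M0 bM.
have ib t : I t -> mu.-integrable I (EFin \o (fun s => b (t, s))).
  move=> It; apply: (integrable_le _ _ _ (integrable_mull M _ (ikC It))) => //.
    by apply: measurable_funTS; exact: measurableT_comp.
  by move=> s Is; have /andP[b0 bk] := bM t s It Is; rewrite ger0_norm.
split=> //; apply: (@integrable_bounded01 _ _ ((M * G) `^ p)).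
  by apply: (measurableT_comp (measurable_powR p)); exact: measurable_section_integral.
move=> t It; rewrite ger0_norm ?powR_ge0//.
have i0 : 0 <= \int[mu]_(s in I) b (t, s).
  by apply: Rintegral_ge0 => s Is; have /andP[] := bM t s It Is.
have MG0 : 0 <= M * G by rewrite mulr_ge0// ltW.
apply: ge0_ler_powR; rewrite ?nnegrE ?(ltW p_gt0)//.
apply: (@le_trans _ _ (\int[mu]_(s in I) (M * kC (t, s)))).
  apply: le_Rintegral => //; [exact: ib|exact: integrable_mull (ikC It)|].
  by move=> s Is; have /andP[] := bM t s It Is.
rewrite RintegralZl//; last exact: ikC.
by rewrite ler_wpM2l// -lee_fin EFin_Rintegral ?kCG//; exact: ikC.
Qed.

Lemma ball_estimate (U : R -> R -> 'rV[R]_n) u x (rho : R -> R) :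
  measurable_fun I rho -> (forall t, I t -> 0 <= rho t) ->
  mu.-integrable I (EFin \o (fun t => rho t `^ p)) ->
  (forall t, I t -> measurable_row (U t)) ->
  (forall t s, I t -> I s -> `|U t s| <= kC (t, s) * `|x s|) ->
  row_integrable u -> (forall t, I t -> x t = vint u t) ->
  (forall t, I t -> `|u t| <= rho t + `|vint (U t) 1|) ->
  [/\ forall t, I t -> `|x t| <= sup_constant * \int[mu]_(s in I) rho s,
      Lpm p u &
      \int[mu]_(t in I) `|u t| `^ p <=
      norm_constant * \int[mu]_(t in I) rho t `^ p].
Proof.
move=> mrho rho0 irho mU UC iu xu urho.
have m0 : measurable_fun setT (cst 0 : R * R -> R) by exact: measurable_cst.
have i0 (t : R) : I t -> mu.-integrable I (EFin \o (fun s => (cst 0 : R * R -> R) (t, s))).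
  by move=> _; exact: integrable_cst01.
have z0 (t : R) : \int[mu]_(s in I) (cst 0 : R * R -> R) (t, s) = 0.
  exact: Rintegral_cst01.
have i0p : mu.-integrable I (EFin \o (fun t =>
    (\int[mu]_(s in I) (cst 0 : R * R -> R) (t, s)) `^ p)).
  rewrite (_ : (fun _ => _) = cst (0 `^ p)); first exact: integrable_cst01.
  by apply/funext => t; rewrite z0.
have UC0 t s : I t -> I s -> `|U t s| <= kC (t, s) * `|x s| + cst 0 (t, s).
  by move=> It Is; rewrite addr0 UC.
have [_ xB Lu uB] := volterra_estimate p_gt1 pq G0 mkC kC0 kCz kCG m0
  (fun _ _ _ _ => lexx 0) i0 i0p mrho rho0 irho mU UC0 iu xu urho.
have rE (phi : R -> R) : \int[mu]_(t in I)
    phi (rho t + \int[mu]_(s in I) (cst 0 : R * R -> R) (t, s)) =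
    \int[mu]_(t in I) phi (rho t).
  by apply: eq_Rintegral => s _; rewrite z0 addr0.
split; [move=> t It|exact: Lu|].
  by apply: le_trans (xB t It) _; rewrite /sup_constant -(rE id) lexx.
by apply: le_trans uB _; rewrite -(rE (fun r => r `^ p)) lexx.
Qed.

(** Writing the source as [d * sigma] brings out the factor [d ^ p], later compared with the norm of
    [h]; only the integral of [sigma] is left to tend to zero. *)
Lemma remainder_estimate (U : R -> R -> 'rV[R]_n) u x (sigma : R * R -> R) (d M : R) :
  0 <= d -> 0 <= M -> measurable_fun setT sigma ->
  (forall t s, I t -> I s -> 0 <= sigma (t, s) <= M * kC (t, s)) ->
  (forall t, I t -> measurable_row (U t)) ->
  (forall t s, I t -> I s -> `|U t s| <= kC (t, s) * `|x s| + d * sigma (t, s)) ->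
  row_integrable u -> (forall t, I t -> x t = vint u t) ->
  (forall t, I t -> `|u t| <= `|vint (U t) 1|) ->
  \int[mu]_(t in I) `|u t| `^ p <= norm_constant *
    (d `^ p * \int[mu]_(t in I) (\int[mu]_(s in I) sigma (t, s)) `^ p).
Proof.
move=> d0 M0 ms sM mU UC iu xu uU.
pose b (z : R * R) := d * sigma z.
have mb : measurable_fun setT b by exact: measurable_funM.
have bM t s : I t -> I s -> 0 <= b (t, s) <= d * M * kC (t, s).
  move=> It Is; have /andP[s0 sk] := sM t s It Is.
  by rewrite /b mulr_ge0//= -mulrA ler_wpM2l.
have [ib ibp] := section_bounded_powR mb (mulr_ge0 d0 M0) bM.
have [is_ isp] := section_bounded_powR ms M0 sM.
have i00 : mu.-integrable I (EFin \o (fun t : R => (0 : R) `^ p)) by exact: integrable_cst01.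
have urho t : I t -> `|u t| <= 0 + `|vint (U t) 1| by rewrite add0r; exact: uU.
have b0 t s : I t -> I s -> 0 <= b (t, s).
  by move=> It Is; have /andP[] := bM t s It Is.
have [_ _ _ uB] := volterra_estimate p_gt1 pq G0 mkC kC0 kCz kCG mb b0 ib ibp
  (measurable_cst (0 : R)) (fun _ _ => lexx 0) i00 mU UC iu xu urho.
apply: le_trans uB _; rewrite /norm_constant ler_wpM2l ?mulr_ge0 ?addr_ge0 ?powR_ge0//.
rewrite -RintegralZl// le_eqVlt; apply/orP; left; apply/eqP.
apply: eq_Rintegral => t; rewrite inE => It; rewrite add0r RintegralZl//; last exact: is_.
by rewrite powRM//; apply: Rintegral_ge0 => s Is; have /andP[] := sM t s It Is.
Qed.

Lemma linear_lipschitz_kernel x : measurable_row x -> (forall s, I s -> `|x s| <= r) ->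
  lipschitz_kernel p (linear_kernel x) kC (fun=> 0) G.
Proof.
move=> mx xr; apply: (lk_lipschitz_kernel lk) => //.
- by move=> v i; exact: measurable_linear_kernel.
- by move=> t s v w; rewrite /linear_kernel -mulmxBl jacL// extend0_le.
- by move=> t s; rewrite /linear_kernel mul0mx normr0.
- by move=> t _; exact: integrable_cst01.
- rewrite (_ : (fun _ => _) = cst (0 `^ p)); first exact: integrable_cst01.
  by apply/funext => t; rewrite Rintegral_cst01.
Qed.

Lemma lk_measurable_section x t : measurable_row x ->
  measurable_row (fun s => Psi t s (x s)).
Proof.
apply: measurable_kernel_section; first exact: lk_measurable lk.
by move=> t' s' w; apply: differentiable_continuous; exact: lk_diff lk _ _ _.
Qed.

Lemma lk_integrable_section x t : measurable_row x ->
  (forall s, I s -> `|x s| <= r) -> I t -> row_integrable (fun s => Psi t s (x s)).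
Proof.
move=> mx xr It.
have iw : mu.-integrable I (EFin \o (fun s => A (t, s) * (n%:R * r) + B (t, s))).
  apply: integrable_addr => //; last exact: lk_sectionB lk _ It.
  apply: integrable_mulr => //; apply: ge0_integrable => //.
  - by apply: measurable_funTS; apply: measurableT_comp => //; exact: lk_measurableA lk.
  - by move=> s _; have [] := lk_ge0 lk (t, s).
  - exact: le_lt_trans (lk_sectionA lk It) (ltry _).
apply: row_integrable_le iw; first exact: lk_measurable_section.
move=> s Is; apply: le_trans (lk_growth lk _ _ _) _; rewrite lerD2r.
have [A0 _ _] := lk_ge0 lk (t, s).
by rewrite ler_wpM2l// ler_wpM2l// xr.
Qed.

Lemma solves_stable y1 y2 x1 x2 : Lpm p y1 -> Lpm p y2 ->
  solves Psi y1 x1 -> solves Psi y2 x2 ->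
  (forall s, I s -> `|x1 s| <= r) -> (forall s, I s -> `|x2 s| <= r) ->
  forall t, I t -> `|x1 t - x2 t| <= sup_constant * \int[mu]_(s in I) `|y1 s - y2 s|.
Proof.
move=> Ly1 Ly2 s1 s2 x1r x2r.
have Ly := LpmB p_gt1 Ly1 Ly2.
have [[mx1 _] x1E] := s1; have [[mx2 _] x2E] := s2.
have iu1 := Lpm_row_integrable p_gt1 pq (solves_Lpm p_gt1 lk Ly1 s1).
have iu2 := Lpm_row_integrable p_gt1 pq (solves_Lpm p_gt1 lk Ly2 s2).
have iu := row_integrableB iu1 iu2.
pose U t s := Psi t s (x1 s) - Psi t s (x2 s).
have mU t : I t -> measurable_row (U t).
  by move=> It; apply: measurable_rowB; exact: lk_measurable_section.
have UC t s : I t -> I s -> `|U t s| <= kC (t, s) * `|x1 s - x2 s|.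
  by move=> It Is; apply: lipL; [exact: x1r|exact: x2r].
have xE t : I t -> x1 t - x2 t = vint (fun s => (y1 s - volterra Psi x1 s) -
    (y2 s - volterra Psi x2 s)) t.
  by move=> It; rewrite vintB// -x1E// -x2E.
have uU t : I t -> `|(y1 t - volterra Psi x1 t) - (y2 t - volterra Psi x2 t)| <=
    `|y1 t - y2 t| + `|vint (U t) 1|.
  move=> It; have i1 : I 1 by apply/in01.
  have -> : vint (U t) 1 = volterra Psi x1 t - volterra Psi x2 t :=
    vintB (lk_integrable_section mx1 x1r It) (lk_integrable_section mx2 x2r It) i1.
  exact: norm_sub_sub.
have y0 t : I t -> 0 <= `|y1 t - y2 t| by [].
have [] // := ball_estimate (measurable_norm01 Ly.1) y0 Ly.2 mU UC iu xE uU.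
Qed.

Lemma linear_stable h x v : Lpm p h -> measurable_row x ->
  (forall s, I s -> `|x s| <= r) -> solves (linear_kernel x) h v ->
  [/\ forall t, I t -> `|v t| <= sup_constant * \int[mu]_(s in I) `|h s|,
      Lpm p (fun s => h s - volterra (linear_kernel x) v s) &
      \int[mu]_(t in I) `|h t - volterra (linear_kernel x) v t| `^ p <=
      norm_constant * \int[mu]_(t in I) `|h t| `^ p].
Proof.
move=> Lh mx xr [bv vE].
have lT := linear_lipschitz_kernel mx xr.
have iu := Lpm_row_integrable p_gt1 pq (lipschitz_kernel_Lpm p_gt1 G0 lT Lh bv).
pose U t s := linear_kernel x t s (v s).
have mU t : I t -> measurable_row (U t).
  by move=> It; exact: (lip_measurable_section lT t bv.1).
have UC t s : I t -> I s -> `|U t s| <= kC (t, s) * `|v s|.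
  by move=> It Is; apply: jacL; exact: extend0_le.
have uU t : I t -> `|h t - volterra (linear_kernel x) v t| <= `|h t| + `|vint (U t) 1|.
  by move=> It; exact: ler_normB.
have h0 t : I t -> 0 <= `|h t| by [].
exact: (ball_estimate (measurable_norm01 Lh.1) h0 Lh.2 mU UC iu vE uU).
Qed.

(** The error [xh - x - v] solves, up to sign of the source, the linear problem at [x] driven by the
    Taylor remainder of [Psi] between [x] and [xh]; the data [y] and [h] cancel. *)
Lemma ball_frechet y h x xh v (sigma : R * R -> R) (d M : R) :
  Lpm p y -> Lpm p h -> 0 <= d -> 0 <= M -> measurable_fun setT sigma ->
  (forall t s, I t -> I s -> 0 <= sigma (t, s) <= M * kC (t, s)) ->
  solves Psi y x -> solves Psi (fun t => y t + h t) xh ->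
  solves (linear_kernel x) h v -> Lpm p (fun t => y t + h t) ->
  (forall s, I s -> `|x s| <= r) -> (forall s, I s -> `|xh s| <= r) ->
  (forall t s, I t -> I s -> `|Psi t s (xh s) - Psi t s (x s) -
     linear_kernel x t s (xh s - x s)| <= d * sigma (t, s)) ->
  \int[mu]_(t in I) `|(y t + h t - volterra Psi xh t) - (y t - volterra Psi x t) -
     (h t - volterra (linear_kernel x) v t)| `^ p <=
  norm_constant * (d `^ p * \int[mu]_(t in I) (\int[mu]_(s in I) sigma (t, s)) `^ p).
Proof.
move=> Ly Lh d0 M0 ms sM sx sxh sv Lyh xr xhr hs.
have [[mx _] xE] := sx; have [[mxh _] xhE] := sxh; have [bv vE] := sv.
have lT := linear_lipschitz_kernel mx xr.
have iux := Lpm_row_integrable p_gt1 pq (solves_Lpm p_gt1 lk Ly sx).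
have iuxh := Lpm_row_integrable p_gt1 pq (solves_Lpm p_gt1 lk Lyh sxh).
have iuv := Lpm_row_integrable p_gt1 pq (lipschitz_kernel_Lpm p_gt1 G0 lT Lh bv).
have iu := row_integrableB (row_integrableB iuxh iux) iuv.
pose U t s := Psi t s (xh s) - Psi t s (x s) - linear_kernel x t s (v s).
have mU t : I t -> measurable_row (U t).
  move=> It; apply: measurable_rowB; last exact: (lip_measurable_section lT t bv.1).
  by apply: measurable_rowB; exact: lk_measurable_section.
pose w t := xh t - x t - v t.
have UC t s : I t -> I s -> `|U t s| <= kC (t, s) * `|w s| + d * sigma (t, s).
  move=> It Is.
  have -> : U t s = linear_kernel x t s (w s) + (Psi t s (xh s) - Psi t s (x s) -
      linear_kernel x t s (xh s - x s)).
    rewrite /U /w /linear_kernel mulmxBl; set a := _ *m _; set b := _ *m _.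
    by rewrite [RHS]addrC -!addrA; congr (_ + (_ + _)); rewrite addrA addNr add0r.
  apply: le_trans (ler_normD _ _) _; apply: lerD; last exact: hs.
  by apply: jacL; exact: extend0_le.
have wE t : I t -> w t = vint (fun s => (y s + h s - volterra Psi xh s) -
    (y s - volterra Psi x s) - (h s - volterra (linear_kernel x) v s)) t.
  move=> It; rewrite (vintB (row_integrableB iuxh iux) iuv It) (vintB iuxh iux It).
  by rewrite -(xE t It) -(vE t It) -(xhE t It).
have i1 : I 1 by apply/in01.
have uU t : I t -> `|(y t + h t - volterra Psi xh t) - (y t - volterra Psi x t) -
    (h t - volterra (linear_kernel x) v t)| <= `|vint (U t) 1|.
  move=> It; have ixh := lk_integrable_section mxh xhr It.
  have ix := lk_integrable_section mx xr It.
  have il := lip_integrable_section lT bv It.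
  have e1 : vint (U t) 1 = vint (fun s => Psi t s (xh s) - Psi t s (x s)) 1 -
    volterra (linear_kernel x) v t := vintB (row_integrableB ixh ix) il i1.
  have e2 : vint (fun s => Psi t s (xh s) - Psi t s (x s)) 1 =
    volterra Psi xh t - volterra Psi x t := vintB ixh ix i1.
  rewrite e1 e2.
  exact: norm_cancel_sub2.
exact: (remainder_estimate d0 M0 ms sM mU UC iu wE uU).
Qed.

(** The splitting lets the kernel at [z] act on [v - v'] and the difference of the kernels act on
    [v'], the solution at the fixed base point, which is bounded by the size of [h]. *)
Lemma ball_derivative_diff h x z v v' (sigma : R * R -> R) (d M : R) :
  Lpm p h -> 0 <= d -> 0 <= M -> measurable_fun setT sigma ->
  (forall t s, I t -> I s -> 0 <= sigma (t, s) <= M * kC (t, s)) ->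
  measurable_row x -> measurable_row z ->
  (forall s, I s -> `|x s| <= r) -> (forall s, I s -> `|z s| <= r) ->
  solves (linear_kernel z) h v -> solves (linear_kernel x) h v' ->
  (forall t s, I t -> I s ->
    `|linear_kernel z t s (v' s) - linear_kernel x t s (v' s)| <= d * sigma (t, s)) ->
  \int[mu]_(t in I) `|(h t - volterra (linear_kernel z) v t) -
     (h t - volterra (linear_kernel x) v' t)| `^ p <=
  norm_constant * (d `^ p * \int[mu]_(t in I) (\int[mu]_(s in I) sigma (t, s)) `^ p).
Proof.
move=> Lh d0 M0 ms sM mx mz xr zr [bv vE] [bv' vE'] hs.
have lx := linear_lipschitz_kernel mx xr; have lz := linear_lipschitz_kernel mz zr.
have iuv := Lpm_row_integrable p_gt1 pq (lipschitz_kernel_Lpm p_gt1 G0 lz Lh bv).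
have iuv' := Lpm_row_integrable p_gt1 pq (lipschitz_kernel_Lpm p_gt1 G0 lx Lh bv').
have iu := row_integrableB iuv iuv'.
pose U t s := linear_kernel z t s (v s) - linear_kernel x t s (v' s).
have mU t : I t -> measurable_row (U t).
  move=> It; apply: measurable_rowB; first exact: (lip_measurable_section lz t bv.1).
  exact: (lip_measurable_section lx t bv'.1).
pose w t := v t - v' t.
have UC t s : I t -> I s -> `|U t s| <= kC (t, s) * `|w s| + d * sigma (t, s).
  move=> It Is.
  have -> : U t s = linear_kernel z t s (w s) +
      (linear_kernel z t s (v' s) - linear_kernel x t s (v' s)).
    by rewrite /U /w /linear_kernel mulmxBl addrA subrK.
  apply: le_trans (ler_normD _ _) _; apply: lerD; last exact: hs.
  by apply: jacL; exact: extend0_le.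
have wE t : I t -> w t = vint (fun s => (h s - volterra (linear_kernel z) v s) -
    (h s - volterra (linear_kernel x) v' s)) t.
  move=> It; rewrite (vintB iuv iuv' It).
  exact: (congr2 (fun a b => a - b) (vE t It) (vE' t It)).
have i1 : I 1 by apply/in01.
have uU t : I t -> `|(h t - volterra (linear_kernel z) v t) -
    (h t - volterra (linear_kernel x) v' t)| <= `|vint (U t) 1|.
  move=> It; have il := lip_integrable_section lz bv It.
  have il' := lip_integrable_section lx bv' It.
  have -> : vint (U t) 1 = volterra (linear_kernel z) v t -
    volterra (linear_kernel x) v' t := vintB il il' i1.
  exact: norm_cancel_sub.
exact: (remainder_estimate d0 M0 ms sM mU UC iu wE uU).
Qed.

End ball.
End linearization.

Lemma frechet_remainder (R : realType) (n : nat) (f : 'rV[R]_n -> 'rV[R]_n) (x : 'rV[R]_n) (e : R) :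
  differentiable f x -> 0 < e -> exists2 d : R, 0 < d &
  forall w : 'rV[R]_n, `|w - x| < d -> `|f w - f x - (w - x) *m 'J f x| <= e * `|w - x|.
Proof.
move=> df e0; have /eqaddoP/(_ e e0) := diff_locally df.
move=> /nbhs_ballP[d /= d0 dP]; exists d => // w wx.
have := dP (w - x); rewrite -ball_normE /ball_/= sub0r normrN => /(_ wx).
rewrite -[X in `|X| <= _ -> _]/(f (w - x + x) - (f x + 'd f x (w - x))).
by rewrite subrK opprD addrA /jacobian mul_rV_lin1.
Qed.

(** * Convergence to zero of the normalized remainders along sequences *)

Section continuity_moduli.
Context (R : realType) (n : nat).
Notation mu := (@lebesgue_measure R).
Local Notation I := (`[0%R, 1%R]%classic : set R).
Variables (p q : R).
Hypotheses (p_gt1 : 1 < p) (pq : p^-1 + q^-1 = 1).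
Implicit Types (x y z u v h : R -> 'rV[R]_n).

Let p_gt0 : 0 < p. Proof. exact: lt_trans ltr01 p_gt1. Qed.

Variables (Psi : R -> R -> 'rV[R]_n -> 'rV[R]_n) (A B C : R * R -> R) (Ga Gc : R).
Hypothesis lk : local_kernel p Psi A B C Ga Gc.

Section ball.
Variables (r L : R).
Hypotheses (r0 : 0 <= r) (L0 : 0 <= L).
Hypothesis lipL : forall t s (v w : 'rV[R]_n), `|v| <= r -> `|w| <= r ->
  `|Psi t s v - Psi t s w| <= L * C (t, s) * `|v - w|.
Hypothesis jacL : forall t s (v h : 'rV[R]_n), `|v| <= r ->
  `|h *m 'J (Psi t s) v| <= L * C (t, s) * `|h|.

Let section_constant (M : R) : 0 <= M -> forall t, I t ->
  (\int[mu]_(s in I) (M * (L * C (t, s)))%:E <= (M * L * Gc)%:E)%E.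
Proof.
move=> M0 t It; under eq_integral do rewrite mulrA.
apply: (section_scale (k := C)); rewrite ?mulr_ge0//; first exact: lk_measurableC lk.
  by move=> z; have [] := lk_ge0 lk z.
exact: lk_sectionC lk _ It.
Qed.

Let LC0 (z : R * R) : 0 <= L * C z.
Proof. by rewrite mulr_ge0//; have [] := lk_ge0 lk z. Qed.

Let mLC (M : R) : measurable_fun setT (fun z : R * R => M * (L * C z)).
Proof.
by apply: measurable_funM => //; apply: measurable_funM => //; exact: lk_measurableC lk.
Qed.

(* For [d = 0] the quotient is the junk value [0]; in [frechet_quotient_bound]
   the residual then vanishes as well. *)
Definition frechet_quotient x (d : R) x' (z : R * R) : R :=
  `|Psi z.1 z.2 (extend0 x' z.2) - Psi z.1 z.2 (extend0 x z.2) -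
    linear_kernel Psi x z.1 z.2 (extend0 x' z.2 - extend0 x z.2)| / d.

Lemma measurable_frechet_quotient x d x' : measurable_row x ->
  (forall s, I s -> `|x s| <= r) -> measurable_row x' ->
  measurable_fun setT (frechet_quotient x d x').
Proof.
move=> mx xr mx'; apply: measurable_funM => //; apply: measurable_row_norm => i.
have mlin : measurable_fun setT (fun z : R * R =>
    linear_kernel Psi x z.1 z.2 (extend0 x' z.2 - extend0 x z.2) 0 i).
  apply: (@caratheodory_measurable _ _ R n setT (fun (z : R * R) (w : 'rV[R]_n) =>
    linear_kernel Psi x z.1 z.2 w 0 i)
    (fun z : R * R => extend0 x' z.2 - extend0 x z.2)) => //.
  - by move=> w; exact: (measurable_linear_kernel lk).
  - move=> z _ w; apply: (@continuous_comp _ _ _ (linear_kernel Psi x z.1 z.2)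
      (fun u : 'rV[R]_n => u 0 i)); last exact: coord_continuous.
    exact: (lip_continuous (linear_lipschitz_kernel lk r0 L0 jacL mx xr)).
  - move=> j; rewrite (_ : (fun _ => _) = (fun z : R * R => extend0 x' z.2 0 j - extend0 x z.2 0 j)).
      by apply: measurable_funB; exact: measurable_extend0.
    by apply/funext => z; rewrite !mxE.
rewrite (_ : (fun _ => _) = (fun z : R * R => Psi z.1 z.2 (extend0 x' z.2) 0 i -
   Psi z.1 z.2 (extend0 x z.2) 0 i -
   linear_kernel Psi x z.1 z.2 (extend0 x' z.2 - extend0 x z.2) 0 i)).
  apply: measurable_funB => //; apply: measurable_funB;
    by apply: (lk_superposition lk) => j; exact: measurable_extend0.
by apply/funext => z; rewrite !mxE.
Qed.

Lemma frechet_residual_le t s (v w : 'rV[R]_n) : `|v| <= r -> `|w| <= r ->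
  `|Psi t s w - Psi t s v - (w - v) *m 'J (Psi t s) v| <=
  2 * (L * C (t, s)) * `|w - v|.
Proof.
move=> vr wr; apply: le_trans (ler_normB _ _) _.
by rewrite -mulrA mulr_natl mulr2n lerD// ?lipL// jacL.
Qed.

Lemma frechet_quotient_bound x d x' t s : I s -> 0 <= d ->
  `|x s| <= r -> `|x' s| <= r -> `|x' s - x s| <= d ->
  0 <= frechet_quotient x d x' (t, s) <= 2 * (L * C (t, s)) /\
  `|Psi t s (x' s) - Psi t s (x s) - linear_kernel Psi x t s (x' s - x s)| <=
  d * frechet_quotient x d x' (t, s).
Proof.
move=> Is d0 xr x'r xd; rewrite /frechet_quotient /linear_kernel /= !extend0E//.
have := frechet_residual_le t s xr x'r; move: `|_ - _ *m _| (normr_ge0 (Psi t s (x' s) -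
  Psi t s (x s) - (x' s - x s) *m 'J (Psi t s) (x s))) => N N0 NL.
have {}NL : N <= 2 * (L * C (t, s)) * d.
  by apply: le_trans NL _; rewrite ler_wpM2l// mulr_ge0.
rewrite (divr_ge0 N0 d0)/=; move: d0; rewrite le_eqVlt => /predU1P[d0|d0].
  by move: NL; rewrite -d0 invr0 !mulr0 => NL; split=> //; exact: mulr_ge0.
by split; [rewrite ler_pdivrMr|rewrite mulrC divfK ?gt_eqF].
Qed.

Lemma frechet_quotient_cvg0 x (X : nat -> R -> 'rV[R]_n) (d : nat -> R) :
  measurable_row x -> (forall s, I s -> `|x s| <= r) ->
  (forall m, measurable_row (X m)) -> (forall m s, I s -> `|X m s| <= r) ->
  (forall m, 0 <= d m) -> d @ \oo --> (0 : R) ->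
  (forall m s, I s -> `|X m s - x s| <= d m) ->
  \int[mu]_(t in I) (\int[mu]_(s in I) frechet_quotient x (d m) (X m) (t, s)) `^ p
    @[m --> \oo] --> (0 : R).
Proof.
move=> mx xr mX Xr d0 dcvg Xd.
apply: (iterated_dominated_cvg0 (k := fun z : R * R => 2 * (L * C z)) (G := 2 * L * Gc)
  (rho := fun m => frechet_quotient x (d m) (X m)) p_gt0 _ (mLC 2) _
  (section_constant (ler0n _ 2))).
- by move=> m; exact: measurable_frechet_quotient.
- move=> m t s It Is.
  by have [] := frechet_quotient_bound t Is (d0 m) (xr s Is) (Xr m s Is) (Xd m s Is).
move=> t s It Is; apply/cvgrPdist_le => e e0.
have nearx := frechet_remainder (lk_diff lk t s (x s)) e0.
have [eta eta0 etaP] := nearx.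
have /cvgrPdist_lt/(_ _ eta0) near1 := dcvg; apply: filterS near1 => m; rewrite sub0r normrN => dm.
rewrite sub0r normrN ger0_norm; last first.
  by have [/andP[]] := frechet_quotient_bound t Is (d0 m) (xr s Is) (Xr m s Is) (Xd m s Is).
rewrite /frechet_quotient/= /linear_kernel !extend0E//.
have := etaP (X m s) (le_lt_trans (Xd m s Is) (le_lt_trans (ler_norm _) dm)).
have := Xd m s Is; move: (d0 m); rewrite le_eqVlt => /predU1P[<-|dm0] Xdm.
  by rewrite invr0 mulr0 => _; exact: ltW.
rewrite ler_pdivrMr// => /le_trans; apply.
by rewrite ler_pM2l.
Qed.

(** A sum over the rows of the Jacobian difference replaces an operator norm: each summand is Borel,
    being built from [linear_kernel] at a fixed vector, and the sum times [|v|] bounds the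
    difference applied to [v]. *)
Definition jacobian_gap x x' (z : R * R) : R := \sum_(j < n)
  `|linear_kernel Psi x' z.1 z.2 (delta_mx 0 j) - linear_kernel Psi x z.1 z.2 (delta_mx 0 j)|.

Lemma jacobian_gap_bound x x' t s : I s -> `|x s| <= r -> `|x' s| <= r ->
  0 <= jacobian_gap x x' (t, s) <= (2 * n%:R) * (L * C (t, s)).
Proof.
move=> Is xr x'r; rewrite sumr_ge0//=.
apply: (@le_trans _ _ (\sum_(j < n) 2 * (L * C (t, s)))); last first.
  rewrite sumr_const card_ord -[leLHS]mulr_natr le_eqVlt; apply/orP; left; apply/eqP; ring.
apply: ler_sum => j _; rewrite /linear_kernel /= !extend0E//.
have d1 : `|delta_mx 0 j : 'rV[R]_n| <= 1.
  by apply: row_norm_le => // i; rewrite mxE eqxx; case: eqP => _; rewrite ?normr1 ?normr0.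
apply: le_trans (ler_normB _ _) _; rewrite mulr_natl mulr2n.
by apply: lerD; apply: le_trans (jacL _ _ _ _) _ => //; rewrite ler_piMr.
Qed.

Lemma linear_kernel_gap x x' t s (v : 'rV[R]_n) :
  `|linear_kernel Psi x' t s v - linear_kernel Psi x t s v| <=
  `|v| * jacobian_gap x x' (t, s).
Proof.
rewrite /linear_kernel -mulmxBr mulmx_sum_row.
apply: le_trans (ler_norm_sum _ _ _) _; rewrite mulr_sumr; apply: ler_sum => j _.
by rewrite normrZ /linear_kernel -mulmxBr -rowE ler_wpM2r// row_coord_le.
Qed.

Lemma measurable_jacobian_gap x x' : measurable_row x -> measurable_row x' ->
  measurable_fun setT (jacobian_gap x x').
Proof.
move=> mx mx'; apply: measurable_sum => j; apply: measurable_row_norm => i.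
rewrite (_ : (fun _ => _) = (fun z : R * R => linear_kernel Psi x' z.1 z.2 (delta_mx 0 j) 0 i -
   linear_kernel Psi x z.1 z.2 (delta_mx 0 j) 0 i)).
  by apply: measurable_funB; exact: (measurable_linear_kernel lk).
by apply/funext => z; exact: row_coordB.
Qed.

Lemma jacobian_gap_cvg0 x (X : nat -> R -> 'rV[R]_n) :
  measurable_row x -> (forall s, I s -> `|x s| <= r) ->
  (forall m, measurable_row (X m)) -> (forall m s, I s -> `|X m s| <= r) ->
  (forall s, I s -> X m s @[m --> \oo] --> x s) ->
  \int[mu]_(t in I) (\int[mu]_(s in I) jacobian_gap x (X m) (t, s)) `^ p
    @[m --> \oo] --> (0 : R).
Proof.
move=> mx xr mX Xr Xx.
apply: (iterated_dominated_cvg0 (k := fun z : R * R => 2 * n%:R * (L * C z))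
  (G := 2 * n%:R * L * Gc) (rho := fun m => jacobian_gap x (X m)) p_gt0 _ (mLC (2 * n%:R)) _
  (section_constant (mulr_ge0 (ler0n _ 2) (ler0n _ n)))).
- by move=> m; exact: measurable_jacobian_gap.
- by move=> m t s It Is; apply: jacobian_gap_bound; [|exact: xr|exact: Xr].
move=> t s It Is.
have cJ : 'J (Psi t s) (X m s) @[m --> \oo] --> 'J (Psi t s) (x s).
  have cc := @lk_C1 _ _ _ _ _ _ _ _ _ lk t s (x s).
  by apply: cvg_trans cc; apply: (@cvg_app _ _ _ _ (fun w => 'J (Psi t s) w) (Xx s Is)).
have c0 : \sum_(j < n) `|row j ('J (Psi t s) (X m s) - 'J (Psi t s) (x s))|
    @[m --> \oo] --> (0 : R).
  rewrite [X in _ --> X](_ : _ = \sum_(j < n) (0 : R)); last by rewrite big1.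
  apply: cvg_big => [|j _]; first exact: add_continuous.
  apply/cvgrPdist_le => e e0.
  move/cvgrPdist_le : cJ => /(_ e e0); apply: filterS => m.
  rewrite sub0r normrN normr_id -normrN opprB; apply: le_trans.
  by apply: row_norm_le => // i; rewrite mxE; exact: mx_coord_le.
apply: cvg_trans c0; apply: near_eq_cvg; apply: nearW => m.
apply: eq_bigr => j _; rewrite /linear_kernel /= !extend0E//.
by rewrite -mulmxBr -rowE.
Qed.

End ball.
End continuity_moduli.

(** * Moduli of differentiability and of continuity of the derivative *)

Section moduli.
Context (R : realType) (n : nat).
Notation mu := (@lebesgue_measure R).
Local Notation I := (`[0%R, 1%R]%classic : set R).
Variables (p q : R).
Hypotheses (p_gt1 : 1 < p) (pq : p^-1 + q^-1 = 1).
Implicit Types (x y z u v h : R -> 'rV[R]_n).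

Let p_gt0 : 0 < p. Proof. exact: lt_trans ltr01 p_gt1. Qed.

Lemma Lpm0 : @Lpm R n p (fun=> 0).
Proof.
split; first by move=> i; rewrite (_ : (fun _ => _) = cst 0) //; apply/funext => t; rewrite mxE.
rewrite (_ : (fun _ => _) = cst (0 `^ p)); first exact: integrable_cst01.
by apply/funext => t; rewrite normr0.
Qed.

Lemma LpmD u v : Lpm p u -> Lpm p v -> Lpm p (fun t => u t + v t).
Proof.
move=> Lu Lv; have := LpmB p_gt1 Lu (LpmB p_gt1 Lpm0 Lv).
by congr (Lpm p _); apply/funext => t; rewrite sub0r opprK.
Qed.

Definition pth_power_norm u : R := \int[mu]_(t in I) `|u t| `^ p.

Lemma pth_power_norm_ge0 u : 0 <= pth_power_norm u.
Proof. by apply: Rintegral_ge0 => t _; exact: powR_ge0. Qed.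

Lemma mean_norm_ge0 u : 0 <= \int[mu]_(t in I) `|u t|.
Proof. exact: Rintegral_ge0. Qed.

Lemma mean_norm_powR_le u : Lpm p u ->
  (\int[mu]_(t in I) `|u t|) `^ p <= pth_power_norm u.
Proof. by move=> [m_u iu]; apply: (jensen01 p_gt1 pq _ _ iu) => //; exact: measurable_norm01. Qed.

Lemma mean_norm_le u : Lpm p u -> \int[mu]_(t in I) `|u t| <= pth_power_norm u `^ p^-1.
Proof.
move=> Lu; have m0 := mean_norm_ge0 u.
have -> : \int[mu]_(t in I) `|u t| = (\int[mu]_(t in I) `|u t|) `^ p `^ p^-1.
  by rewrite -powRrM mulfV ?lt0r_neq0// powRr1.
apply: ge0_ler_powR; rewrite ?nnegrE ?invr_ge0 ?powR_ge0 ?pth_power_norm_ge0 ?(ltW p_gt0)//.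
exact: mean_norm_powR_le.
Qed.

Lemma mean_norm_cvg0 (h : nat -> R -> 'rV[R]_n) : (forall m, Lpm p (h m)) ->
  (forall m, pth_power_norm (h m) < m.+1%:R^-1) ->
  \int[mu]_(t in I) `|h m t| @[m --> \oo] --> (0 : R).
Proof.
move=> Lh hm; apply: (@squeeze_cvgr _ _ _ _ (fun=> 0) (fun m => m.+1%:R^-1 `^ p^-1)).
- apply: nearW => m; rewrite mean_norm_ge0/=; apply: le_trans (mean_norm_le (Lh m)) _.
  by apply: ge0_ler_powR; rewrite ?nnegrE ?invr_ge0 ?pth_power_norm_ge0 ?(ltW p_gt0) ?(ltW (hm m)).
- exact: cvg_cst.
- apply: cvg0_powR; rewrite ?invr_gt0//; exact: cvg_harmonic.
Qed.

Variables (Psi : R -> R -> 'rV[R]_n -> 'rV[R]_n) (A B C : R * R -> R) (Ga Gc : R).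
Hypothesis lk : local_kernel p Psi A B C Ga Gc.

(** The [+ 1] covers all data within distance one of [y], so a single radius, and with it a single
    [L], serves every perturbed solution. *)
Definition nearby_bound y : R := apriori_bound n B Ga (\int[mu]_(t in I) `|y t| + 1).

Lemma nearby_bound_ge0 y : 0 <= nearby_bound y.
Proof. by apply: (apriori_bound_ge0 lk); rewrite addr_ge0 ?mean_norm_ge0. Qed.

Lemma nearby_solution_le y z x : Lpm p y -> Lpm p z ->
  pth_power_norm (fun t => z t - y t) <= 1 -> solves Psi z x ->
  forall t, I t -> `|x t| <= nearby_bound y.
Proof.
move=> Ly Lz zy; apply: (solves_apriori p_gt1 pq lk Lz).
have Lzy := LpmB p_gt1 Lz Ly.
have izy := Lpm_norm_integrable p_gt1 pq Lzy.
have iy := Lpm_norm_integrable p_gt1 pq Ly.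
apply: (@le_trans _ _ (\int[mu]_(t in I) (`|y t| + `|z t - y t|))).
  apply: le_Rintegral => //; first exact: (Lpm_norm_integrable p_gt1 pq Lz).
    exact: integrable_addr.
  by move=> t _; rewrite -[z t in leLHS](subrK (y t)) addrC ler_normD.
rewrite RintegralD// lerD2l; apply: le_trans (mean_norm_le Lzy) _.
have -> : (1 : R) = 1 `^ p^-1 by rewrite powR1.
by rewrite ge0_ler_powR ?nnegrE ?invr_ge0 ?pth_power_norm_ge0 ?(ltW p_gt0).
Qed.

Lemma solution_le y x : Lpm p y -> solves Psi y x ->
  forall t, I t -> `|x t| <= nearby_bound y.
Proof.
move=> Ly; apply: (nearby_solution_le Ly Ly); rewrite /pth_power_norm.
under eq_Rintegral do rewrite subrr normr0 powR0 ?lt0r_neq0//.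
by rewrite Rintegral_cst01.
Qed.

Let modulus_step (k s m j c : R) : 0 <= k -> 0 <= s -> 0 <= j -> m <= c ->
  k * (s * m * j) <= k * s * j * c.
Proof.
by move=> k0 s0 j0 mc; rewrite (_ : k * (s * m * j) = k * s * j * m) ?ler_wpM2l ?mulr_ge0//; ring.
Qed.

(* Were there no such [d], perturbations [h m] with vanishing norm would
   contradict [frechet_quotient_cvg0]. *)
Lemma frechet_modulus y x (e : R) : Lpm p y -> solves Psi y x -> 0 < e ->
  exists2 d : R, 0 < d & forall h xh v, Lpm p h -> pth_power_norm h < d ->
    solves Psi (fun t => y t + h t) xh -> solves (linear_kernel Psi x) h v ->
    pth_power_norm (fun t => (y t + h t - volterra Psi xh t) - (y t - volterra Psi x t) -
      (h t - volterra (linear_kernel Psi x) v t)) <= e * pth_power_norm h.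
Proof.
move=> Ly sx e0; apply: contrapT => nd.
have /choice[w wP] (m : nat) : exists w : (R -> 'rV[R]_n) * (R -> 'rV[R]_n) * (R -> 'rV[R]_n),
    [/\ Lpm p w.1.1, pth_power_norm w.1.1 < m.+1%:R^-1,
      solves Psi (fun t => y t + w.1.1 t) w.1.2, solves (linear_kernel Psi x) w.1.1 w.2 &
      e * pth_power_norm w.1.1 < pth_power_norm (fun t => (y t + w.1.1 t - volterra Psi w.1.2 t) -
        (y t - volterra Psi x t) - (w.1.1 t - volterra (linear_kernel Psi x) w.2 t))].
  apply: contrapT => nw; apply: nd; exists m.+1%:R^-1; first by rewrite invr_gt0.
  move=> h xh v Lh hm sxh sv; rewrite leNgt; apply/negP => lt.
  exact: nw (ex_intro _ (h, xh, v) (And5 Lh hm sxh sv lt)).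
pose h m := (w m).1.1; pose X m := (w m).1.2; pose v m := (w m).2.
have Lh m : Lpm p (h m) by case: (wP m) => H _ _ _ _; exact: H.
have hm m : pth_power_norm (h m) < m.+1%:R^-1 by case: (wP m) => _ H _ _ _; exact: H.
have sX m : solves Psi (fun t => y t + h m t) (X m).
  by case: (wP m) => _ _ H _ _; exact: H.
have sv m : solves (linear_kernel Psi x) (h m) (v m).
  by case: (wP m) => _ _ _ H _; exact: H.
have Lyh m := LpmD Ly (Lh m).
have r0 := nearby_bound_ge0 y; set r := nearby_bound y in r0.
have [L L0 [lipL jacL]] := lk_lipschitz lk r0.
have yhE m : (fun t => y t + h m t - y t) = h m by apply/funext => t; rewrite addrC addKr.
have Xr m s : I s -> `|X m s| <= r.
  apply: (nearby_solution_le Ly (Lyh m) _ (sX m)); rewrite yhE.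
  by apply: ltW; apply: lt_le_trans (hm m) _; rewrite invf_le1 ?ler1n.
have xr := solution_le Ly sx.
pose S := sup_constant Gc L; pose K := norm_constant p Gc L.
have S0 : 0 <= S by rewrite mulr_ge0// expR_ge0.
have K0 : 0 <= K by rewrite mulr_ge0 ?addr_ge0 ?powR_ge0.
(* This denominator of the quotient bounds [|X m s - x s|] uniformly in [s], by [solves_stable]. *)
pose d m := S * \int[mu]_(t in I) `|h m t|.
have d0 m : 0 <= d m by rewrite mulr_ge0// mean_norm_ge0.
have dcvg : d @ \oo --> (0 : R).
  by rewrite -(mulr0 S); apply: cvgMr; exact: mean_norm_cvg0.
have Xd m s : I s -> `|X m s - x s| <= d m.
  move=> Is; have := solves_stable p_gt1 pq lk L0 lipL (Lyh m) Ly (sX m) sx (Xr m) xr Is.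
  have eqh : \int[mu]_(t in I) `|y t + h m t - y t| = \int[mu]_(t in I) `|h m t|.
    by apply: eq_Rintegral => t _; rewrite (_ : y t + _ - _ = h m t)// addrC addKr.
  by rewrite eqh.
have mX m : measurable_row (X m) := (sX m).1.1.
have mx : measurable_row x := sx.1.1.
pose sigma m := frechet_quotient Psi x (d m) (X m).
pose J m := \int[mu]_(t in I) (\int[mu]_(s in I) sigma m (t, s)) `^ p.
have J0 : J m @[m --> \oo] --> (0 : R) :=
  frechet_quotient_cvg0 p_gt1 lk r0 L0 lipL jacL mx xr mX Xr d0 dcvg Xd.
have bound m := ball_frechet p_gt1 pq lk r0 L0 jacL Ly (Lh m) (d0 m) (ler0n _ 2)
  (measurable_frechet_quotient lk r0 L0 jacL (d m) mx xr (mX m))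
  (fun t s It Is => (frechet_quotient_bound lk L0 lipL jacL t Is (d0 m) (xr s Is)
    (Xr m s Is) (Xd m s Is)).1) sx (sX m) (sv m) (Lyh m) xr (Xr m)
  (fun t s It Is => (frechet_quotient_bound lk L0 lipL jacL t Is (d0 m) (xr s Is)
    (Xr m s Is) (Xd m s Is)).2).
have : K * S `^ p * J m @[m --> \oo] --> (0 : R).
  by rewrite -(mulr0 (K * S `^ p)); exact: cvgMr.
(* At this [N] one has [K * S ^ p * J N <= e]. By Jensen [d N ^ p] is at most [S ^ p] times the
   [p]-th power norm of [h N], so the remainder is too small for the choice of [h N]. *)
move=> /cvgrPdist_le/(_ _ e0)[N _ /(_ N (leqnn N))].
rewrite /= sub0r normrN => /(le_trans (ler_norm _)) KJ.
have [_ _ _ _] := wP N; apply/negP; rewrite -leNgt.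
apply: le_trans (bound N) _; rewrite -/K -/(J N) /d powRM ?mean_norm_ge0//.
have JN0 : 0 <= J N by apply: Rintegral_ge0 => t _; exact: powR_ge0.
apply: le_trans (modulus_step K0 (powR_ge0 S p) JN0 (mean_norm_powR_le (Lh N))) _.
by rewrite ler_wpM2r ?pth_power_norm_ge0.
Qed.

(** By contradiction along sequences, as for [frechet_modulus], except that the directions [h m]
    need not tend to zero. Their size enters only through the factor [d m], while [sigma m] depends
    on [X m] alone and its integral vanishes as [X m] tends to [x]. *)
Lemma derivative_modulus y x (e : R) : Lpm p y -> solves Psi y x -> 0 < e ->
  exists2 d : R, 0 < d & forall z xz, Lpm p z -> pth_power_norm (fun t => z t - y t) < d ->
    solves Psi z xz -> forall h v v', Lpm p h ->
    solves (linear_kernel Psi xz) h v -> solves (linear_kernel Psi x) h v' ->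
    pth_power_norm (fun t => (h t - volterra (linear_kernel Psi xz) v t) -
      (h t - volterra (linear_kernel Psi x) v' t)) <= e * pth_power_norm h.
Proof.
move=> Ly sx e0; apply: contrapT => nd.
have /choice[w wP] (m : nat) : exists w : (R -> 'rV[R]_n) * (R -> 'rV[R]_n) *
      ((R -> 'rV[R]_n) * (R -> 'rV[R]_n) * (R -> 'rV[R]_n)),
    ([/\ Lpm p w.1.1, pth_power_norm (fun t => w.1.1 t - y t) < m.+1%:R^-1 &
      solves Psi w.1.1 w.1.2]) /\
    [/\ Lpm p w.2.1.1, solves (linear_kernel Psi w.1.2) w.2.1.1 w.2.1.2,
      solves (linear_kernel Psi x) w.2.1.1 w.2.2 &
      e * pth_power_norm w.2.1.1 < pth_power_norm (fun t =>
        (w.2.1.1 t - volterra (linear_kernel Psi w.1.2) w.2.1.2 t) -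
        (w.2.1.1 t - volterra (linear_kernel Psi x) w.2.2 t))].
  apply: contrapT => nw; apply: nd; exists m.+1%:R^-1; first by rewrite invr_gt0.
  move=> z xz Lz zm sz h v v' Lh sv sv'; rewrite leNgt; apply/negP => lt.
  exact: nw (ex_intro _ (z, xz, (h, v, v')) (conj (And3 Lz zm sz) (And4 Lh sv sv' lt))).
pose z m := (w m).1.1; pose X m := (w m).1.2; pose h m := (w m).2.1.1.
pose v m := (w m).2.1.2; pose v' m := (w m).2.2.
have Lz m : Lpm p (z m) by case: (wP m) => -[H _ _] _; exact: H.
have zm m : pth_power_norm (fun t => z m t - y t) < m.+1%:R^-1.
  by case: (wP m) => -[_ H _] _; exact: H.
have sX m : solves Psi (z m) (X m) by case: (wP m) => -[_ _ H] _; exact: H.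
have Lh m : Lpm p (h m) by case: (wP m) => _ [H _ _ _]; exact: H.
have sv m : solves (linear_kernel Psi (X m)) (h m) (v m).
  by case: (wP m) => _ [_ H _ _]; exact: H.
have sv' m : solves (linear_kernel Psi x) (h m) (v' m).
  by case: (wP m) => _ [_ _ H _]; exact: H.
have Lzy m := LpmB p_gt1 (Lz m) Ly.
have r0 := nearby_bound_ge0 y; set r := nearby_bound y in r0.
have [L L0 [lipL jacL]] := lk_lipschitz lk r0.
have Xr m s : I s -> `|X m s| <= r.
  apply: (nearby_solution_le Ly (Lz m) _ (sX m)).
  by apply: ltW; apply: lt_le_trans (zm m) _; rewrite invf_le1 ?ler1n.
have xr := solution_le Ly sx.
pose S := sup_constant Gc L; pose K := norm_constant p Gc L.
have S0 : 0 <= S by rewrite mulr_ge0// expR_ge0.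
have K0 : 0 <= K by rewrite mulr_ge0 ?addr_ge0 ?powR_ge0.
have dcvg : S * \int[mu]_(t in I) `|z m t - y t| @[m --> \oo] --> (0 : R).
  rewrite -[X in _ --> X](mulr0 S); apply: cvgMr.
  exact: (mean_norm_cvg0 (h := fun m t => z m t - y t) Lzy zm).
have Xx s : I s -> X m s @[m --> \oo] --> x s.
  move=> Is; apply/cvgrPdist_le => c c0.
  move/cvgrPdist_le : dcvg => /(_ c c0); apply: filterS => m.
  rewrite sub0r normrN => /(le_trans (ler_norm _)); apply: le_trans.
  rewrite distrC.
  exact: (solves_stable p_gt1 pq lk L0 lipL (Lz m) Ly (sX m) sx (Xr m) xr Is).
have mX m : measurable_row (X m) := (sX m).1.1.
have mx : measurable_row x := sx.1.1.
pose sigma m := jacobian_gap Psi x (X m).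
pose J m := \int[mu]_(t in I) (\int[mu]_(s in I) sigma m (t, s)) `^ p.
have J0 : J m @[m --> \oo] --> (0 : R) :=
  jacobian_gap_cvg0 p_gt1 lk L0 jacL mx xr mX Xr Xx.
pose d m := S * \int[mu]_(t in I) `|h m t|.
have d0 m : 0 <= d m by rewrite mulr_ge0// mean_norm_ge0.
have gap0 m t s : I t -> I s -> 0 <= sigma m (t, s) <= 2 * n%:R * (L * C (t, s)).
  by move=> It Is; exact: (jacobian_gap_bound lk L0 jacL t Is (xr s Is) (Xr m s Is)).
have gap m t s : I t -> I s -> `|linear_kernel Psi (X m) t s (v' m s) -
    linear_kernel Psi x t s (v' m s)| <= d m * sigma m (t, s).
  move=> It Is; apply: le_trans (linear_kernel_gap _ _ _ _ _ _) _.
  apply: ler_wpM2r; first by have /andP[] := gap0 m t s It Is.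
  by have [+ _ _] := linear_stable p_gt1 pq lk r0 L0 jacL (Lh m) mx xr (sv' m); exact.
have bound m := ball_derivative_diff p_gt1 pq lk r0 L0 jacL (Lh m) (d0 m)
  (mulr_ge0 (ler0n _ 2) (ler0n _ n)) (measurable_jacobian_gap lk mx (mX m))
  (gap0 m) mx (mX m) xr (Xr m) (sv m) (sv' m) (gap m).
have : K * S `^ p * J m @[m --> \oo] --> (0 : R).
  by rewrite -(mulr0 (K * S `^ p)); exact: cvgMr.
move=> /cvgrPdist_le/(_ _ e0)[N _ /(_ N (leqnn N))].
rewrite /= sub0r normrN => /(le_trans (ler_norm _)) KJ.
have [_ [_ _ _]] := wP N; apply/negP; rewrite -leNgt.
apply: le_trans (bound N) _; rewrite -/K -/(J N) /d powRM ?mean_norm_ge0//.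
have JN0 : 0 <= J N by apply: Rintegral_ge0 => t _; exact: powR_ge0.
apply: le_trans (modulus_step K0 (powR_ge0 S p) JN0 (mean_norm_powR_le (Lh N))) _.
by rewrite ler_wpM2r ?pth_power_norm_ge0.
Qed.

End moduli.

(** * The Sobolev formulation *)

Section solution_bridge.
Context (R : realType) (n : nat).
Notation mu := (@lebesgue_measure R).
Local Notation I := (`[0%R, 1%R]%classic : set R).
Variables (p q : R).
Hypotheses (p_gt1 : 1 < p) (pq : p^-1 + q^-1 = 1).
Implicit Types (x y z u v h : R -> 'rV[R]_n).

Lemma ae_eq_vint u v t : I t -> ae_eq mu I u v -> vint u t = vint v t.
Proof.
move=> It uv; apply/rowP => i; rewrite !mxE; apply: ae_eq_Rintegral_nonmeas.
apply: ae_imply uv => s us st; rewrite us//.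
by move: It st => /in01[_ t1]; rewrite /= !in_itv/= => /andP[-> /le_trans->].
Qed.

Lemma W01p_representative u x : Lpm p u -> (forall t, I t -> x t = vint u t) ->
  exists z, [/\ W01p p z, forall t, I t -> z t = x t & ae_eq mu I (z^`())%classic u].
Proof.
move=> Lu xu; exists (vint (fun t => if t \in I then u t else 0)).
have [Wz zu] := vint_W01p p_gt1 pq Lu; split => //.
by move=> t It; rewrite xu//; apply: eq_vint => // s Is; rewrite mem_set.
Qed.

Variables (Phi Psi : R -> R -> 'rV[R]_n -> 'rV[R]_n) (A B C : R * R -> R) (Ga Gc : R).
Hypothesis lk : local_kernel p Psi A B C Ga Gc.
Hypothesis Phi_Psi : {ae mu, forall t, I t ->
  {ae mu, forall s, PDelta R (t, s) -> Phi t s = Psi t s}}.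

Lemma row_integral_volterra x : {ae mu, forall t, I t ->
  \row_(i < n) (\int[mu]_(s in `[0, t]) (Phi t s (x s) 0 i)) = volterra Psi x t}.
Proof.
apply: ae_imply Phi_Psi => t PP It; have /in01[t0 t1] := It.
apply/rowP => i; rewrite !mxE.
transitivity (\int[mu]_(s in `[0, t]) (Psi t s (x s) 0 i)).
  apply: ae_eq_Rintegral_nonmeas; apply: ae_imply (PP It) => s Pst.
  rewrite /= in_itv/= => /andP[s0 st]; rewrite Pst//.
  by split; rewrite /= ?t0 ?t1 ?s0 ?(le_trans st).
(* The domains [[0, t]] and [[0, 1]] give the same integral because [Psi] vanishes above the
   diagonal. *)
rewrite Rintegral_mkcond [RHS]Rintegral_mkcond; congr Rintegral.
apply/funext => s; rewrite !patchE !mem_setE !in_itv/=.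
have [s0|//] := leP 0 s; have [st|ts] /= := leP s t; first by rewrite (le_trans st).
have [|-> _ _] := lk_zero lk (t := t) (s := s); last by rewrite mxE; case: ifP.
by case=> _ _ /=; rewrite leNgt ts.
Qed.

(** A Borel representative [w] of the derivative has [x] as its primitive, by [W01p_vint], and the
    equation identifies [w] a.e. with [u] minus the Volterra term. *)
Lemma is_solution_solves x y u : Lpm p u -> ae_eq mu I y u -> is_solution p Phi y x ->
  solves Psi u x /\ ae_eq mu I (x^`())%classic (fun t => u t - volterra Psi x t).
Proof.
move=> Lu yu [Wx xsol]; have [_ _ _ Lx'] := Wx.
have [w Lw xw] := Lp_repr p_gt1 Lx'.
have xE := W01p_vint p_gt1 pq Wx Lw xw.
have bx : bounded_row x.
  apply: (@eq_bounded_row _ _ (vint w)); first by move=> t It; rewrite xE.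
  exact: (vint_bounded_row (Lpm_row_integrable p_gt1 pq Lw)).
have x'E : ae_eq mu I (x^`())%classic (fun t => u t - volterra Psi x t).
  apply: ae_imply2 (ae_imply2 (fun t => @conj _ _) xsol (row_integral_volterra x)) yu.
  by move=> t [xt vt] yt It; rewrite -(yt It) -(xt It) (vt It) addrK.
split=> //; split=> // t It; rewrite xE//; apply: ae_eq_vint => //.
by apply: ae_imply2 x'E xw => s xs ws Is; rewrite -(ws Is) (xs Is).
Qed.

Lemma solves_is_solution x z y u : Lpm p u -> ae_eq mu I y u -> solves Psi u x ->
  W01p p z -> (forall t, I t -> z t = x t) ->
  ae_eq mu I (z^`())%classic (fun t => u t - volterra Psi x t) -> is_solution p Phi y z.
Proof.
move=> Lu yu sx Wz zx z'E; split=> //.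
apply: ae_imply2 (ae_imply2 (fun t => @conj _ _) z'E (row_integral_volterra z)) yu.
move=> t [zt vt] yt It; rewrite (yt It) (zt It) (vt It).
have -> : volterra Psi z t = volterra Psi x t by exact: eq_volterra.
by rewrite subrK.
Qed.

End solution_bridge.

Section linear_combinations.
Context (R : realType) (n : nat).
Notation mu := (@lebesgue_measure R).
Local Notation I := (`[0%R, 1%R]%classic : set R).
Variables (p q : R).
Hypotheses (p_gt1 : 1 < p) (pq : p^-1 + q^-1 = 1).
Implicit Types (x y z u v h : R -> 'rV[R]_n).

Lemma LpmZ (a : R) u : Lpm p u -> Lpm p (fun t => a *: u t).
Proof.
move=> [m_u iu]; apply: (@Lpm_le _ _ _ p_gt1 _ (fun t => `|a| * `|u t|)).
- move=> i; rewrite (_ : (fun _ => _) = (fun t => a * u t 0 i)).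
    by apply: measurable_funM => //; exact: m_u.
  by apply/funext => t; rewrite mxE.
- by move=> t _; rewrite normrZ.
rewrite (_ : EFin \o _ = EFin \o (fun t => `|a| `^ p * `|u t| `^ p)).
  exact: integrable_mull.
by apply/funext => t /=; rewrite powRM.
Qed.

Lemma Lpm_combine a u v h : Lpm p u -> Lpm p v -> Lpm p h ->
  Lpm p (fun t => u t - (a *: v t + h t)).
Proof. by move=> Lu Lv Lh; exact: (LpmB p_gt1 Lu (LpmD p_gt1 (LpmZ a Lv) Lh)). Qed.

Lemma vint_combine a u v h t : row_integrable u -> row_integrable v ->
  row_integrable h -> I t ->
  vint (fun s => u s - (a *: v s + h s)) t = vint u t - (a *: vint v t + vint h t).
Proof.
move=> iu iv ih /in01[t0 t1]; apply/rowP => i; rewrite !mxE.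
have int w : row_integrable w -> mu.-integrable `[0, t] (EFin \o (fun s => w s 0 i)).
  by move=> iw; apply: integrableS (row_integrable_coord i iw) => //; exact: subset_itv01.
have [iu' iv' ih'] := And3 (int _ iu) (int _ iv) (int _ ih).
have iav : mu.-integrable `[0, t] (EFin \o (fun s => a * v s 0 i)) by exact: integrable_mull.
rewrite -RintegralZl// -RintegralD// -RintegralB//; last exact: integrable_addr.
by apply: eq_Rintegral => s _; rewrite !mxE.
Qed.

Variables (Psi : R -> R -> 'rV[R]_n -> 'rV[R]_n) (A B C : R * R -> R) (Ga Gc : R).
Hypothesis lk : local_kernel p Psi A B C Ga Gc.
Variables (r : R) (x : R -> 'rV[R]_n).
Hypotheses (r0 : 0 <= r) (mx : measurable_row x) (xr : forall s, I s -> `|x s| <= r).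

Let lin := linear_kernel Psi x.

Lemma linear_kernel_lipschitz :
  exists (k : R * R -> R) (G : R), 0 < G /\ lipschitz_kernel p lin k (fun=> 0) G.
Proof.
have [L L0 [lipL jacL]] := lk_lipschitz lk r0.
exists (fun z : R * R => L * C z), (L * Gc + 1); split; first exact: (LGc_gt0 lk L0).
exact: (linear_lipschitz_kernel lk r0 L0 jacL mx xr).
Qed.

Lemma linear_solvable h : Lpm p h -> exists v, solves lin h v.
Proof.
move=> Lh; have [k [G [G0 lT]]] := linear_kernel_lipschitz.
have [v bv vE] := lip_existence p_gt1 pq G0 lT Lh.
by exists v; split.
Qed.

Lemma linear_solves_Lpm h v : Lpm p h -> solves lin h v ->
  Lpm p (fun t => h t - volterra lin v t).
Proof.
move=> Lh [bv _]; have [k [G [G0 lT]]] := linear_kernel_lipschitz.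
exact: (lipschitz_kernel_Lpm p_gt1 G0 lT Lh bv).
Qed.

Let regroup (a : R) (h0 h1 h2 w0 w1 w2 : 'rV[R]_n) :
  (h0 - w0) - (a *: (h1 - w1) + (h2 - w2)) =
  (h0 - (a *: h1 + h2)) - (w0 - (a *: w1 + w2)).
Proof. by apply/rowP => i; rewrite !mxE; ring. Qed.

(** Representatives and solutions are chosen independently for [h0], [h1] and [h2], so linearity is
    reached by estimating the defect: it solves the same linear problem, with the defect of the data
    as right-hand side. *)
Lemma linear_combine (a : R) h0 h1 h2 v0 v1 v2 :
  Lpm p h0 -> Lpm p h1 -> Lpm p h2 ->
  solves lin h0 v0 -> solves lin h1 v1 -> solves lin h2 v2 ->
  solves lin (fun t => h0 t - (a *: h1 t + h2 t)) (fun t => v0 t - (a *: v1 t + v2 t)) /\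
  forall t, I t -> (h0 t - volterra lin v0 t) -
    (a *: (h1 t - volterra lin v1 t) + (h2 t - volterra lin v2 t)) =
    (h0 t - (a *: h1 t + h2 t)) - volterra lin (fun t => v0 t - (a *: v1 t + v2 t)) t.
Proof.
move=> L0 L1 L2 s0 s1 s2; have [k [G [G0 lT]]] := linear_kernel_lipschitz.
have K0 := linear_solves_Lpm L0 s0; have K1 := linear_solves_Lpm L1 s1.
have K2 := linear_solves_Lpm L2 s2.
have E t : I t -> (h0 t - volterra lin v0 t) -
    (a *: (h1 t - volterra lin v1 t) + (h2 t - volterra lin v2 t)) =
    (h0 t - (a *: h1 t + h2 t)) - volterra lin (fun t => v0 t - (a *: v1 t + v2 t)) t.
  move=> It; rewrite regroup; congr (_ - _).
  have i1 : I 1 by apply/in01.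
  have iv v : bounded_row v -> row_integrable (fun s => lin t s (v s)).
    by move=> bv; exact: (lip_integrable_section lT bv It).
  have := vint_combine a (iv v0 s0.1) (iv v1 s1.1) (iv v2 s2.1) i1.
  rewrite -/(volterra lin v0 t) -/(volterra lin v1 t) -/(volterra lin v2 t) => <-.
  by apply: eq_vint => // s Is; rewrite /lin /linear_kernel mulmxBl mulmxDl -scalemxAl.
split; last exact: E.
pose D t := v0 t - (a *: v1 t + v2 t).
pose w t := (h0 t - volterra lin v0 t) -
    (a *: (h1 t - volterra lin v1 t) + (h2 t - volterra lin v2 t)).
have ri u : Lpm p u -> row_integrable u by move=> Lu; exact: (Lpm_row_integrable p_gt1 pq Lu).
have iw : row_integrable w := ri _ (Lpm_combine a K0 K1 K2).
have DE t : I t -> D t = vint w t.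
  move=> It; rewrite /D (s0.2 t It) (s1.2 t It) (s2.2 t It); apply/esym.
  exact: (vint_combine a (ri _ K0) (ri _ K1) (ri _ K2) It).
split; first by apply: (@eq_bounded_row _ _ (vint w)) (vint_bounded_row iw) => t It; exact/esym/DE.
move=> t It; apply: (eq_trans (DE t It)); apply: eq_vint => [//|s Is]; exact: E.
Qed.

End linear_combinations.

Section norms.
Context (R : realType) (n : nat).
Notation mu := (@lebesgue_measure R).
Local Notation I := (`[0%R, 1%R]%classic : set R).
Variable p : R.
Hypothesis p_gt1 : 1 < p.
Implicit Types (x y z u v h : R -> 'rV[R]_n).

Let p_gt0 : 0 < p. Proof. exact: lt_trans ltr01 p_gt1. Qed.

Let powR_invK (a : R) : 0 <= a -> a `^ p `^ p^-1 = a.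
Proof. by move=> a0; rewrite -powRrM mulfV ?lt0r_neq0// powRr1. Qed.

Let invK_powR (a : R) : 0 <= a -> a `^ p^-1 `^ p = a.
Proof. by move=> a0; rewrite -powRrM mulVf ?lt0r_neq0// powRr1. Qed.

Let ler_powR_inv (a b : R) : 0 <= a -> a <= b -> a `^ p^-1 <= b `^ p^-1.
Proof.
move=> a0 ab; apply: ge0_ler_powR; rewrite ?nnegrE ?invr_ge0 ?(ltW p_gt0)//.
exact: le_trans ab.
Qed.

Lemma Lp_norm_ge0 u : 0 <= Lp_norm p u. Proof. exact: powR_ge0. Qed.

Lemma pth_power_norm_le_Lp_norm u : Lpm p u -> pth_power_norm p u <= Lp_norm p u `^ p.
Proof.
move=> Lu; rewrite /Lp_norm invK_powR; last by apply: Rintegral_ge0 => t _; exact: powR_ge0.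
apply: le_Rintegral => //; first exact: Lu.2; first exact: (Lpm_enorm_integrable p_gt1 Lu).
move=> t _; apply: ge0_ler_powR; rewrite ?nnegrE ?(ltW p_gt0) ?enorm_ge0//.
exact: norm_le_enorm.
Qed.

Lemma Lp_norm_le_pth_power_norm u : Lpm p u ->
  Lp_norm p u <= n%:R * pth_power_norm p u `^ p^-1.
Proof.
move=> Lu; rewrite -[n%:R](powR_invK (ler0n _ n)) -powRM ?powR_ge0 ?pth_power_norm_ge0//.
apply: ler_powR_inv; first by apply: Rintegral_ge0 => t _; exact: powR_ge0.
rewrite -RintegralZl//; last exact: Lu.2.
apply: le_Rintegral => //; first exact: (Lpm_enorm_integrable p_gt1 Lu).
  by apply: integrable_mull => //; exact: Lu.2.
move=> t _; rewrite -powRM//; apply: ge0_ler_powR; rewrite ?nnegrE ?(ltW p_gt0) ?enorm_ge0 ?mulr_ge0//.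
exact: enorm_le_norm.
Qed.

(** Estimates are proved for [p]-th powers in the sup norm; taking the root and returning to the
    Euclidean norm costs the factor [n%:R]. *)
Lemma Lp_norm_le_scaled u h (c : R) : Lpm p u -> Lpm p h -> 0 <= c ->
  pth_power_norm p u <= c `^ p * pth_power_norm p h ->
  Lp_norm p u <= n%:R * c * Lp_norm p h.
Proof.
move=> Lu Lh c0 uh; apply: le_trans (Lp_norm_le_pth_power_norm Lu) _.
rewrite -mulrA ler_wpM2l// -[leRHS]powR_invK ?mulr_ge0 ?Lp_norm_ge0//.
apply: ler_powR_inv; first exact: pth_power_norm_ge0.
apply: le_trans uh _; rewrite powRM ?Lp_norm_ge0// ler_wpM2l ?powR_ge0//.
exact: pth_power_norm_le_Lp_norm.
Qed.

Lemma Lp_norm_eq0 u : Lpm p u -> pth_power_norm p u <= 0 -> Lp_norm p u = 0.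
Proof.
move=> Lu u0; have e0 : pth_power_norm p u = 0.
  by apply/eqP; rewrite eq_le u0 pth_power_norm_ge0.
apply/eqP; rewrite eq_le Lp_norm_ge0 andbT.
apply: le_trans (Lp_norm_le_pth_power_norm Lu) _.
by rewrite e0 powR0 ?mulr0 ?invr_eq0 ?lt0r_neq0.
Qed.

Definition ae_derive z u := {ae mu, forall t, I t -> is_derive t (1 : R) z (u t)}.

Lemma W01p_ae_derive z u : W01p p z -> ae_eq mu I (z^`())%classic u -> ae_derive z u.
Proof.
move=> [_ _ dz _]; apply: ae_imply2 dz => t dz zu It.
by apply: DeriveDef; [exact: dz|rewrite -derive1E zu].
Qed.

Lemma ae_derive_W01p_norm z u : ae_derive z u -> W01p_norm p z = Lp_norm p u.
Proof.
move=> dz; apply: Lp_norm_ae; apply: ae_imply dz => t dz It.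
by rewrite derive1E; have := dz It => H; rewrite derive_val.
Qed.

Lemma ae_deriveB z1 z2 u1 u2 : ae_derive z1 u1 -> ae_derive z2 u2 ->
  ae_derive (z1 - z2) (fun t => u1 t - u2 t).
Proof.
by apply: ae_imply2 => t d1 d2 It; apply: is_deriveB; [exact: d1|exact: d2].
Qed.

Lemma ae_derive_lin (a : R) z1 z2 u1 u2 : ae_derive z1 u1 -> ae_derive z2 u2 ->
  ae_derive (a *: z1 + z2) (fun t => a *: u1 t + u2 t).
Proof.
apply: ae_imply2 => t d1 d2 It; apply: is_deriveD; last exact: d2.
by apply: is_deriveZ; exact: d1.
Qed.

End norms.

(** * Differentiability of the solution operator *)

Section solution_operator.
Context (R : realType) (n : nat).
Notation mu := (@lebesgue_measure R).
Local Notation I := (`[0%R, 1%R]%classic : set R).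
Variables (p q : R).
Hypotheses (p_gt1 : 1 < p) (pq : p^-1 + q^-1 = 1) (n_gt0 : (0 < n)%N).
Implicit Types (x y z u v h : R -> 'rV[R]_n).

Let p_gt0 : 0 < p. Proof. exact: lt_trans ltr01 p_gt1. Qed.

Lemma pth_power_norm_ae0 h : ae_eq mu I h (fun=> 0) -> pth_power_norm p h = 0.
Proof.
move=> h0; rewrite /pth_power_norm.
have -> := ae_eq_Rintegral_comp (fun v : 'rV[R]_n => `|v| `^ p) h0.
under eq_Rintegral do rewrite normr0 powR0 ?lt0r_neq0//.
by rewrite Rintegral_cst01.
Qed.

Variables (Psi : R -> R -> 'rV[R]_n -> 'rV[R]_n) (A B C : R * R -> R) (Ga Gc : R).
Hypothesis lk : local_kernel p Psi A B C Ga Gc.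

(** [z] is tied to [v] only through its derivative, which is all that [W01p_norm] sees; [v] is the
    bounded solution of the linear problem, [z] its counterpart in [W01p]. *)
Definition tangent x h z v :=
  [/\ solves (linear_kernel Psi x) h v, W01p p z &
      ae_derive z (fun t => h t - volterra (linear_kernel Psi x) v t)].

Section base_point.
Variables (y x : R -> 'rV[R]_n).
Hypotheses (Ly : Lpm p y) (sx : solves Psi y x).

Let r := nearby_bound B Ga y.
Let r0 : 0 <= r. Proof. exact: (nearby_bound_ge0 lk). Qed.
Let xr : forall s, I s -> `|x s| <= r. Proof. exact: (solution_le p_gt1 pq lk Ly sx). Qed.
Let mx : measurable_row x. Proof. exact: sx.1.1. Qed.

Lemma tangent_exists h : Lpm p h -> exists zv, tangent x h zv.1 zv.2.
Proof.
move=> Lh; have [v sv] := linear_solvable p_gt1 pq lk r0 mx xr Lh.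
have Lw := linear_solves_Lpm p_gt1 lk r0 mx xr Lh sv.
have [z [Wz _ zw]] := W01p_representative p_gt1 pq Lw sv.2.
by exists (z, v); split; [exact: sv|exact: Wz|exact: (W01p_ae_derive Wz zw)].
Qed.

Lemma tangent_linear (a : R) h0 h1 h2 z0 z1 z2 v0 v1 v2 :
  Lpm p h0 -> Lpm p h1 -> Lpm p h2 -> ae_eq mu I h0 (fun t => a *: h1 t + h2 t) ->
  tangent x h0 z0 v0 -> tangent x h1 z1 v1 -> tangent x h2 z2 v2 ->
  W01p_norm p (z0 - (a *: z1 + z2)) = 0.
Proof.
move=> L0 L1 L2 h012 [s0 _ d0] [s1 _ d1] [s2 _ d2].
rewrite (ae_derive_W01p_norm _ (ae_deriveB d0 (ae_derive_lin a d1 d2))).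
have [sD wE] := linear_combine p_gt1 pq lk r0 mx xr a L0 L1 L2 s0 s1 s2.
rewrite (Lp_norm_ae p (aeW mu wE)).
have [L L_ge0 [_ jacL]] := lk_lipschitz lk r0.
have LD := Lpm_combine p_gt1 a L0 L1 L2.
have [_ Lw wK] := linear_stable p_gt1 pq lk r0 L_ge0 jacL LD mx xr sD.
have hh0 : pth_power_norm p (fun t => h0 t - (a *: h1 t + h2 t)) = 0.
  by apply: pth_power_norm_ae0; apply: ae_imply h012 => t e It; rewrite e// subrr.
apply: (Lp_norm_eq0 p_gt1 Lw); apply: (le_trans wK).
by rewrite -/(pth_power_norm p _) hh0 mulr0.
Qed.

Lemma tangent_bounded : exists K : R, forall h z v, Lpm p h -> tangent x h z v ->
  W01p_norm p z <= K * Lp_norm p h.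
Proof.
have [L L_ge0 [_ jacL]] := lk_lipschitz lk r0.
pose K := norm_constant p Gc L.
have K0 : 0 <= K by rewrite mulr_ge0 ?addr_ge0 ?powR_ge0.
exists (n%:R * K `^ p^-1) => h z v Lh [sv _ dz].
rewrite (ae_derive_W01p_norm _ dz).
have [_ Lw wK] := linear_stable p_gt1 pq lk r0 L_ge0 jacL Lh mx xr sv.
apply: (Lp_norm_le_scaled p_gt1 Lw Lh (powR_ge0 _ _)).
by rewrite -powRrM mulVf ?lt0r_neq0// powRr1.
Qed.

Let scaled_eps (e : R) : 0 < e -> exists2 c, 0 < c & n%:R * c = e.
Proof.
by move=> e0; exists (e / n%:R); rewrite ?divr_gt0 ?ltr0n// mulrC divfK// pnatr_eq0 -lt0n.
Qed.

Let Lp_norm_small h (d : R) : Lpm p h -> 0 < d -> Lp_norm p h < d `^ p^-1 ->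
  pth_power_norm p h < d.
Proof.
move=> Lh d0 hd; apply: le_lt_trans (pth_power_norm_le_Lp_norm p_gt1 Lh) _.
have := @gt0_ltr_powR R p p_gt0 (Lp_norm p h) (d `^ p^-1).
rewrite !nnegrE Lp_norm_ge0 powR_ge0 -powRrM mulVf ?lt0r_neq0// powRr1 ?ltW//.
exact.
Qed.

Lemma tangent_frechet (e : R) : 0 < e -> ae_derive x (fun t => y t - volterra Psi x t) ->
  exists2 d : R, 0 < d & forall h xh z v, Lpm p h -> Lp_norm p h < d ->
    solves Psi (fun t => y t + h t) xh ->
    ae_derive xh (fun t => y t + h t - volterra Psi xh t) -> tangent x h z v ->
    W01p_norm p (xh - x - z) <= e * Lp_norm p h.
Proof.
move=> e0 dx; have [c c0 ce] := scaled_eps e0.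
(* The modulus compares [p]-th powers in the sup norm. So it is applied to [c ^ p] with
   [n%:R * c = e], and the resulting threshold [d] is replaced by its [p]-th root. *)
have [d d0 dP] := frechet_modulus p_gt1 pq lk Ly sx (powR_gt0 p c0).
exists (d `^ p^-1); first exact: powR_gt0.
move=> h xh z v Lh hd sxh dxh [sv _ dz].
rewrite (ae_derive_W01p_norm _ (ae_deriveB (ae_deriveB dxh dx) dz)) -ce.
apply: (Lp_norm_le_scaled p_gt1 _ Lh (ltW c0)).
  apply: (LpmB p_gt1); last exact: (linear_solves_Lpm p_gt1 lk r0 mx xr Lh sv).
  apply: (LpmB p_gt1); last exact: (solves_Lpm p_gt1 lk Ly sx).
  exact: (solves_Lpm p_gt1 lk (LpmD p_gt1 Ly Lh) sxh).
exact: (dP _ _ _ Lh (Lp_norm_small Lh d0 hd) sxh sv).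
Qed.

Lemma tangent_continuous (e : R) : 0 < e ->
  exists2 d : R, 0 < d & forall y' x', Lpm p y' -> Lp_norm p (fun t => y' t - y t) < d ->
    solves Psi y' x' -> forall h z z' v v', Lpm p h ->
    tangent x' h z' v' -> tangent x h z v ->
    W01p_norm p (z' - z) <= e * Lp_norm p h.
Proof.
move=> e0; have [c c0 ce] := scaled_eps e0.
have [d d0 dP] := derivative_modulus p_gt1 pq lk Ly sx (powR_gt0 p c0).
exists (d `^ p^-1); first exact: powR_gt0.
move=> y' x' Ly' hd sx' h z z' v v' Lh [sv' _ dz'] [sv _ dz].
rewrite (ae_derive_W01p_norm _ (ae_deriveB dz' dz)) -ce.
apply: (Lp_norm_le_scaled p_gt1 _ Lh (ltW c0)).
  apply: (LpmB p_gt1); last exact: (linear_solves_Lpm p_gt1 lk r0 mx xr Lh sv).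
  exact: (linear_solves_Lpm p_gt1 lk (nearby_bound_ge0 lk y') sx'.1.1
    (solution_le p_gt1 pq lk Ly' sx') Lh sv').
exact: (dP _ _ Ly' (Lp_norm_small (LpmB p_gt1 Ly' Ly) d0 hd) sx' _ _ _ Lh sv' sv).
Qed.

End base_point.
End solution_operator.

Section well_posedness.
Context (R : realType) (n : nat).
Notation mu := (@lebesgue_measure R).
Local Notation I := (`[0%R, 1%R]%classic : set R).
Variables (p q : R).
Hypotheses (p_gt1 : 1 < p) (pq : p^-1 + q^-1 = 1) (n_gt0 : (0 < n)%N).
Implicit Types (x y z u v h : R -> 'rV[R]_n).

Variables (Phi Psi : R -> R -> 'rV[R]_n -> 'rV[R]_n) (A B C : R * R -> R) (Ga Gc : R).
Hypothesis lk : local_kernel p Psi A B C Ga Gc.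
Hypothesis Phi_Psi : {ae mu, forall t, I t ->
  {ae mu, forall s, PDelta R (t, s) -> Phi t s = Psi t s}}.

Lemma solution_exists_unique y : Lp p y -> exists2 x, is_solution p Phi y x &
  forall x', is_solution p Phi y x' -> forall t, 0 <= t <= 1 -> x' t = x t.
Proof.
move=> /(Lp_repr p_gt1)[u Lu yu].
have [x sx] := solves_exists p_gt1 pq lk Lu.
have [z [Wz zx zw]] := W01p_representative p_gt1 pq (solves_Lpm p_gt1 lk Lu sx) sx.2.
have sz := solves_is_solution lk Phi_Psi Lu yu sx Wz zx zw.
exists z; first exact: sz.
move=> z' sz' t t01; have It : I t by rewrite /= in_itv.
have [sol' _] := is_solution_solves p_gt1 pq lk Phi_Psi Lu yu sz'.
have [sol _] := is_solution_solves p_gt1 pq lk Phi_Psi Lu yu sz.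
have [L L0 [lipL _]] := lk_lipschitz lk (nearby_bound_ge0 lk u).
have := solves_stable p_gt1 pq lk L0 lipL Lu Lu sol' sol
  (solution_le p_gt1 pq lk Lu sol') (solution_le p_gt1 pq lk Lu sol) It.
under eq_Rintegral do rewrite subrr normr0.
by rewrite Rintegral_cst01 mulr0 normr_le0 subr_eq0 => /eqP.
Qed.

(** [S] is any selector of solutions. Choice supplies Borel representatives [rep h] of the data and
    tangents [F (y, h)], whose first components form the derivative; the seminorms do not see a.e.
    changes, so these choices are harmless. *)
Lemma solution_operator_C1 S : (forall y, Lp p y -> is_solution p Phi y (S y)) ->
  continuously_differentiable (Lp p) (Lp_norm p) (W01p p) (W01p_norm p) S.
Proof.
move=> SP.
have /choice[rep repP] (h : R -> 'rV[R]_n) : exists u, Lp p h -> Lpm p u /\ ae_eq mu I h u.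
  have [Lh|nLh] := pselect (Lp p h); last by exists h.
  by have [u Lu hu] := Lp_repr p_gt1 Lh; exists u.
have Lrep h : Lp p h -> Lpm p (rep h) by move=> /repP[].
have aerep h : Lp p h -> ae_eq mu I h (rep h) by move=> /repP[].
have sol y u : Lpm p u -> ae_eq mu I y u -> solves Psi u (S y) /\
    ae_derive (S y) (fun t => u t - volterra Psi (S y) t).
  move=> Lu yu; have sy := SP y (Lpm_Lp p_gt1 Lu yu).
  have [sSy dSy] := is_solution_solves p_gt1 pq lk Phi_Psi Lu yu sy.
  by split; [exact: sSy|exact: (W01p_ae_derive sy.1 dSy)].
have srep y : Lp p y -> solves Psi (rep y) (S y).
  by move=> Ly; have [] := sol y (rep y) (Lrep y Ly) (aerep y Ly).
have /choice[F FP] (yh : (R -> 'rV[R]_n) * (R -> 'rV[R]_n)) : exists zv,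
    Lp p yh.1 -> Lp p yh.2 -> tangent p Psi (S yh.1) (rep yh.2) zv.1 zv.2.
  have [Ly|nLy] := pselect (Lp p yh.1); last by exists yh => /nLy[].
  have [Lh|nLh] := pselect (Lp p yh.2); last by exists yh => _ /nLh[].
  have [zv zvP] := tangent_exists p_gt1 pq lk (Lrep _ Ly) (srep _ Ly) (Lrep _ Lh).
  by exists zv => _ _; exact: zvP.
have tan y h : Lp p y -> Lp p h -> tangent p Psi (S y) (rep h) (F (y, h)).1 (F (y, h)).2.
  by move=> Ly Lh; exact: (FP (y, h) Ly Lh).
have normE h : Lp p h -> Lp_norm p (rep h) = Lp_norm p h.
  by move=> Lh; rewrite (Lp_norm_ae p (aerep h Lh)).
split; first by move=> y Ly; have [] := SP y Ly.
exists (fun y h => (F (y, h)).1) => y Ly.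
  split; first split.
  - by move=> h Lh; have [_ Wz _] := tan y h Ly Lh.
  - move=> a h k Lh Lk.
    have hk : ae_eq mu I (a *: h + k) (fun t => a *: rep h t + rep k t).
      by apply: ae_imply2 (aerep h Lh) (aerep k Lk) => t eh ek It; rewrite -(eh It) -(ek It).
    have Lrhk := LpmD p_gt1 (LpmZ p_gt1 a (Lrep h Lh)) (Lrep k Lk).
    have Lhk : Lp p (a *: h + k) := Lpm_Lp p_gt1 Lrhk hk.
    apply: (tangent_linear p_gt1 pq lk (Lrep y Ly) (srep y Ly) (Lrep _ Lhk) (Lrep h Lh)
      (Lrep k Lk) _ (tan y _ Ly Lhk) (tan y h Ly Lh) (tan y k Ly Lk)).
    by apply: ae_imply2 (aerep _ Lhk) hk => t e1 e2 It; rewrite -(e1 It) (e2 It).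
  - have [K KP] := tangent_bounded p_gt1 pq lk (Lrep y Ly) (srep y Ly).
    exists K => h Lh; rewrite -(normE h Lh).
    exact: (KP _ _ _ (Lrep h Lh) (tan y h Ly Lh)).
  move=> e e0.
  have [sSy dSy] := sol y (rep y) (Lrep y Ly) (aerep y Ly).
  have [d d0 dP] := tangent_frechet p_gt1 pq n_gt0 lk (Lrep y Ly) sSy e0 dSy.
  exists d; first exact: d0.
  move=> h Lh; rewrite -(normE h Lh) => hd.
  (* [rep (y + h)] need not be [rep y + rep h], and [tangent_frechet] wants the latter; both
     represent [y + h], and [sol] accepts any representative. *)
  have yh : ae_eq mu I (y + h) (fun t => rep y t + rep h t).
    by apply: ae_imply2 (aerep y Ly) (aerep h Lh) => t ey eh It; rewrite -(ey It) -(eh It).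
  have [sSyh dSyh] := sol (y + h) _ (LpmD p_gt1 (Lrep y Ly) (Lrep h Lh)) yh.
  exact: (dP _ _ _ _ (Lrep h Lh) hd sSyh dSyh (tan y h Ly Lh)).
move=> e e0.
have [d d0 dP] := tangent_continuous p_gt1 pq n_gt0 lk (Lrep y Ly) (srep y Ly) e0.
exists d; first exact: d0.
move=> z Lz zd h Lh; rewrite -(normE h Lh).
have zy : ae_eq mu I (z - y) (fun t => rep z t - rep y t).
  by apply: ae_imply2 (aerep z Lz) (aerep y Ly) => t ez ey It; rewrite -(ez It) -(ey It).
rewrite (Lp_norm_ae p zy) in zd.
exact: (dP _ _ (Lrep z Lz) zd (srep z Lz) _ _ _ _ _ (Lrep h Lh) (tan z h Lz Lh) (tan y h Ly Lh)).
Qed.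

End well_posedness.

Theorem theorem4p5 (R : realType) (p q : R) (n : nat)
    (Phi : R -> R -> 'rV[R]_n -> 'rV[R]_n)
    (p_gt1 : 1 < p) (pq : p^-1 + q^-1 = 1) (n_gt0 : (0 < n)%N)
    (Phi_measurable : forall (x : 'rV[R]_n) (i : 'I_n),
      ae_measurable (leb2 R) (PDelta R) (fun z : R * R => Phi z.1 z.2 x 0 i))
    (Phi_C1 : {ae leb2 R, forall z : R * R, PDelta R z ->
      (forall x, differentiable (Phi z.1 z.2) x) /\
      continuous (fun x => 'J (Phi z.1 z.2) x)})
    (Phi_growth : exists a b : R * R -> R,
      [/\ (forall z, PDelta R z -> 0 <= a z /\ 0 <= b z),
          Lp_scalar (leb2 R) (PDelta R) p a,
          Lp_scalar (leb2 R) (PDelta R) p b,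
          {ae leb2 R, forall z : R * R, PDelta R z ->
            forall x, enorm (Phi z.1 z.2 x) <= a z * enorm x + b z}
        & exists2 abar : R, 0 < abar &
          {ae @lebesgue_measure R, forall t : R, `[0, 1]%classic t ->
            (\int[lebesgue_measure]_(s in `[0%R, t]) (a (t, s) `^ p)%:E
               <= (abar `^ p)%:E)%E}])
    (Phi_x_bound : exists (c : R * R -> R) (alpha : R -> R) (C : R),
      [/\ (forall z, PDelta R z -> 0 <= c z) /\
            Lp_scalar (leb2 R) (PDelta R) p c,
          (forall r, 0 <= r -> 0 <= alpha r) /\
            {within `[0, +oo[, continuous alpha},
          0 < C,
          {ae leb2 R, forall z : R * R, PDelta R z ->
            forall x, opnorm ('J (Phi z.1 z.2) x) <= c z * alpha (enorm x)}
        & {ae @lebesgue_measure R, forall t : R, `[0, 1]%classic t ->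
            (\int[lebesgue_measure]_(s in `[0%R, t]) (c (t, s) `^ q)%:E
               <= C%:E)%E}]) :
  (forall y, Lp p y ->
     exists2 x, is_solution p Phi y x &
       forall x', is_solution p Phi y x' ->
         forall t, 0 <= t <= 1 -> x' t = x t) /\
  (forall S : (R -> 'rV[R]_n) -> (R -> 'rV[R]_n),
     (forall y, Lp p y -> is_solution p Phi y (S y)) ->
     continuously_differentiable (Lp p) (Lp_norm p) (W01p p) (W01p_norm p) S).
Proof.
have [a [b [ab0 La Lb growth [abar abar0 abarP]]]] := Phi_growth.
have [c [alpha [Cc [[c0 Lc] [alpha0 alpha_cont] Cc0 jacobian_le CcP]]]] := Phi_x_bound.
have [Psi [A [B [C [Ga [Gc [lk Phi_Psi]]]]]]] := ae_borel_kernel p_gt1 pq Phi_measurable Phi_C1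
  (fun z Dz => (ab0 z Dz).1) (fun z Dz => (ab0 z Dz).2) c0 La.1 Lb Lc.1 growth abarP
  alpha0 alpha_cont jacobian_le (ltW Cc0) CcP.
split; first exact: (solution_exists_unique p_gt1 pq lk Phi_Psi).
exact: (solution_operator_C1 p_gt1 pq n_gt0 lk Phi_Psi).
Qed.
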